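(* Let $\Gamma\subset\mathbb{C}$ be a lattice and let $\hat\Gamma\subset\Gamma$ be a subgroup of index $2$. Write $\wp(z),\zeta(z),\sigma(z)$ for the Weierstrass functions corresponding to $\Gamma$ and $\hat\wp(z),\hat\zeta(z),\hat\sigma(z)$ for the Weierstrass functions corresponding to $\hat\Gamma$. Fix $\omega_1\in\hat\Gamma\setminus 2\Gamma$ and $\omega_2\in\Gamma\setminus\hat\Gamma$. Let $e_1,e_2,e_3$ be the (distinct) roots of the polynomial $4x^3-g_2(\Gamma)x-g_3(\Gamma)$, numbered so that $e_1=\wp(\omega_1/2)$, and let $\hat e_1,\hat e_2,\hat e_3$ be the roots of $4x^3-g_2(\hat\Gamma)x-g_3(\hat\Gamma)$, numbered so that $\hat e_1=\hat\wp(\omega_2)$. Then the following hold. (i) The Weierstrass functions satisfy $$\wp(z)=\hat\wp(z)+\frac{(\hat e_2-\hat e_1)(\hat e_3-\hat e_1)}{\hat\wp(z)-\hat e_1},$$ $$\wp'(z)=\hat\wp'(z)\left(1-\frac{(\hat e_2-\hat e_1)(\hat e_3-\hat e_1)}{(\hat\wp(z)-\hat e_1)^2}\right),$$ $$\zeta(z)=2\hat\zeta(z)+\frac12\,\frac{\hat\wp'(z)}{\hat\wp(z)-\hat e_1}+\hat e_1 z,$$ $$\sigma^2(z)=\exp(\hat e_1z^2)\,(\hat\wp(z)-\hat e_1)\,\hat\sigma^4(z).$$ (ii) The roots satisfy $$\hat e_1=-\frac{e_1}{2},\qquad 16(\hat e_2-\hat e_1)(\hat e_3-\hat e_1)=(e_2-e_3)^2.$$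 (iii) The Weierstrass invariants satisfy $$g_2(\hat\Gamma)=\frac{3e_1^2}{4}+(e_1-e_2)(e_1-e_3),$$ $$g_3(\hat\Gamma)=-\frac{e_1^3}{8}+\frac{e_1}{2}(e_1-e_2)(e_1-e_3),$$ $$\Delta(\hat\Gamma)=\frac1{16}(e_1-e_2)(e_1-e_3)(e_2-e_3)^4.$$
   Context: A lattice is a discrete additive subgroup of $\mathbb{C}$ of rank $2$. For a discrete subgroup $\Gamma\subset\mathbb{C}$ the Weierstrass functions are $$\wp(z;\Gamma)=\frac1{z^2}+\sum_{u\in\Gamma\setminus\{0\}}\left(\frac1{(z-u)^2}-\frac1{u^2}\right),\quad \zeta(z;\Gamma)=\frac1z+\sum_{u\in\Gamma\setminus\{0\}}\left(\frac1{z-u}+\frac1u+\frac z{u^2}\right),$$ $$\sigma(z;\Gamma)=z\prod_{u\in\Gamma\setminus\{0\}}\left(1-\frac zu\right)e^{\frac zu+\frac{z^2}{2u^2}},$$ and $g_2(\Gamma)=\sum_{u\in\Gamma\setminus\{0\}}60u^{-4}$, $g_3(\Gamma)=\sum_{u\in\Gamma\setminus\{0\}}140u^{-6}$, $\Delta(\Gamma)=g_2(\Gamma)^3-27g_3(\Gamma)^2$. The prime denotes the derivative in $z$. Any subgroup of index $2$ in a lattice is itself a lattice. The identities in (i) are identities of meromorphic functions of $z\in\mathbb{C}$. *)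

(* Defs.v *)
(* The complex plane is R[i], for any realType R. *)
From HB Require Import structures.
From mathcomp Require Import all_boot all_order all_algebra finmap.
From mathcomp Require Import all_classical all_reals all_analysis.
From mathcomp Require Import complex.
From mathcomp.analysis.showcase Require Import summability.

Set Implicit Arguments.
Unset Strict Implicit.
Unset Printing Implicit Defensive.

Import Order.TTheory GRing.Theory Num.Theory.
Import numFieldNormedType.Exports.

Local Open Scope classical_set_scope.
Local Open Scope ring_scope.
Local Open Scope complex_scope.

(* R[i] carries the topology of its modulus and is a normed space over itself,
   so that derive1 below is the complex derivative. *)
HB.instance Definition _ (R : realType) :=
  NormedModule.copy R[i] (R[i] : numFieldType).

Definition cexp (R : realType) (z : R[i]) : R[i] :=
  (expR (complex.Re z))%:C * (cos (complex.Im z) +i* sin (complex.Im z)).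

Definition subgroup (R : realType) (G : set R[i]) : Prop :=
  G 0 /\ forall u v, G u -> G v -> G (u - v).

(* Every point is isolated, i.e. the subspace topology is discrete. *)
Definition discrete_subset (R : realType) (G : set R[i]) : Prop :=
  G `<=` isolated G.

(* G is free abelian on two generators. Independence is over the integers;
   independence over R is a consequence of discreteness. *)
Definition rank_two (R : realType) (G : set R[i]) : Prop :=
  exists u v : R[i],
    (forall m n : int, u *~ m + v *~ n = 0 -> m = 0 /\ n = 0) /\
    G = [set u *~ m + v *~ n | m in [set: int] & n in [set: int]].

Definition lattice (R : realType) (G : set R[i]) : Prop :=
  [/\ subgroup G, discrete_subset G & rank_two G].

(* There are exactly two cosets, H and w + H. *)
Definition index_two (R : realType) (H G : set R[i]) : Prop :=
  [/\ subgroup H, H `<=` G &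
      exists2 w, (G `\` H) w & forall u, G u -> H u \/ H (u - w)].

(* Unordered sum and product over S: limits of the finite partial sums and
   products along the directed family of finite sets (filter totally); f is
   replaced by the neutral element outside S. *)
Definition sum_over (R : realType) (S : set R[i]) (f : R[i] -> R[i]) : R[i] :=
  sum (patch (fun=> 0) S f).

Definition prod_over (R : realType) (S : set R[i]) (f : R[i] -> R[i]) : R[i] :=
  lim ((fun A : {fset R[i]} => \prod_(u : A) patch (fun=> 1) S f (val u))
       @ totally).

(* Since 0^-1 = 0, weierstrass_p and weierstrass_zeta take meaningless values
   at the points of G, which are their poles. *)
Definition weierstrass_p (R : realType) (G : set R[i]) (z : R[i]) : R[i] :=
  1 / z ^+ 2 +
  sum_over (G `\ 0) (fun u => 1 / (z - u) ^+ 2 - 1 / u ^+ 2).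

Definition weierstrass_zeta (R : realType) (G : set R[i]) (z : R[i]) : R[i] :=
  1 / z + sum_over (G `\ 0) (fun u => 1 / (z - u) + 1 / u + z / u ^+ 2).

Definition weierstrass_sigma (R : realType) (G : set R[i]) (z : R[i]) : R[i] :=
  z * prod_over (G `\ 0)
        (fun u => (1 - z / u) * cexp (z / u + z ^+ 2 / (2 * u ^+ 2))).

Definition weierstrass_g2 (R : realType) (G : set R[i]) : R[i] :=
  sum_over (G `\ 0) (fun u => 60 * u ^- 4).

Definition weierstrass_g3 (R : realType) (G : set R[i]) : R[i] :=
  sum_over (G `\ 0) (fun u => 140 * u ^- 6).

Definition weierstrass_disc (R : realType) (G : set R[i]) : R[i] :=
  weierstrass_g2 G ^+ 3 - 27 * weierstrass_g3 G ^+ 2.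

Definition weierstrass_cubic (R : realType) (G : set R[i]) : {poly R[i]} :=
  4 *: 'X^3 - weierstrass_g2 G *: 'X - (weierstrass_g3 G)%:P.

(* e1, e2, e3 are the roots of the cubic p, listed with multiplicity. *)
Definition cubic_roots (R : realType) (p : {poly R[i]}) (e1 e2 e3 : R[i]) :
    Prop :=
  p = lead_coef p *: (('X - e1%:P) * ('X - e2%:P) * ('X - e3%:P)).

(* Main.v *)
Require Import Defs.
From HB Require Import structures.
From mathcomp Require Import all_boot all_order all_algebra finmap.
From mathcomp Require Import all_classical all_reals all_analysis.
From mathcomp Require Import complex ring lra.
From mathcomp.analysis.showcase Require Import summability.

Set Implicit Arguments.
Unset Strict Implicit.
Unset Printing Implicit Defensive.

Import Order.TTheory GRing.Theory Num.Theory.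
Import numFieldNormedType.Exports.

Local Open Scope classical_set_scope.
Local Open Scope ring_scope.
Local Open Scope complex_scope.

(** Write L for the subgroup of index two, w for omega_2, so that the larger lattice is the
    union of L and of the coset D = w + L, and P for the function wp of L, with e = P(w).

    Sums over the larger lattice split into a sum over L and one over D. With
    p = P - e, with q the wp series over D and h the zeta series over D minus zeta and e z,
    this says that its functions are wp = P + q and zeta = 2 zeta_L + h + e z. Translating
    the index set gives p(z + w) = q(z), and h is odd, L-periodic and changes sign under
    translation by w. The function p' - 2 h p is L-periodic; its polar parts at 0 and at w
    cancel and it vanishes there, so by Liouville's theorem p' = 2 h p (wp_gap_ode). In
    the same way p q is a constant c (wp_gap_coset_cst), and comparing coefficients at 0 gives
    c = 3 e ^ 2 - g2(L) / 4 (gap_cst_g2), which is the product of the differences of roots, and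
    g2 = g2(L) + 20 c for the larger lattice. Dividing by p yields the formulas for wp, its
    derivative and zeta.

    The division needs p <> 0 away from the larger lattice, and that comes with the identity
    for sigma: the quotient of its two sides has logarithmic derivative 0, again because
    p' = 2 h p, and the value 1 at 0; the complement of the lattice points other than 0 is
    connected by polygons, so the quotient is identically 1 (sigma_isogeny, wp_gap_neq0).

    For (ii) the same theory is applied to the second half period v = omega_1 / 2 of L. The two
    relations p q = c, for w and for v, show that the values of P at w, v and v + w add up to 0
    (half_period_sum). As e1 = P(v) + q(v) = P(v) + P(v + w) - e, this gives e1 = - 2 e. All
    remaining identities follow from c, e, g2 and the symmetric functions of the roots.

    Analyticity enters through second-order expansions with explicit majorants (jet). They
    can be multiplied and summed over infinite families, and they are just strong enough for
    Liouville's theorem, which is proved by comparing with a logarithmic barrier in the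
    maximum principle for the four-point Laplacian. All series are majorised by the sum of
    the inverse cubes |u| ^ - 3 over the lattice G / 2, which contains D and the half periods.
    The lattice has a real basis because it is discrete (lattice_basis). *)

(** * The real-valued modulus *)

Section Modulus.
Variable R : realType.
Local Notation C := R[i].
Implicit Types x y z : C.

(** The norm of R[i] takes its values in R[i]; estimates are made with real numbers. *)
Definition cmod (z : C) : R := complex.Re `|z|.

Lemma cmodE z : (cmod z)%:C = `|z|.
Proof. by rewrite /cmod RRe_real // ger0_real. Qed.

Lemma cmod_ge0 z : 0 <= cmod z.
Proof. by rewrite -lecR cmodE normr_ge0. Qed.

Lemma cmod0 : cmod 0 = 0.
Proof. by apply: complexI; rewrite cmodE normr0. Qed.

Lemma cmod1 : cmod 1 = 1.
Proof. by apply: complexI; rewrite cmodE normr1. Qed.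

Lemma cmodN z : cmod (- z) = cmod z.
Proof. by rewrite /cmod normrN. Qed.

Lemma cmodB x y : cmod (x - y) = cmod (y - x).
Proof. by rewrite -cmodN opprB. Qed.

Lemma cmodM x y : cmod (x * y) = cmod x * cmod y.
Proof. by apply: complexI; rewrite rmorphM /= !cmodE normrM. Qed.

Lemma cmodX x n : cmod (x ^+ n) = cmod x ^+ n.
Proof. by apply: complexI; rewrite rmorphXn /= !cmodE normrX. Qed.

Lemma cmodV x : cmod x^-1 = (cmod x)^-1.
Proof. by apply: complexI; rewrite fmorphV /= !cmodE normfV. Qed.

Lemma cmod_real (r : R) : cmod r%:C = `|r|.
Proof.
by apply: complexI; rewrite cmodE normc_def /= expr0n /= addr0 sqrtr_sqr.
Qed.

Lemma cmod_nat n : cmod n%:R = n%:R.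
Proof. by apply: complexI; rewrite cmodE normr_nat rmorph_nat. Qed.

Lemma cmod_eq0 z : (cmod z == 0) = (z == 0).
Proof. by rewrite -[LHS](inj_eq (@complexI R)) cmodE normr_eq0. Qed.

Lemma cmod_gt0 z : (0 < cmod z) = (z != 0).
Proof. by rewrite lt_def cmod_eq0 cmod_ge0 andbT. Qed.

Lemma cmodD x y : cmod (x + y) <= cmod x + cmod y.
Proof. by rewrite -lecR rmorphD /= !cmodE ler_normD. Qed.

Lemma cmodDB x y : cmod x - cmod y <= cmod (x - y).
Proof. by rewrite -lecR rmorphB /= !cmodE lerB_dist. Qed.

Lemma cmod_sum (I : Type) (s : seq I) (P : pred I) (F : I -> C) :
  cmod (\sum_(i <- s | P i) F i) <= \sum_(i <- s | P i) cmod (F i).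
Proof.
elim/big_rec2 : _ => [|i b a _ H]; first by rewrite cmod0.
by apply: (le_trans (cmodD _ _)); rewrite lerD2l.
Qed.

Lemma cmod_Re z : `|complex.Re z| <= cmod z.
Proof. by rewrite -lecR cmodE normc_ge_Re. Qed.

Lemma cmod_Im z : `|complex.Im z| <= cmod z.
Proof.
apply: le_trans (_ : cmod (z * 'i) <= _); last first.
  by rewrite cmodM -[X in _ * X]/(Num.sqrt (0 ^+ 2 + 1 ^+ 2)) expr0n /= add0r expr1n sqrtr1 mulr1.
by apply: le_trans (cmod_Re _); rewrite ReiNIm normrN.
Qed.

Lemma cmod_ReIm z : cmod z <= `|complex.Re z| + `|complex.Im z|.
Proof.
rewrite {1}(complexE z).
apply: (le_trans (cmodD _ _)); rewrite cmodM !cmod_real lerD2l.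
by rewrite -[X in X * _]/(Num.sqrt (0 ^+ 2 + 1 ^+ 2)) expr0n /= add0r expr1n sqrtr1 mul1r.
Qed.

Lemma cmod_sqr z : cmod z ^+ 2 = complex.Re z ^+ 2 + complex.Im z ^+ 2.
Proof.
by apply: complexI; rewrite rmorphXn /= cmodE add_Re2_Im2.
Qed.

End Modulus.

(** * Limits along the finite subsets of a type *)

Section Nets.
Variable R : realType.
Local Notation C := R[i].
Variable T : choiceType.
#[local] Existing Instance totally_filter.
Implicit Types (F G : {fset T} -> C) (A B : {fset T}) (l m : C).

Lemma cvg_totallyP F l : F @ totally --> l <->
  forall e : R, 0 < e -> exists A, forall B, (A `<=` B)%fset -> cmod (F B - l) <= e.
Proof.
split=> [/cvgrPdist_le H e e0|H].
  have e0' : (0 : C) < e%:C by rewrite ltcR.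
  have [A _ HA] := H _ e0'.
  by exists A => B /HA /=; rewrite -cmodE lecR cmodB.
apply/cvgrPdist_le => e e0.
have e1 : 0 < complex.Re e by move: e0; rewrite ltcE => /andP[].
have [A HA] := H _ e1; exists A => // B /HA /=.
have {2}-> : e = (complex.Re e)%:C by rewrite RRe_real// gtr0_real.
by rewrite -cmodE lecR cmodB.
Qed.

Lemma cvg_totally_uniq F l m : F @ totally --> l -> F @ totally --> m -> l = m.
Proof. by apply: cvg_unique; exact: norm_hausdorff. Qed.

Lemma cvg_totally_lim F l : F @ totally --> l -> lim (F @ totally) = l.
Proof. by move=> h; apply: cvg_lim => //; exact: norm_hausdorff. Qed.

Lemma cvg_totally_le F G l m (c : R) : 0 <= c ->
  F @ totally --> l -> G @ totally --> m ->
  (exists A0, forall A, (A0 `<=` A)%fset -> cmod (F A) <= c * cmod (G A)) ->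
  cmod l <= c * cmod m.
Proof.
move=> c0 /cvg_totallyP HF /cvg_totallyP HG [A0 H].
apply/ler_addgt0Pl => /= e e0.
have d0 : 0 < e / (1 + c) by rewrite divr_gt0//; lra.
have [A1 H1] := HF _ d0; have [A2 H2] := HG _ d0.
pose A := (A0 `|` (A1 `|` A2))%fset.
have h : cmod (F A) <= c * cmod (G A) by apply: H; apply: fsubsetUl.
have h1 : cmod (F A - l) <= e / (1 + c).
  by apply: H1; rewrite /A fsetUCA fsubsetUl.
have h2 : cmod (G A - m) <= e / (1 + c).
  by apply: H2; rewrite /A fsetUA fsubsetUr.
have := cmodDB l (F A); rewrite cmodB => h3.
have := cmodDB (G A) m => h4.
have de : e = e / (1 + c) + c * (e / (1 + c)).
  by rewrite -[X in X + _]mul1r -mulrDl mulrC divfK// gt_eqF//; lra.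
have : c * cmod (G A) <= c * (cmod m + e / (1 + c)).
  by rewrite ler_wpM2l//; lra.
rewrite {2}de; lra.
Qed.

(** Completeness is read off from that of the real line, one coordinate at a time. *)
Lemma cvg_totally_cauchy F :
  (forall e : R, 0 < e -> exists A, forall B, (A `<=` B)%fset -> cmod (F B - F A) <= e) ->
  exists l, F @ totally --> l.
Proof.
move=> H.
have real_case (f : {fset T} -> R) :
    (forall e : R, 0 < e -> exists A, forall B, (A `<=` B)%fset -> `|f B - f A| <= e) ->
    exists r : R, forall e : R, 0 < e -> exists A, forall B, (A `<=` B)%fset -> `|f B - r| <= e.
  move=> Hf.
  have /cauchy_cvg cf : cauchy (f @ totally).
    apply: cauchy_exP => e e0.
    have [A HA] := Hf (e / 2) ltac:(lra).
    exists (f A); exists A => // B /HA h; rewrite -ball_normE /= distrC.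
    by apply: le_lt_trans h _; lra.
  exists (lim (f @ totally)) => e e0.
  have /cvgrPdist_le/(_ e e0)[A _ HA] := cf.
  by exists A => B /HA /=; rewrite distrC.
have [a Ha] : exists a, forall e : R, 0 < e ->
    exists A, forall B, (A `<=` B)%fset -> `|complex.Re (F B) - a| <= e.
  apply: (real_case (fun B => complex.Re (F B))) => e /H[A HA]; exists A => B /HA.
  by apply: le_trans; rewrite -raddfB cmod_Re.
have [b Hb] : exists a, forall e : R, 0 < e ->
    exists A, forall B, (A `<=` B)%fset -> `|complex.Im (F B) - a| <= e.
  apply: (real_case (fun B => complex.Im (F B))) => e /H[A HA]; exists A => B /HA.
  by apply: le_trans; rewrite -raddfB cmod_Im.
exists (a +i* b); apply/cvg_totallyP => e e0.
have [A HA] := Ha (e / 2) ltac:(lra).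
have [B HB] := Hb (e / 2) ltac:(lra).
exists (A `|` B)%fset => D; rewrite fsubUset => /andP[/HA h1 /HB h2].
apply: le_trans (cmod_ReIm _) _; rewrite !raddfB /=; lra.
Qed.

End Nets.

(** * Unordered sums with bounded partial sums of moduli *)

Section Sums.
Variable R : realType.
Local Notation C := R[i].
Local Notation T := R[i].
#[local] Existing Instance totally_filter.
Implicit Types (f g : T -> C) (A B : {fset T}) (M : R) (S : set T).

Definition majorised (m : T -> R) M := forall A, \sum_(u <- A) m u <= M.

Definition abs_sum_le f M := majorised (fun u => cmod (f u)) M.

Lemma partial_sumE f A : partial_sum f A = \sum_(u <- A) f u.
Proof. by rewrite /partial_sum big_seq_fsetE. Qed.

Lemma majorised_ge0 m M : majorised m M -> 0 <= M.
Proof. by move=> /(_ fset0); rewrite big_seq_fset0. Qed.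

Lemma fsubset_sum (V : zmodType) (F : T -> V) A B : (A `<=` B)%fset ->
  \sum_(u <- B) F u = \sum_(u <- A) F u + \sum_(u <- (B `\` A)%fset) F u.
Proof.
move=> AB; rewrite (big_fsetID _ (fun u => u \in A)) /=; congr (_ + _).
  apply: eq_fbigl => u; rewrite !inE /=; case uA: (u \in A); rewrite ?andbF ?andbT//.
  by rewrite (fsubsetP AB).
by apply: eq_fbigl => u; rewrite !inE /= andbC.
Qed.

(** The finite sums nearly attain their supremum; what remains outside is small. *)
Lemma majorised_tail m M (e : R) : (forall u, 0 <= m u) -> majorised m M -> 0 < e ->
  exists A, forall B, [disjoint A & B]%fset -> \sum_(u <- B) m u <= e.
Proof.
move=> m0 mM e0.
pose E := [set x | exists A, x = \sum_(u <- A) m u].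
have hE : has_sup E.
  split; first by exists (\sum_(u <- (fset0 : {fset T})) m u), fset0.
  by exists M => _ [A ->]; exact: mM.
have [_ [A ->] HA] := sup_adherent e0 hE.
exists A => B AB.
have : \sum_(u <- (A `|` B)%fset) m u <= sup E by apply: ub_le_sup; [case: hE|exists (A `|` B)%fset].
rewrite (fsubset_sum _ (fsubsetUl A B)) fsetDUl fsetDv fset0U.
have -> : (B `\` A = B)%fset by apply/fsetDidPl; rewrite fdisjoint_sym.
lra.
Qed.

Lemma majorised_le m n M : (forall u, m u <= n u) -> majorised n M -> majorised m M.
Proof. by move=> mn nM A; apply: le_trans (nM A); apply: ler_sum. Qed.

Lemma majorisedZ m M c : 0 <= c -> majorised m M -> majorised (fun u => c * m u) (c * M).
Proof. by move=> c0 mM A; rewrite -mulr_sumr ler_wpM2l. Qed.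

Lemma majorisedD m n M N : majorised m M -> majorised n N -> majorised (fun u => m u + n u) (M + N).
Proof. by move=> mM nN A; rewrite big_split lerD. Qed.

Lemma majorised_bij (s s' : T -> T) m M : cancel s s' -> cancel s' s ->
  majorised m M -> majorised (m \o s) M.
Proof.
move=> ss' s's mM A /=.
have -> : \sum_(u <- A) m (s u) = \sum_(u <- [fset s u | u in A]%fset) m u.
  by rewrite big_imfset//; apply: in2W; exact: can_inj ss'.
exact: mM.
Qed.

Definition net_sum f := sum f : C.

Lemma net_sum_cvg f M : abs_sum_le f M -> partial_sum f @ totally --> net_sum f.
Proof.
move=> fM.
suff [l Hl] : exists l : C, partial_sum f @ totally --> l.
  by rewrite /net_sum /sum (cvg_totally_lim Hl).
apply: cvg_totally_cauchy => e e0.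
have [A HA] := majorised_tail (fun u => cmod_ge0 (f u)) fM e0.
exists A => B AB; rewrite !partial_sumE (fsubset_sum _ AB) addrAC subrr add0r.
apply: le_trans (cmod_sum _ _ _) _; apply: HA.
by apply/fdisjointP => u uA; rewrite !inE uA.
Qed.

Lemma net_sum_eq f M l : abs_sum_le f M ->
   (forall e, 0 < e -> exists A, forall B, (A `<=` B)%fset -> cmod (\sum_(u <- B) f u - l) <= e) ->
   net_sum f = l.
Proof.
move=> /net_sum_cvg fM H; apply: (cvg_totally_uniq fM); apply/cvg_totallyP => e /H[A HA].
by exists A => B /HA; rewrite partial_sumE.
Qed.

Lemma abs_sum_leD f g M N : abs_sum_le f M -> abs_sum_le g N -> abs_sum_le (fun u => f u + g u) (M + N).
Proof.
move=> fM gN; apply: majorised_le (majorisedD fM gN) => u; exact: cmodD.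
Qed.

Lemma abs_sum_leZ c f M : abs_sum_le f M -> abs_sum_le (fun u => c * f u) (cmod c * M).
Proof.
move=> /(majorisedZ (cmod_ge0 c)) H; apply: majorised_le H => u; by rewrite cmodM.
Qed.

Lemma net_sumD f g M N : abs_sum_le f M -> abs_sum_le g N ->
  net_sum (fun u => f u + g u) = net_sum f + net_sum g.
Proof.
move=> fM gN; apply: (cvg_totally_uniq (net_sum_cvg (abs_sum_leD fM gN))).
have -> : partial_sum (fun u => f u + g u) = partial_sum f \+ partial_sum g.
  by apply/funext => A; rewrite /= !partial_sumE big_split.
exact: cvgD (net_sum_cvg fM) (net_sum_cvg gN).
Qed.

Lemma net_sumZ c f M : abs_sum_le f M -> net_sum (fun u => c * f u) = c * net_sum f.
Proof.
move=> fM; apply: (cvg_totally_uniq (net_sum_cvg (abs_sum_leZ c fM))).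
have -> : partial_sum (fun u => c * f u) = (fun A => c * partial_sum f A).
  by apply/funext => A; rewrite /= !partial_sumE mulr_sumr.
exact: cvgM (cvg_cst c) (net_sum_cvg fM).
Qed.

Lemma eq_net_sum f g : f =1 g -> net_sum f = net_sum g.
Proof. by move=> /funext ->. Qed.

Lemma net_sum_bij (s s' : T -> T) f M : cancel s s' -> cancel s' s ->
  abs_sum_le f M -> net_sum (f \o s) = net_sum f.
Proof.
move=> ss' s's fM.
have H : abs_sum_le (f \o s) M by apply: (majorised_bij ss' s's fM).
apply: (net_sum_eq H) => e e0.
have /cvg_totallyP/(_ e e0)[A HA] := net_sum_cvg fM.
exists [fset s' u | u in A]%fset => B AB.
have -> : \sum_(u <- B) (f \o s) u = partial_sum f [fset s u | u in B]%fset.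
  by rewrite partial_sumE big_imfset//; apply: in2W; exact: can_inj ss'.
apply: HA; apply/fsubsetP => u uA; apply/imfsetP; exists (s' u); rewrite ?s's//=.
by apply: (fsubsetP AB); apply/imfsetP; exists u.
Qed.

End Sums.

(** * Sums over sets of complex numbers *)

Section SumOver.
#[local] Existing Instance totally_filter.
Variable R : realType.
Local Notation C := R[i].
Implicit Types (f g : C -> C) (m : C -> R) (S : set C) (M : R).

Definition summable_over S f := exists M, abs_sum_le (patch (fun=> 0) S f) M.

Lemma sum_overE S f : sum_over S f = net_sum (patch (fun=> 0) S f).
Proof. by []. Qed.

Lemma summ_le S f m M : majorised m M -> (forall u, 0 <= m u) ->
  (forall u, S u -> cmod (f u) <= m u) -> summable_over S f.
Proof.
move=> mM m0 fm; exists M; apply: majorised_le mM => u; rewrite /patch.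
by case: ifPn => [/set_mem/fm//|_]; rewrite cmod0.
Qed.

Lemma sum_over_cvg S f : summable_over S f ->
  (fun A : {fset C} => \sum_(u <- A) patch (fun=> 0) S f u) @ totally --> sum_over S f.
Proof.
move=> [M /net_sum_cvg]; rewrite -sum_overE.
by have -> : partial_sum (patch (fun=> 0) S f) = (fun A : {fset C} => \sum_(u <- A) patch (fun=> 0) S f u)
  by apply/funext => A; rewrite partial_sumE.
Qed.

Lemma patchT f S u : S u -> patch (fun=> 0) S f u = f u.
Proof. by move=> Su; rewrite /patch mem_set. Qed.

Lemma patchF f S u : ~ S u -> patch (fun=> 0) S f u = 0.
Proof. by move=> Su; rewrite /patch memNset. Qed.

Lemma eq_sum_over S f g : (forall u, S u -> f u = g u) -> sum_over S f = sum_over S g.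
Proof.
move=> fg; apply: eq_net_sum => u; have [Su|Su] := pselect (S u); first by rewrite !patchT// fg.
by rewrite !patchF.
Qed.

Lemma eq_summ S f g : (forall u, S u -> f u = g u) -> summable_over S f -> summable_over S g.
Proof.
move=> fg [M H]; exists M; apply: majorised_le H => u.
have [Su|Su] := pselect (S u); first by rewrite !patchT// fg.
by rewrite !patchF.
Qed.

Lemma summD S f g : summable_over S f -> summable_over S g -> summable_over S (fun u => f u + g u).
Proof.
move=> [M fM] [N gN]; exists (M + N); apply: majorised_le (abs_sum_leD fM gN) => u /=.
have [Su|Su] := pselect (S u); first by rewrite !patchT.
by rewrite !patchF // addr0.
Qed.

Lemma summZ S c f : summable_over S f -> summable_over S (fun u => c * f u).
Proof.
move=> [M fM]; exists (cmod c * M); apply: majorised_le (abs_sum_leZ c fM) => u /=.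
have [Su|Su] := pselect (S u); first by rewrite !patchT.
by rewrite !patchF // mulr0.
Qed.

Lemma summZr S c f : summable_over S f -> summable_over S (fun u => f u * c).
Proof. by move=> /(summZ c); apply: eq_summ => u _; rewrite mulrC. Qed.

Lemma summN S f : summable_over S f -> summable_over S (fun u => - f u).
Proof. by move=> /(summZ (-1)); apply: eq_summ => u _; rewrite mulN1r. Qed.

Lemma summB S f g : summable_over S f -> summable_over S g -> summable_over S (fun u => f u - g u).
Proof. by move=> fS /summN; apply: summD. Qed.

Lemma sum_overD S f g : summable_over S f -> summable_over S g ->
  sum_over S (fun u => f u + g u) = sum_over S f + sum_over S g.
Proof.
move=> [M fM] [N gN]; rewrite !sum_overE -(net_sumD fM gN); apply: eq_net_sum => u.
have [Su|Su] := pselect (S u); first by rewrite !patchT.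
by rewrite !patchF // addr0.
Qed.

Lemma sum_overZ S c f : summable_over S f -> sum_over S (fun u => c * f u) = c * sum_over S f.
Proof.
move=> [M fM]; rewrite !sum_overE -(net_sumZ c fM); apply: eq_net_sum => u.
have [Su|Su] := pselect (S u); first by rewrite !patchT.
by rewrite !patchF // mulr0.
Qed.

Lemma sum_overZr S c f : summable_over S f -> sum_over S (fun u => f u * c) = sum_over S f * c.
Proof.
by move=> fS; rewrite mulrC -sum_overZ//; apply: eq_sum_over => u _; rewrite mulrC.
Qed.

Lemma sum_overN S f : summable_over S f -> sum_over S (fun u => - f u) = - sum_over S f.
Proof.
by move=> /(sum_overZ (-1)); rewrite mulN1r => <-; apply: eq_sum_over => u _; rewrite mulN1r.
Qed.

Lemma sum_overB S f g : summable_over S f -> summable_over S g ->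
  sum_over S (fun u => f u - g u) = sum_over S f - sum_over S g.
Proof. by move=> fS gS; rewrite sum_overD ?sum_overN//; exact: summN. Qed.

Lemma summU S S' f : summable_over S f -> summable_over S' f -> summable_over (S `|` S') f.
Proof.
move=> [M fM] [N gN]; exists (M + N); apply: majorised_le (majorisedD fM gN) => u /=.
have [[Su|Su]|Su] := pselect ((S `|` S') u).
- by rewrite !(patchT f Su) (patchT f (or_introl Su)) lerDl cmod_ge0.
- by rewrite !(patchT f Su) (patchT f (or_intror Su)) lerDr cmod_ge0.
- by rewrite (patchF f Su) cmod0 addr_ge0// cmod_ge0.
Qed.

Lemma sum_overU S S' f : summable_over S f -> summable_over S' f -> (forall u, S u -> ~ S' u) ->
  sum_over (S `|` S') f = sum_over S f + sum_over S' f.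
Proof.
move=> [M fM] [N gN] SS'; rewrite !sum_overE -(net_sumD fM gN); apply: eq_net_sum => u.
have [Su|Su] := pselect (S u).
  by rewrite (patchT f Su) (patchF f (SS' _ Su)) addr0 (patchT f (or_introl Su)).
rewrite (patchF f Su) add0r.
have [Su'|Su'] := pselect (S' u); first by rewrite !(patchT f Su') (patchT f (or_intror Su')).
by rewrite !(patchF f Su') patchF// => -[].
Qed.

Lemma summ1 a f : summable_over [set a] f.
Proof.
exists (cmod (f a)) => A.
have [aA|aA] := boolP (a \in A).
  rewrite (big_fsetD1 a)//= patchT// big1_fset ?addr0// => u.
  by rewrite !inE => /andP[/eqP ua _] _; rewrite patchF ?cmod0.
rewrite big1_fset ?cmod_ge0// => u uA _; rewrite patchF ?cmod0// => /= ua.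
by rewrite -ua uA in aA.
Qed.

Lemma sum_over1 a f : sum_over [set a] f = f a.
Proof.
have [M fM] := summ1 a f; apply: (net_sum_eq fM) => e e0.
exists [fset a]%fset => B; rewrite fsub1set => aB.
rewrite (big_fsetD1 a)//= patchT// big1_fset ?addr0 ?subrr ?cmod0 ?ltW// => u.
by rewrite !inE => /andP[/eqP ua _] _; rewrite patchF.
Qed.

Lemma sum_over0 S : sum_over S (fun=> 0) = 0.
Proof.
have H : abs_sum_le (patch (fun=> 0) S (fun=> 0 : C)) 0.
  by move=> A; rewrite big1// => u _; rewrite /patch if_same cmod0.
apply: (net_sum_eq H) => e e0; exists fset0 => B _.
by rewrite big1 ?subrr ?cmod0 ?ltW// => u _; rewrite /patch if_same.
Qed.

Lemma summ_bij S (s s' : C -> C) f : cancel s s' -> cancel s' s ->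
  summable_over S f -> summable_over (s @^-1` S) (f \o s).
Proof. by move=> ss' s's [M /(majorised_bij ss' s's) fM]; exists M. Qed.

Lemma sum_over_bij S (s s' : C -> C) f : cancel s s' -> cancel s' s ->
  summable_over S f -> sum_over (s @^-1` S) (f \o s) = sum_over S f.
Proof. by move=> ss' s's [M fM]; rewrite !sum_overE -(net_sum_bij ss' s's fM). Qed.

Lemma sum_over_shift S v f : summable_over S f ->
  sum_over [set u | S (u + v)] (fun u => f (u + v)) = sum_over S f.
Proof. by apply: sum_over_bij; [exact: addrK|exact: subrK]. Qed.

Lemma summ_opp S f : (forall u, S u -> S (- u)) -> summable_over S f -> summable_over S (fun u => f (- u)).
Proof.
move=> SN fS; have -> : S = -%R @^-1` S.
  by apply/seteqP; split => u /= => [/SN//|/SN]; rewrite opprK.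
exact: (summ_bij (@opprK _) (@opprK _) fS).
Qed.

Lemma sum_over_opp S f : (forall u, S u -> S (- u)) -> summable_over S f ->
  sum_over S (fun u => f (- u)) = sum_over S f.
Proof.
move=> SN fS; have {1}-> : S = -%R @^-1` S.
  by apply/seteqP; split => u /= => [/SN//|/SN]; rewrite opprK.
exact: (sum_over_bij (@opprK _) (@opprK _) fS).
Qed.

(** The reflection u |-> - u permutes the terms, so each may be replaced by its average
    with its mirror image. *)
Lemma sum_over_sym S f g : (forall u, S u -> S (- u)) -> summable_over S f ->
  (forall u, S u -> f u + f (- u) = 2 * g u) -> sum_over S f = sum_over S g.
Proof.
move=> SN fS fg.
have gE u : S u -> 2^-1 * (f u + f (- u)) = g u by move=> /fg ->; rewrite mulKf.
rewrite -(eq_sum_over gE) sum_overZ; last exact/summD/summ_opp.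
rewrite sum_overD//; last exact: summ_opp.
by rewrite sum_over_opp//; field.
Qed.

End SumOver.

(** * Second-order expansions *)

Section Jets.
Variable R : realType.
Local Notation C := R[i].
Implicit Types (f g : C -> C) (r N M : R) (a c d x h : C).
#[local] Existing Instance totally_filter.

(** An expansion f 0 + d h + c h ^ 2 with remainder K |h| ^ 3 on the disc of radius r. The
    single number N bounds the value at r of the majorant polynomial. It is additive under sums
    and multiplicative under products, so that families of expansions can be summed without
    following the individual coefficients. Order two is what Liouville's theorem needs. *)
Definition jet r N f d := exists c (K : R), [/\ 0 <= K,
  cmod (f 0) + cmod d * r + cmod c * r ^+ 2 + K * r ^+ 3 <= N &
  forall h, cmod h <= r -> cmod (f h - f 0 - d * h - c * h ^+ 2) <= K * cmod h ^+ 3].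

Lemma jet_ge0 r N f d : 0 <= r -> jet r N f d -> 0 <= N.
Proof.
move=> r0 [c [K [K0 H _]]]; apply: le_trans H.
by rewrite !addr_ge0// ?mulr_ge0 ?cmod_ge0 ?exprn_ge0.
Qed.

Lemma jet_bound r N f d h : 0 <= r -> jet r N f d -> cmod h <= r -> cmod (f h) <= N.
Proof.
move=> r0 [c [K [K0 H Hf]]] hr; apply: le_trans H.
have -> : f h = f 0 + d * h + c * h ^+ 2 + (f h - f 0 - d * h - c * h ^+ 2) by ring.
have h2 : cmod h ^+ 2 <= r ^+ 2 by rewrite lerXn2r ?nnegrE ?cmod_ge0.
have h3 : cmod h ^+ 3 <= r ^+ 3 by rewrite lerXn2r ?nnegrE ?cmod_ge0.
apply: le_trans (cmodD _ _) _; apply: lerD; last first.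
  by apply: le_trans (Hf h hr) _; rewrite ler_wpM2l.
apply: le_trans (cmodD _ _) _; apply: lerD; last by rewrite cmodM cmodX ler_wpM2l// cmod_ge0.
by apply: le_trans (cmodD _ _) _; rewrite lerD2l cmodM ler_wpM2l// cmod_ge0.
Qed.

Lemma jet_slope r N f d : 0 <= r -> jet r N f d -> cmod d * r <= N.
Proof.
move=> r0 [c [K [K0 H _]]]; apply: le_trans H.
by rewrite addrAC [_ + cmod d * r]addrC -!addrA lerDl !addr_ge0// ?mulr_ge0 ?cmod_ge0 ?exprn_ge0.
Qed.

Lemma jet_weaken r N N' f d : N <= N' -> jet r N f d -> jet r N' f d.
Proof. by move=> NN' [c [K [K0 H Hf]]]; exists c, K; split => //; apply: le_trans NN'. Qed.

Lemma jet_shrink r r' N f d : 0 <= r' -> r' <= r -> jet r N f d -> jet r' N f d.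
Proof.
move=> r0 rr' [c [K [K0 H Hf]]]; exists c, K; split => //; last first.
  by move=> h hr; apply: Hf; apply: le_trans rr'.
apply: le_trans H; have r0' := le_trans r0 rr'.
by rewrite !lerD// ler_wpM2l// ?cmod_ge0// lerXn2r.
Qed.

Lemma jet_ext r N f g d : 0 <= r -> (forall h, cmod h <= r -> f h = g h) -> jet r N f d -> jet r N g d.
Proof.
move=> r0 fg [c [K [K0 H Hf]]]; exists c, K.
have fg0 : f 0 = g 0 by apply: fg; rewrite cmod0.
by split; [|rewrite -fg0|move=> h hr; rewrite -fg0 -fg//; apply: Hf].
Qed.

Lemma jet_cst r a : jet r (cmod a) (fun=> a) 0.
Proof.
exists 0, 0; split; rewrite // ?cmod0 ?mul0r ?addr0// => h _.
by rewrite !mul0r subrr !subr0 cmod0.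
Qed.

Lemma jet_var r a : jet r (cmod a + r) (fun h => a + h) 1.
Proof.
exists 0, 0; split; rewrite // ?cmod0 ?mul0r ?addr0 ?cmod1 ?mul1r// => h _.
have -> : a + h - a - 1 * h - 0 * h ^+ 2 = 0 by ring.
by rewrite cmod0 mul0r.
Qed.

Lemma jetD r N N' f g d d' : 0 <= r -> jet r N f d -> jet r N' g d' ->
  jet r (N + N') (fun h => f h + g h) (d + d').
Proof.
move=> r0 [c [K [K0 H Hf]]] [c' [K' [K0' H' Hg]]].
exists (c + c'), (K + K'); split; first exact: addr_ge0.
  have := cmodD (f 0) (g 0).
  have := ler_wpM2r r0 (cmodD d d').
  have := ler_wpM2r (exprn_ge0 2 r0) (cmodD c c').
  rewrite !mulrDl; lra.
move=> h hr; have := Hf h hr; have := Hg h hr.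
set u := (X in cmod X <= _ -> _); set v := (X in _ -> cmod X <= _ -> _).
move=> hu hv; have -> : f h + g h - (f 0 + g 0) - (d + d') * h - (c + c') * h ^+ 2 = v + u.
  by rewrite /u /v; ring.
by apply: le_trans (cmodD _ _) _; rewrite mulrDl; lra.
Qed.

(** The majorant of a product is at most the product of the majorants. *)
Lemma jetM r N N' f g d d' : 0 <= r -> jet r N f d -> jet r N' g d' ->
  jet r (N * N') (fun h => f h * g h) (d * g 0 + f 0 * d').
Proof.
move=> r0 Jf Jg; have N0 := jet_ge0 r0 Jf; have N0' := jet_ge0 r0 Jg.
case: Jf Jg => [c [K [K0 H Hf]]] [c' [K' [K0' H' Hg]]].
set A0 := cmod (f 0) in H *; set A1 := cmod d in H *; set A2 := cmod c in H *.
set B0 := cmod (g 0) in H' *; set B1 := cmod d' in H' *; set B2 := cmod c' in H' *.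
have [a0 a1 a2] : [/\ 0 <= A0, 0 <= A1 & 0 <= A2] by split; apply: cmod_ge0.
have [b0 b1 b2] : [/\ 0 <= B0, 0 <= B1 & 0 <= B2] by split; apply: cmod_ge0.
pose NG := B0 + B1 * r + B2 * r ^+ 2 + K' * r ^+ 3.
pose PF := A0 + A1 * r + A2 * r ^+ 2.
exists (c * g 0 + d * d' + f 0 * c'), (K * NG + PF * K' + (A1 * B2 + A2 * B1) + A2 * B2 * r).
have r2 := exprn_ge0 2 r0; have r3 := exprn_ge0 3 r0.
have NG0 : 0 <= NG by rewrite !addr_ge0// mulr_ge0.
have PF0 : 0 <= PF by rewrite !addr_ge0// mulr_ge0.
split.
- by rewrite !addr_ge0// !mulr_ge0.
- have -> : cmod (f 0 * g 0) = A0 * B0 by rewrite cmodM.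
  have h1 : cmod (d * g 0 + f 0 * d') * r <= (A1 * B0 + A0 * B1) * r.
    by rewrite ler_wpM2r//; apply: le_trans (cmodD _ _) _; rewrite !cmodM.
  have h2 : cmod (c * g 0 + d * d' + f 0 * c') * r ^+ 2 <= (A2 * B0 + A1 * B1 + A0 * B2) * r ^+ 2.
    rewrite ler_wpM2r//; apply: le_trans (cmodD _ _) _; rewrite !cmodM lerD2r.
    by apply: le_trans (cmodD _ _) _; rewrite !cmodM.
  apply: le_trans (_ : (PF + K * r ^+ 3) * NG <= _); last first.
    by rewrite ler_pM// addr_ge0// mulr_ge0.
  have -> : (PF + K * r ^+ 3) * NG = A0 * B0 + (A1 * B0 + A0 * B1) * r + (A2 * B0 + A1 * B1 + A0 * B2) * r ^+ 2
     + (K * NG + PF * K' + (A1 * B2 + A2 * B1) + A2 * B2 * r) * r ^+ 3.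
    by rewrite /PF /NG; ring.
  lra.
move=> h hr; have Hfh := Hf h hr; have Hgh := Hg h hr.
set u := (X in cmod X <= _) in Hfh; set v := (X in cmod X <= _) in Hgh.
set t := cmod h in hr Hfh Hgh *; have t0 : 0 <= t := cmod_ge0 _.
have t3 := exprn_ge0 3 t0.
have hh2 : t ^+ 2 <= r ^+ 2 by rewrite lerXn2r.
have hh3 : t ^+ 3 <= r ^+ 3 by rewrite lerXn2r.
have gh : cmod (g h) <= NG.
  have -> : g h = g 0 + d' * h + c' * h ^+ 2 + v by rewrite /v; ring.
  apply: le_trans (cmodD _ _) _; apply: lerD; last by apply: le_trans Hgh _; rewrite ler_wpM2l.
  apply: le_trans (cmodD _ _) _; apply: lerD; last by rewrite cmodM cmodX ler_wpM2l.
  by apply: le_trans (cmodD _ _) _; rewrite lerD2l cmodM ler_wpM2l.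
have ph : cmod (f 0 + d * h + c * h ^+ 2) <= PF.
  apply: le_trans (cmodD _ _) _; apply: lerD; last by rewrite cmodM cmodX ler_wpM2l.
  by apply: le_trans (cmodD _ _) _; rewrite lerD2l cmodM ler_wpM2l.
have -> : f h * g h - f 0 * g 0 - (d * g 0 + f 0 * d') * h - (c * g 0 + d * d' + f 0 * c') * h ^+ 2
  = u * g h + (f 0 + d * h + c * h ^+ 2) * v + (d * c' + c * d') * h ^+ 3 + c * c' * h * h ^+ 3.
  by rewrite /u /v; ring.
have -> : (K * NG + PF * K' + (A1 * B2 + A2 * B1) + A2 * B2 * r) * t ^+ 3 =
  K * t ^+ 3 * NG + PF * (K' * t ^+ 3) + (A1 * B2 + A2 * B1) * t ^+ 3 + A2 * B2 * r * t ^+ 3.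
  by ring.
apply: le_trans (cmodD _ _) _; apply: lerD; last first.
  rewrite (cmodM _ (h ^+ 3)) cmodX (cmodM _ h) (cmodM c) -/t -/A2 -/B2.
  by rewrite ler_wpM2r// ler_wpM2l// mulr_ge0.
apply: le_trans (cmodD _ _) _; apply: lerD; last first.
  rewrite cmodM cmodX -/t ler_wpM2r//.
  by apply: le_trans (cmodD _ _) _; rewrite !cmodM.
apply: le_trans (cmodD _ _) _; apply: lerD; rewrite cmodM; by apply: ler_pM; rewrite ?cmod_ge0.
Qed.

Lemma jetZ r N a f d : 0 <= r -> jet r N f d -> jet r (cmod a * N) (fun h => a * f h) (a * d).
Proof.
move=> r0 J; have := jetM r0 (jet_cst r a) J.
by rewrite mul0r add0r.
Qed.

Lemma jetN r N f d : 0 <= r -> jet r N f d -> jet r N (fun h => - f h) (- d).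
Proof.
move=> r0 /(jetZ (-1) r0); rewrite cmodN cmod1 mul1r mulN1r.
by apply: jet_ext => // h _; rewrite mulN1r.
Qed.

Lemma jetB r N N' f g d d' : 0 <= r -> jet r N f d -> jet r N' g d' ->
  jet r (N + N') (fun h => f h - g h) (d - d').
Proof. by move=> r0 Jf /(jetN r0); apply: jetD. Qed.

(** On a disc whose radius is at most half the distance to the pole, the majorant of the
    geometric series is at most twice its first term. *)
Lemma jet_inv r x : 0 < r -> 2 * r <= cmod x ->
  jet r (2 / cmod x) (fun h => (x + h)^-1) (- x ^- 2).
Proof.
move=> r0 rx; have x0 : 0 < cmod x by lra.
have xn0 : x != 0 by rewrite -cmod_gt0.
exists (x ^- 3), (2 / cmod x ^+ 4); split.
- by rewrite divr_ge0// exprn_ge0// cmod_ge0.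
- rewrite addr0 cmodN !cmodV !cmodX.
  set s := (cmod x)^-1; have s0 : 0 < s by rewrite invr_gt0.
  have q : s * r <= 2^-1 by rewrite mulrC ler_pdivrMr//; lra.
  have q0 : 0 <= s * r by rewrite mulr_ge0// ltW.
  have -> : s + (cmod x ^+ 2)^-1 * r + (cmod x ^+ 3)^-1 * r ^+ 2 + 2 / cmod x ^+ 4 * r ^+ 3 =
    s * (1 + s * r + (s * r) ^+ 2 + 2 * (s * r) ^+ 3).
    by rewrite /s; field; rewrite gt_eqF.
  rewrite mulrC; apply: (ler_wpM2r (ltW s0)); set y := s * r in q q0 *.
  have h2 : y ^+ 2 <= 4^-1 by have := ler_pM q0 q0 q q; rewrite expr2; lra.
  have h3 : y ^+ 3 <= 8^-1 by have := ler_pM (exprn_ge0 2 q0) q0 h2 q; rewrite [y ^+ 3]exprSr; lra.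
  lra.
move=> h hr; rewrite addr0.
have xh : cmod x / 2 <= cmod (x + h).
  have := cmodDB x (- h); rewrite opprK cmodN; lra.
have xh0 : x + h != 0 by rewrite -cmod_gt0; lra.
have -> : (x + h)^-1 - x^-1 - - x ^- 2 * h - x ^- 3 * h ^+ 2 = - (h ^+ 3 / (x ^+ 3 * (x + h))).
  by field; rewrite xn0 xh0.
rewrite cmodN (cmodM (h ^+ 3)) cmodV (cmodM (x ^+ 3)) !cmodX mulrC ler_wpM2r ?exprn_ge0 ?cmod_ge0//.
have -> : 2 / cmod x ^+ 4 = (cmod x ^+ 3 * (cmod x / 2))^-1 by field; rewrite gt_eqF.
rewrite lef_pV2 ?posrE ?mulr_gt0 ?exprn_gt0//; [|lra..].
by rewrite ler_wpM2l// exprn_ge0// ltW.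
Qed.

Lemma cvg_totally_cmod (F : {fset C} -> C) (l : C) :
  F @ totally --> l -> (fun A => cmod (F A)) @ totally --> cmod l.
Proof.
move=> /cvg_totallyP H; apply/cvgrPdist_le => e /H[A HA]; exists A => // B /HA /= h.
have h1 := cmodDB (F B) l; have h2 := cmodDB l (F B); rewrite cmodB in h2.
rewrite ler_norml; apply/andP; split; lra.
Qed.

(** Termwise expansion of a series of jets: the bounds N u bound all the
    coefficients and remainders at once, so majorising them suffices. *)
Lemma jet_sum r (S : set C) (N : C -> R) M (f : C -> C -> C) (d : C -> C) :
  0 < r -> majorised N M -> (forall u, 0 <= N u) ->
  (forall u, S u -> jet r (N u) (f u) (d u)) ->
  jet r M (fun h => sum_over S (fun u => f u h)) (sum_over S d).
Proof.
move=> r0 NM N0 J; have r0' := ltW r0.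
have /choice[cK HcK] : forall u, exists p : C * R, S u -> [/\ 0 <= p.2,
  cmod (f u 0) + cmod (d u) * r + cmod p.1 * r ^+ 2 + p.2 * r ^+ 3 <= N u &
  forall h, cmod h <= r -> cmod (f u h - f u 0 - d u * h - p.1 * h ^+ 2) <= p.2 * cmod h ^+ 3].
  move=> u; have [Su|Su] := pselect (S u); last by exists (0, 0).
  by have [c [K H]] := J _ Su; exists (c, K).
pose c u := (cK u).1; pose K u := (cK u).2.
have r3 : 0 < r ^+ 3 by apply: exprn_gt0.
have r2 : 0 < r ^+ 2 by apply: exprn_gt0.
have sf h : cmod h <= r -> summable_over S (fun u => f u h).
  by move=> hr; apply: (summ_le NM N0) => u Su; apply: jet_bound (J _ Su) hr.
have sd : summable_over S d.
  have ri : 0 <= r^-1 by rewrite invr_ge0.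
  apply: (summ_le (majorisedZ ri NM)) => [u|u Su]; first by rewrite mulr_ge0.
  by rewrite ler_pdivlMl// mulrC; apply: jet_slope (J _ Su).
have sc : summable_over S c.
  have ri : 0 <= (r ^+ 2)^-1 by rewrite invr_ge0 ltW.
  apply: (summ_le (majorisedZ ri NM)) => [u|u Su]; first by rewrite mulr_ge0.
  have [_ H _] := HcK _ Su; rewrite ler_pdivlMl// mulrC; apply: le_trans H.
  have [K0 _ _] := HcK _ Su.
  by rewrite addrC addrA lerDr !addr_ge0// ?mulr_ge0 ?cmod_ge0// ltW.
pose rem h u := f u h - f u 0 - d u * h - c u * h ^+ 2.
have zr : cmod (0 : C) <= r by rewrite cmod0.
have srem h : cmod h <= r -> summable_over S (rem h).
  by move=> hr; apply: summB (summZr _ sc); apply: summB (summZr _ sd); apply: summB; apply: sf.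
have Srem h : cmod h <= r -> sum_over S (rem h) = sum_over S (fun u => f u h)
    - sum_over S (fun u => f u 0) - sum_over S d * h - sum_over S c * h ^+ 2.
  move=> hr; rewrite !sum_overB ?sum_overZr//; try exact: sf; try exact: summZr; try (by apply: summB; exact: sf).
  by apply: summB (summZr _ sd); apply: summB; apply: sf.
have key h : cmod h <= r ->
    cmod (sum_over S (rem h)) * r ^+ 3 + (cmod (sum_over S (fun u => f u 0)) +
      cmod (sum_over S d) * r + cmod (sum_over S c) * r ^+ 2) * cmod h ^+ 3 <= M * cmod h ^+ 3.
  move=> hr; have t3 : 0 <= cmod h ^+ 3 by rewrite exprn_ge0 ?cmod_ge0.
  have L1 := cvg_totally_cmod (sum_over_cvg (srem h hr)).
  have L2 := cvg_totally_cmod (sum_over_cvg (sf 0 zr)).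
  have L3 := cvg_totally_cmod (sum_over_cvg sd).
  have L4 := cvg_totally_cmod (sum_over_cvg sc).
  have LL := cvgD (cvgM L1 (cvg_cst (r ^+ 3))) (cvgM (cvgD (cvgD L2 (cvgM L3 (cvg_cst r)))
     (cvgM L4 (cvg_cst (r ^+ 2)))) (cvg_cst (cmod h ^+ 3))).
  have FF : Filter (@totally C) by exact: filter_filter.
  do 11 have {}LL := LL FF.
  apply: (cvgr_to_le LL); exists fset0 => // A _ /=.
  apply: le_trans (_ : (\sum_(u <- A) N u) * cmod h ^+ 3 <= _); last by rewrite ler_wpM2r.
  pose p (a : C -> C) u := cmod (patch (fun=> 0) S a u).
  apply: le_trans (_ : \sum_(u <- A) (p (rem h) u * r ^+ 3 +
    (p (f^~ 0) u + p d u * r + p c u * r ^+ 2) * cmod h ^+ 3) <= _).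
    rewrite big_split -!mulr_suml /= !big_split -!mulr_suml /=.
    pose q (a : C -> C) := cmod (\sum_(u <- A) patch (fun=> 0) S a u).
    rewrite -[X in X <= _]/(q (rem h) * r ^+ 3 + (q (f^~ 0) + q d * r + q c * r ^+ 2) * cmod h ^+ 3).
    apply: lerD; rewrite ler_wpM2r ?(ltW r3)// ?cmod_sum//.
    apply: lerD; last by rewrite ler_wpM2r ?(ltW r2)// cmod_sum.
    by apply: lerD; rewrite ?ler_wpM2r ?cmod_sum.
  rewrite mulr_suml; apply: ler_sum => u _; rewrite /p.
  have [Su|Su] := pselect (S u); last first.
    by rewrite !patchF// cmod0 !mul0r !addr0 mul0r add0r mulr_ge0.
  rewrite !patchT//; have [K0 H Hf] := HcK _ Su.
  apply: le_trans (_ : (K u * r ^+ 3 + (cmod (f u 0) + cmod (d u) * r + cmod (c u) * r ^+ 2)) *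
     cmod h ^+ 3 <= _).
    by rewrite [X in _ <= X]mulrDl lerD2r mulrAC ler_wpM2r ?(ltW r3)//; apply: Hf.
  by rewrite ler_wpM2r// addrC.
exists (sum_over S c), ((M - (cmod (sum_over S (fun u => f u 0)) +
      cmod (sum_over S d) * r + cmod (sum_over S c) * r ^+ 2)) / r ^+ 3).
split.
- rewrite divr_ge0 ?(ltW r3)// subr_ge0.
  have := key r%:C; rewrite cmod_real ger0_norm// => /(_ (lexx _)) H.
  rewrite -(ler_pM2r r3); apply: le_trans H.
  by rewrite lerDr mulr_ge0 ?cmod_ge0// ltW.
- by rewrite divfK ?gt_eqF// addrC subrK.
move=> h hr; rewrite -Srem// mulrAC ler_pdivlMr//.
by have := key h hr; rewrite mulrBl; lra.
Qed.

End Jets.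

(** * Liouville's theorem for functions with second-order expansions *)

Section Liouville.
Variable R : realType.
Local Notation C := R[i].
Implicit Types (u v : C -> R) (a z h : C).

Lemma cmodi : cmod ('i : C) = 1.
Proof. by rewrite /cmod /= expr0n /= add0r expr1n sqrtr1. Qed.

(** Continuity of a real function on the plane, phrased with the real-valued modulus. *)
Definition ccont u := forall a (e : R), 0 < e ->
  exists2 r : R, 0 < r & forall z, cmod (z - a) <= r -> `|u z - u a| <= e.

Lemma ccontD u v : ccont u -> ccont v -> ccont (fun z => u z + v z).
Proof.
move=> cu cv a e e0.
have [r r0 H] := cu a (e / 2) ltac:(lra); have [r' r0' H'] := cv a (e / 2) ltac:(lra).
exists (Num.min r r'); first by rewrite lt_min r0.
move=> z; rewrite le_min => /andP[/H h /H' h'].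
have -> : u z + v z - (u a + v a) = (u z - u a) + (v z - v a) by ring.
by apply: le_trans (ler_normD _ _) _; lra.
Qed.

Lemma ccont_cmod (f : R -> R) : (forall x, 0 <= x -> {for x, continuous f}) ->
  ccont (fun z => f (cmod z)).
Proof.
move=> cf a e e0.
have /cvgrPdist_le/(_ e e0)[d /= d0 H] := cf (cmod a) (cmod_ge0 a).
exists (d / 2); first by rewrite divr_gt0.
move=> z zd; rewrite distrC; apply: H => /=.
have h1 := cmodDB z a; have h2 := cmodDB a z; rewrite cmodB in h2.
by rewrite ltr_norml; apply/andP; split; lra.
Qed.

Lemma box_max u (B : R) : 0 <= B -> ccont u ->
  exists a, [/\ `|complex.Re a| <= B, `|complex.Im a| <= B &
    forall z, `|complex.Re z| <= B -> `|complex.Im z| <= B -> u z <= u a].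
Proof.
move=> B0 cu.
pose U (p : R * R) := u (p.1 +i* p.2).
pose A := `[- B, B]%classic `*` `[- B, B]%classic : set (R * R).
have A0 : A !=set0 by exists (0, 0); split => /=; rewrite in_itv /= oppr_le0 B0.
have cA : compact A by apply: compact_setX; exact: segment_compact.
have cU : {within A, continuous U}.
  apply: continuous_subspaceT => -[x y]; apply/cvgrPdist_le => e e0.
  have [r r0 H] := cu (x +i* y) e e0.
  have r2 : 0 < r / 2 by rewrite divr_gt0.
  exists (ball x (r / 2), ball y (r / 2)); first by split; apply: nbhsx_ballx.
  move=> [x' y'] [/=]; rewrite -!ball_normE /= => hx hy.
  rewrite distrC; apply: H => /=.
  apply: le_trans (cmod_ReIm _) _ => /=.
  by rewrite (distrC x') (distrC y'); lra.
have [[x y] xyA H] := compact_EVT_max A0 cA cU.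
move: xyA; rewrite inE => -[/= xB yB].
exists (x +i* y); split => /=; [move: xB|move: yB|]; rewrite ?in_itv/= ?ler_norml//.
move=> z zx zy; have := H (complex.Re z, complex.Im z).
rewrite inE /A /= !in_itv /= -!ler_norml zx zy => /(_ (conj isT isT)).
by rewrite /U /=; case: z {zx zy}.
Qed.

(** Less 4 u(a), this is a discrete Laplacian; in it the terms of orders one and two of an
    expansion of a holomorphic function cancel. *)
Definition cross u a (t : R) :=
  u (a + t%:C) + u (a - t%:C) + u (a + 'i * t%:C) + u (a - 'i * t%:C).

Lemma cross_sqr a t : cross (fun z => cmod z ^+ 2) a t = 4 * cmod a ^+ 2 + 4 * t ^+ 2.
Proof.
case: a => x y; rewrite /cross !cmod_sqr /=; ring.
Qed.

(** The logarithm of the modulus is harmonic: the four factors multiply to a ^ 4 - t ^ 4. *)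
Lemma cross_ln a (t : R) : 0 < t -> t < cmod a ->
  cross (fun z => ln (cmod z)) a t <= 4 * ln (cmod a) + (t / cmod a) ^+ 4.
Proof.
move=> t0 ta; have a0 : 0 < cmod a by lra.
have ct : cmod t%:C = t by rewrite cmod_real ger0_norm// ltW.
have ci : cmod ('i * t%:C : C) = t.
  by rewrite cmodM ct cmodi mul1r.
have p z : cmod z = t -> 0 < cmod (a + z).
  by move=> wzeta; have := cmodDB a (- z); rewrite opprK cmodN; lra.
have h1 := p _ ct; have h3 := p _ ci.
have h2 : 0 < cmod (a - t%:C) by apply: p; rewrite cmodN.
have h4 : 0 < cmod (a - 'i * t%:C) by apply: p; rewrite cmodN.
rewrite /cross -!lnM ?posrE ?mulr_gt0// -!cmodM.
have -> : (a + t%:C) * (a - t%:C) * (a + 'i * t%:C) * (a - 'i * t%:C) = a ^+ 4 - t%:C ^+ 4.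
  have : ('i : C) ^+ 2 = -1 by rewrite sqr_i.
  set j : C := 'i => jE.
  have -> : (a + t%:C) * (a - t%:C) * (a + j * t%:C) * (a - j * t%:C) =
    (a ^+ 2 - t%:C ^+ 2) * (a ^+ 2 - j ^+ 2 * t%:C ^+ 2) by ring.
  by rewrite jE; ring.
have q0 : 0 < 1 + (t / cmod a) ^+ 4 by rewrite ltr_wpDr// exprn_ge0// divr_ge0 ?cmod_ge0// ltW.
apply: le_trans (_ : ln (cmod a ^+ 4 * (1 + (t / cmod a) ^+ 4)) <= _).
  have pos : 0 < cmod (a ^+ 4 - t%:C ^+ 4).
    apply: lt_le_trans (cmodDB _ _); rewrite !cmodX ct subr_gt0.
    by rewrite ltrXn2r// ?nnegrE ?cmod_ge0// ltW.
  rewrite ler_ln ?posrE ?mulr_gt0 ?exprn_gt0//.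
  have := cmodD (a ^+ 4) (- t%:C ^+ 4); rewrite cmodN !cmodX ct => /le_trans; apply.
  by rewrite mulrDr mulr1 lerD2l expr_div_n mulrC divfK// gt_eqF// exprn_gt0.
rewrite lnM ?posrE ?exprn_gt0// lnXn// mulr_natl lerD2l.
have q1 : -1 < (t / cmod a) ^+ 4 by lra.
exact: le_ln1Dx q1.
Qed.


(** A maximum principle with a logarithmic barrier. As u is bounded above, u - b ln |z| is
    small far away; adding d |z| ^ 2 excludes a maximum in between, so the maximum occurs
    near 0. For small b and d both corrections are negligible at the given point. *)
Lemma liouville_real u (M : R) : (forall z, u z <= M) -> ccont u ->
  (forall a (d : R), 0 < d -> exists2 r : R, 0 < r &
     forall t, 0 < t -> t <= r -> 4 * u a - d * t ^+ 2 <= cross u a t) ->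
  forall z, u z <= u 0.
Proof.
move=> uM cu Hu z0; apply/ler_addgt0Pl => e' e'0.
pose e := e' / 3; have e0 : 0 < e by rewrite /e; lra.
have [r r0 Hr] := cu 0 e e0.
have {}Hr z : cmod z <= r -> u z <= u 0 + e.
  by rewrite -[X in cmod X]subr0 => /Hr; rewrite ler_norml => /andP[]; lra.
pose lg (x : R) := ln (Num.max x r) - ln r.
have lg0 x : 0 <= lg x.
  by rewrite /lg subr_ge0 ler_ln ?posrE ?lt_max ?r0 ?orbT// le_max lexx orbT.
have lgmono x y : x <= y -> lg x <= lg y.
  move=> xy; rewrite /lg lerD2r ler_ln ?posrE ?lt_max ?r0 ?orbT//.
  by rewrite ge_max !le_max xy lexx orbT.
pose b := e / (1 + lg (cmod z0)).
have b0 : 0 < b by rewrite divr_gt0// ltr_pwDl.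
have bz0 : b * lg (cmod z0) <= e.
  by rewrite /b mulrAC ler_pdivrMr ?ltr_pwDl// ler_pM2l// lerDr.
(* B is so large that, outside the disc of radius B, the barrier outweighs the bound M. *)
pose B := cmod z0 + r * expR ((M - u 0) / b).
have B0 : 0 < B by rewrite ltr_wpDl ?cmod_ge0// mulr_gt0// expR_gt0.
have lgB : M - u 0 <= b * lg B.
  rewrite -ler_pdivrMl// mulrC; apply: le_trans (lgmono (r * expR ((M - u 0) / b)) _ _); last first.
    by rewrite lerDr cmod_ge0.
  rewrite /lg lerBrDl -[X in _ + X <= _]expRK -lnM ?posrE ?expR_gt0//.
  by rewrite ler_ln ?posrE ?mulr_gt0 ?expR_gt0// ?lt_max ?r0 ?orbT// le_max lexx.
pose d := e / (2 * B ^+ 2).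
have d0 : 0 < d by rewrite divr_gt0// mulr_gt0// exprn_gt0.
pose v z := u z + (- (b * lg (cmod z)) + d * cmod z ^+ 2).
have cv : ccont v.
  apply: ccontD => //; apply: (ccont_cmod (f := fun x => - (b * lg x) + d * x ^+ 2)) => x x0.
  apply: continuousD; last first.
    by apply: continuousM; [exact: cst_continuous|exact: exprn_continuous].
  apply: continuousN; apply: continuousM; first exact: cst_continuous.
  apply: continuousB; last exact: cst_continuous.
  have cm : {for x, continuous (fun y : R => Num.max y r)}.
    by apply: continuous_max; [exact: cvg_id|exact: cst_continuous].
  apply: (continuous_comp cm).
  by apply: continuous_ln; rewrite lt_max r0 orbT.
have [a [aRe aIm amax]] := box_max (ltW B0) cv.
have va : v a <= u 0 + 2 * e.
  have sq : d * cmod a ^+ 2 <= e.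
    rewrite cmod_sqr /d mulrAC ler_pdivrMr ?mulr_gt0 ?exprn_gt0// ler_pM2l//.
    have sqB x : `|x| <= B -> x ^+ 2 <= B ^+ 2.
      by move=> xB; rewrite -real_normK ?num_real// lerXn2r// nnegrE// ltW.
    have := sqB _ aRe; have := sqB _ aIm; lra.
  have [ar|ra] := leP (cmod a) r.
    have := Hr _ ar; rewrite /v; have := mulr_ge0 (ltW b0) (lg0 (cmod a)); lra.
  have [Ba|aB] := leP B (cmod a).
    have := uM a; have := ler_wpM2l (ltW b0) (lgmono _ _ Ba); rewrite /v; lra.
  exfalso.
  (* At an interior maximum of v the discrete Laplacian is nonpositive, but here the
     contribution 4 d t ^ 2 of d |z| ^ 2 dominates the errors. *)
  have aRe' : `|complex.Re a| < B by apply: le_lt_trans (cmod_Re a) aB.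
  have aIm' : `|complex.Im a| < B by apply: le_lt_trans (cmod_Im a) aB.
  have ca0 : 0 < cmod a by lra.
  have [s s0 Hs] := Hu a d d0.
  pose q := b / cmod a ^+ 4.
  have q0 : 0 < q by rewrite divr_gt0// exprn_gt0.
  pose t := Num.min (Num.min s 1) (Num.min (Num.min ((B - cmod a)/2) ((cmod a - r) / 2)) (d / (1 + q))).
  have p1 : 0 < (B - cmod a) / 2 by lra.
  have p2 : 0 < (cmod a - r) / 2 by lra.
  have p3 : 0 < d / (1 + q) by rewrite divr_gt0// addr_gt0.
  have t0 : 0 < t by rewrite !lt_min s0 ltr01 p1 p2 p3.
  have [ts t1 tB tr tq] : [/\ t <= s, t <= 1, t <= (B - cmod a) / 2, t <= (cmod a - r) / 2 & t <= d / (1 + q)].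
    by split; rewrite /t !ge_min ?lexx ?orbT.
  have ct : cmod t%:C = t by rewrite cmod_real ger0_norm// ltW.
  have ci : cmod ('i * t%:C : C) = t by rewrite cmodM ct cmodi mul1r.
  have pt h : cmod h = t -> v (a + h) <= v a /\ lg (cmod (a + h)) = ln (cmod (a + h)) - ln r.
    move=> ht; have h1 := cmodD a h; have h2 := cmodDB a (- h); rewrite opprK cmodN ht in h2.
    split; last by rewrite /lg; congr (ln _ - _); apply/max_idPl; lra.
    by apply: amax; [apply: le_trans (cmod_Re _) _|apply: le_trans (cmod_Im _) _]; lra.
  have [v1 l1] := pt _ ct; have [v3 l3] := pt _ ci.
  have [v2 l2] := pt (- t%:C) ltac:(by rewrite cmodN).
  have [v4 l4] := pt (- ('i * t%:C)) ltac:(by rewrite cmodN).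
  have la : lg (cmod a) = ln (cmod a) - ln r.
    by rewrite /lg; congr (ln _ - _); apply/max_idPl; lra.
  have H1 := Hs t t0 ts.
  have H2 := cross_sqr a t.
  have H3 : cross (fun z => ln (cmod z)) a t <= 4 * ln (cmod a) + (t / cmod a) ^+ 4.
    by apply: cross_ln => //; lra.
  move: v1 v2 v3 v4 H1 H2 H3; rewrite /v l1 l2 l3 l4 la /cross.
  set A1 := ln (cmod (a + _)); set A2 := ln (cmod (a + _)); set A3 := ln (cmod (a + _)); set A4 := ln (cmod (a + _)).
  set S1 := cmod (a + _) ^+ 2; set S2 := cmod (a + _) ^+ 2; set S3 := cmod (a + _) ^+ 2; set S4 := cmod (a + _) ^+ 2.
  move=> v1 v2 v3 v4 H1 H2 H3.
  have H3' := ler_wpM2l (ltW b0) H3.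
  have H2' : d * (S1 + S2 + S3 + S4) = d * (4 * cmod a ^+ 2 + 4 * t ^+ 2) by rewrite H2.
  have H4 : b * (t / cmod a) ^+ 4 <= d * t ^+ 2.
    have -> : b * (t / cmod a) ^+ 4 = q * t * (t * t ^+ 2) by rewrite /q; field; rewrite gt_eqF.
    have qt : q * t <= d.
      apply: le_trans (_ : q * (d / (1 + q)) <= _); first by rewrite ler_wpM2l// ltW.
      by rewrite mulrA ler_pdivrMr ?addr_gt0// mulrC ler_pM2l// lerDr.
    have t2 : 0 <= t ^+ 2 := exprn_ge0 2 (ltW t0).
    by apply: (ler_pM (mulr_ge0 (ltW q0) (ltW t0)) (mulr_ge0 (ltW t0) t2) qt); rewrite ler_piMl.
  have dt : 0 < d * t ^+ 2 by rewrite mulr_gt0// exprn_gt0.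
  lra.
have zB : cmod z0 <= B by rewrite lerDl mulr_ge0 ?expR_ge0// ltW.
have := amax z0 (le_trans (cmod_Re _) zB) (le_trans (cmod_Im _) zB).
rewrite {1}/v => h.
have : 0 <= d * cmod z0 ^+ 2 by rewrite mulr_ge0 ?exprn_ge0 ?cmod_ge0// ltW.
have : e' = 3 * e by rewrite /e; field.
lra.
Qed.


Lemma jet_cont (F : C -> C) a (r N : R) d : 0 < r -> jet r N (fun h => F (a + h)) d ->
  forall e : R, 0 < e -> exists2 s : R, 0 < s & forall z, cmod (z - a) <= s -> cmod (F z - F a) <= e.
Proof.
move=> r0 J e e0; have N0 := jet_ge0 (ltW r0) J.
case: J => c [K [K0 H Hf]]; rewrite !addr0 in H Hf.
pose A := cmod d + cmod c * r + K * r ^+ 2.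
have A0 : 0 <= A by rewrite !addr_ge0 ?mulr_ge0 ?cmod_ge0 ?exprn_ge0// ltW.
exists (Num.min r (e / (1 + A))); first by rewrite lt_min r0 divr_gt0// ltr_pwDl.
move=> z; rewrite le_min => /andP[zr ze]; have := Hf _ zr; rewrite [a + _]addrC subrK.
set h := z - a in zr ze *; set t := cmod h in zr ze * => HH; clearbody h.
have t0 : 0 <= t := cmod_ge0 _.
have -> : F z - F a = (F z - F a - d * h - c * h ^+ 2) + c * h ^+ 2 + d * h by ring.
apply: le_trans (_ : t * A <= _); last first.
  apply: le_trans (_ : e / (1 + A) * A <= _); first by rewrite ler_wpM2r.
  by rewrite mulrAC ler_pdivrMr ?ltr_pwDl// ler_pM2l// lerDr.
apply: le_trans (cmodD _ _) _; rewrite cmodM -/t.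
have h1 : cmod (F z - F a - d * h - c * h ^+ 2 + c * h ^+ 2) <= t * (cmod c * r + K * r ^+ 2).
  apply: le_trans (cmodD _ _) _; rewrite [X in _ <= X]mulrDr [X in _ <= X]addrC; apply: lerD; last first.
    by rewrite cmodM cmodX -/t expr2 mulrCA ler_wpM2l// ler_wpM2l ?cmod_ge0.
  apply: le_trans HH _; rewrite exprS mulrCA ler_wpM2l// ler_wpM2l//.
  by rewrite lerXn2r ?nnegrE// ltW.
move: h1; rewrite /A !mulrDr; lra.
Qed.

Lemma jet_cross (F : C -> C) (k : C) a (r N : R) d : 0 < r -> jet r N (fun h => F (a + h)) d ->
  forall e : R, 0 < e -> exists2 s : R, 0 < s & forall t, 0 < t -> t <= s ->
    4 * complex.Re (k * F a) - e * t ^+ 2 <= cross (fun z => complex.Re (k * F z)) a t.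
Proof.
move=> r0 [c [K [K0 H Hf]]] e e0; rewrite addr0 in Hf.
exists (Num.min r (e / (1 + 4 * cmod k * K))).
  by rewrite lt_min r0 divr_gt0// ltr_pwDl// !mulr_ge0 ?cmod_ge0.
move=> t t0; rewrite le_min => /andP[tr te].
have ct : cmod t%:C = t by rewrite cmod_real ger0_norm// ltW.
have ci : cmod ('i * t%:C : C) = t by rewrite cmodM ct cmodi mul1r.
have P h : cmod h = t -> exists2 x, F (a + h) = F a + d * h + c * h ^+ 2 + x & - (cmod k * K * t ^+ 3) <= complex.Re (k * x).
  move=> ht; exists (F (a + h) - F a - d * h - c * h ^+ 2); first by ring.
  rewrite lerNl; apply: le_trans (ler_norm _) _; rewrite normrN.
  apply: le_trans (cmod_Re _) _; rewrite cmodM -mulrA ler_wpM2l ?cmod_ge0//.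
  by rewrite -ht; apply: Hf; rewrite ht.
have [x1 e1 l1] := P _ ct; have [x3 e3 l3] := P _ ci.
have [x2 e2 l2] := P (- t%:C) ltac:(by rewrite cmodN).
have [x4 e4 l4] := P (- ('i * t%:C)) ltac:(by rewrite cmodN).
rewrite /cross e1 e2 e3 e4 -!raddfD /=.
have -> : k * (F a + d * t%:C + c * t%:C ^+ 2 + x1) + k * (F a + d * - t%:C + c * (- t%:C) ^+ 2 + x2) +
  k * (F a + d * ('i * t%:C) + c * ('i * t%:C) ^+ 2 + x3) +
  k * (F a + d * - ('i * t%:C) + c * (- ('i * t%:C)) ^+ 2 + x4) =
  k * F a + k * F a + k * F a + k * F a + k * x1 + k * x2 + k * x3 + k * x4.
  have : ('i : C) ^+ 2 = -1 by rewrite sqr_i.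
  by set j : C := 'i => jE; rewrite !sqrrN !exprMn jE; ring.
have h : 4 * (cmod k * K * t ^+ 3) <= e * t ^+ 2.
  have X0 : 0 <= 4 * cmod k * K by rewrite !mulr_ge0 ?cmod_ge0.
  have -> : 4 * (cmod k * K * t ^+ 3) = (4 * cmod k * K * t) * t ^+ 2 by ring.
  rewrite ler_wpM2r ?exprn_ge0 ?(ltW t0)//.
  apply: le_trans (_ : 4 * cmod k * K * (e / (1 + 4 * cmod k * K)) <= _); first by rewrite ler_wpM2l.
  by rewrite mulrA ler_pdivrMr ?ltr_pwDl// mulrC ler_pM2l// lerDr.
move: l1 l2 l3 l4 h; rewrite !(raddfD (@complex.Re R)) /=; lra.
Qed.

(** Second-order expansions suffice: the discrete Laplacian of Re (k F) is O(t ^ 3), and the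
    maximum principle applies for k = 1, - 1, i and - i. *)
Lemma liouville (F : C -> C) (M : R) : (forall z, cmod (F z) <= M) ->
  (forall a, exists r N d, 0 < r /\ jet r N (fun h => F (a + h)) d) ->
  forall z, F z = F 0.
Proof.
move=> FM J.
have H k z : cmod k = 1 -> complex.Re (k * F z) <= complex.Re (k * F 0).
  move=> k1; apply: (@liouville_real (fun z => complex.Re (k * F z)) M).
  - move=> {}z; apply: le_trans (ler_norm _) _; apply: le_trans (cmod_Re _) _.
    by rewrite cmodM k1 mul1r.
  - move=> a e e0; have [r [N [d [r0 Ja]]]] := J a.
    have [s s0 Hs] := jet_cont r0 Ja e0; exists s => // x /Hs; apply: le_trans.
    by rewrite -raddfB -mulrBr; apply: le_trans (cmod_Re _) _; rewrite cmodM k1 mul1r.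
  - move=> a e e0; have [r [N [d [r0 Ja]]]] := J a; exact: (jet_cross k r0 Ja).
move=> z.
have := H 1 z (cmod1 _); have := H (-1) z ltac:(by rewrite cmodN cmod1).
have := H 'i z (cmodi); have := H (- 'i) z ltac:(by rewrite cmodN cmodi).
rewrite !mulNr !mul1r !raddfN /= ![_ * F _]mulrC !ReiNIm => h1 h2 h3 h4.
by apply/eqP; rewrite eq_complex; apply/andP; split; apply/eqP; lra.
Qed.

(** A continuous periodic function is bounded by its values on a fundamental domain. *)
Lemma liouville_periodic (F : C -> C) (L : set C) (rho : R) :
  (forall a, exists r N d, 0 < r /\ jet r N (fun h => F (a + h)) d) ->
  (forall z (u : C), L u -> F (z + u) = F z) ->
  (forall z, exists2 u, L u & cmod (z - u) <= rho) ->
  forall z, F z = F 0.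
Proof.
move=> J per cpt.
have rho0 : 0 <= rho by have [u _] := cpt 0; apply: le_trans (cmod_ge0 _).
have cF : ccont (fun z => cmod (F z)).
  move=> a e e0; have [r [N [d [r0 Ja]]]] := J a.
  have [s s0 Hs] := jet_cont r0 Ja e0; exists s => // x /Hs; apply: le_trans.
  have h1 := cmodDB (F x) (F a); have h2 := cmodDB (F a) (F x); rewrite cmodB in h2.
  by rewrite ler_norml; apply/andP; split; lra.
have [a [_ _ amax]] := box_max rho0 cF.
apply: (liouville (M := cmod (F a))) => // z.
have [u Lu zu] := cpt z; rewrite -[z](subrK u) per//.
by apply: amax; [apply: le_trans (cmod_Re _) _|apply: le_trans (cmod_Im _) _].
Qed.

End Liouville.

(** * Complex derivatives with quadratic remainder *)

Section Derivative.
Variable R : realType.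
Local Notation C := R[i].
Implicit Types (f g : C -> C) (a d h : C).

(** An explicit quadratic bound on the remainder passes to infinite products, which a limit
    of difference quotients does not. *)
Definition has_deriv f a d := exists r K : R, [/\ 0 < r, 0 <= K &
  forall h, cmod h <= r -> cmod (f (a + h) - f a - d * h) <= K * cmod h ^+ 2].

Lemma jet_has_deriv (r N : R) f a d : 0 < r -> jet r N (fun h => f (a + h)) d -> has_deriv f a d.
Proof.
move=> r0 [c [K [K0 _ H]]]; exists r, (cmod c + K * r); split => //.
  by rewrite addr_ge0 ?cmod_ge0// mulr_ge0// ltW.
move=> h hr; have := H h hr; rewrite addr0.
set x := f (a + h) - f a - d * h => hx.
have -> : x = (x - c * h ^+ 2) + c * h ^+ 2 by rewrite subrK.
apply: le_trans (cmodD _ _) _; rewrite cmodM cmodX mulrDl addrC lerD2l.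
apply: le_trans hx _; rewrite exprS mulrA ler_wpM2r ?exprn_ge0 ?cmod_ge0//.
by rewrite ler_wpM2l.
Qed.

Lemma has_deriv_ext (s : R) f g a d : 0 < s -> (forall h, cmod h <= s -> f (a + h) = g (a + h)) ->
  has_deriv f a d -> has_deriv g a d.
Proof.
move=> s0 fg [r [K [r0 K0 H]]]; exists (Num.min r s), K; split => //; first by rewrite lt_min r0.
move=> h; rewrite le_min => /andP[hr hs].
have := fg 0; rewrite cmod0 addr0 => /(_ (ltW s0)) <-.
by rewrite -fg//; exact: H.
Qed.

Lemma has_deriv_cst c a : has_deriv (fun=> c) a 0.
Proof.
exists 1, 0; split => // h _; by rewrite subrr mul0r subrr cmod0 mul0r.
Qed.

Lemma has_deriv_id a : has_deriv id a 1.
Proof.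
exists 1, 0; split => // h _; by rewrite mul1r [a + h]addrC addrK subrr cmod0 mul0r.
Qed.

Lemma has_derivD f g a d d' : has_deriv f a d -> has_deriv g a d' -> has_deriv (fun z => f z + g z) a (d + d').
Proof.
move=> [r [K [r0 K0 H]]] [r' [K' [r0' K0' H']]].
exists (Num.min r r'), (K + K'); split; [by rewrite lt_min r0|exact: addr_ge0|].
move=> h; rewrite le_min => /andP[/H h1 /H' h2].
have -> : f (a + h) + g (a + h) - (f a + g a) - (d + d') * h =
  (f (a + h) - f a - d * h) + (g (a + h) - g a - d' * h) by ring.
by apply: le_trans (cmodD _ _) _; rewrite mulrDl lerD.
Qed.

Lemma has_deriv_lip f a d : has_deriv f a d -> exists r M : R, [/\ 0 < r, r <= 1, 0 <= M &
  forall h, cmod h <= r -> cmod (f (a + h) - f a) <= M * cmod h].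
Proof.
move=> [r [K [r0 K0 H]]]; exists (Num.min r 1), (cmod d + K).
rewrite lt_min r0 ltr01 ge_min lexx orbT addr_ge0 ?cmod_ge0//; split => // h.
rewrite le_min => /andP[/H hr h1].
have -> : f (a + h) - f a = d * h + (f (a + h) - f a - d * h) by ring.
apply: le_trans (cmodD _ _) _; rewrite cmodM mulrDl lerD2l.
by apply: le_trans hr _; rewrite ler_wpM2l// ler_piMl// cmod_ge0.
Qed.

Lemma has_derivM f g a d d' : has_deriv f a d -> has_deriv g a d' ->
  has_deriv (fun z => f z * g z) a (d * g a + f a * d').
Proof.
move=> Df Dg; have [r2 [M [r20 _ M0 HM]]] := has_deriv_lip Df; have [r3 [M' [r30 _ M0' HM']]] := has_deriv_lip Dg.
case: Df Dg => [r [K [r0 K0 H]]] [r' [K' [r0' K0' H']]].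
exists (Num.min (Num.min r r') (Num.min r2 r3)), (K * cmod (g a) + cmod (f a) * K' + M * M'); split.
- by rewrite !lt_min r0 r0' r20.
- by rewrite !addr_ge0// mulr_ge0// cmod_ge0.
move=> h; rewrite !le_min => /andP[/andP[/H h1 /H' h2] /andP[/HM h3 /HM' h4]].
have -> : f (a + h) * g (a + h) - f a * g a - (d * g a + f a * d') * h =
  (f (a + h) - f a - d * h) * g a + f a * (g (a + h) - g a - d' * h) +
  (f (a + h) - f a) * (g (a + h) - g a) by ring.
rewrite [X in _ <= X]mulrDl [X in _ <= X + _]mulrDl.
apply: le_trans (cmodD _ _) _; apply: lerD.
  apply: le_trans (cmodD _ _) _; apply: lerD; rewrite cmodM.
    by rewrite mulrAC ler_wpM2r ?cmod_ge0.
  by rewrite -mulrA ler_wpM2l ?cmod_ge0.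
rewrite cmodM expr2 mulrACA; apply: ler_pM; rewrite ?cmod_ge0//.
Qed.

Lemma has_derivZ c f a d : has_deriv f a d -> has_deriv (fun z => c * f z) a (c * d).
Proof. by move=> /(has_derivM (has_deriv_cst c a)); rewrite mul0r add0r. Qed.

Lemma has_derivN f a d : has_deriv f a d -> has_deriv (fun z => - f z) a (- d).
Proof.
move=> /(has_derivZ (-1)); rewrite mulN1r; apply: (has_deriv_ext ltr01) => h _; by rewrite mulN1r.
Qed.

Lemma has_derivB f g a d d' : has_deriv f a d -> has_deriv g a d' -> has_deriv (fun z => f z - g z) a (d - d').
Proof. by move=> Df /has_derivN; apply: has_derivD. Qed.

Lemma has_derivV f a d : f a != 0 -> has_deriv f a d -> has_deriv (fun z => (f z)^-1) a (- (d / f a ^+ 2)).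
Proof.
move=> fa0 Df; have [r2 [M [r20 _ M0 HM]]] := has_deriv_lip Df.
case: Df => [r [K [r0 K0 H]]].
have q0 : 0 < cmod (f a) by rewrite cmod_gt0.
pose q := cmod (f a); have q0l : 0 <= q := ltW q0.
have qi : 0 <= 2 / q by rewrite divr_ge0.
have qg : q != 0 by rewrite gt_eqF.
pose s := Num.min (Num.min r r2) (q / (2 * (1 + M))).
have M1 : 0 < 1 + M by lra.
exists s, ((K + M * M * (2 / q)) / q ^+ 2); split.
- by rewrite !lt_min r0 r20 divr_gt0// mulr_gt0.
- by rewrite divr_ge0 ?exprn_ge0// addr_ge0// mulr_ge0// mulr_ge0.
move=> h; rewrite !le_min => /andP[/andP[/H h1 /HM h2] h3].
have MH : M * cmod h <= q / 2.
  apply: le_trans (_ : (1 + M) * cmod h <= _); first by rewrite ler_wpM2r ?cmod_ge0// lerDr.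
  have -> : q / 2 = (1 + M) * (q / (2 * (1 + M))) by field; rewrite gt_eqF.
  by rewrite ler_wpM2l// ltW.
have fh : q / 2 <= cmod (f (a + h)).
  have := cmodDB (f a) (f (a + h)); rewrite cmodB -/q; lra.
have q2 : 0 < q / 2 by rewrite divr_gt0.
have fh0 : f (a + h) != 0 by rewrite -cmod_gt0; apply: lt_le_trans fh.
have -> : (f (a + h))^-1 - (f a)^-1 - - (d / f a ^+ 2) * h =
   (- (f (a + h) - f a - d * h) + (f (a + h) - f a) * (f (a + h) - f a) * (f (a + h))^-1) * (f a ^+ 2)^-1.
  by field; rewrite fa0 fh0.
rewrite cmodM cmodV cmodX -/q [X in _ <= X]mulrAC ler_wpM2r ?invr_ge0 ?exprn_ge0//.
apply: le_trans (cmodD _ _) _; rewrite cmodN [X in _ <= X]mulrDl lerD//.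
have -> : M * M * (2 / q) * cmod h ^+ 2 = (M * cmod h) * (M * cmod h) * (q / 2)^-1.
  by field; rewrite qg.
rewrite cmodM cmodV cmodM; apply: ler_pM; rewrite ?mulr_ge0 ?invr_ge0 ?cmod_ge0//.
  by apply: ler_pM; rewrite ?cmod_ge0.
by rewrite lef_pV2 ?posrE ?divr_gt0//; apply: lt_le_trans fh; rewrite divr_gt0.
Qed.

Lemma has_deriv_derive1 f a d : has_deriv f a d -> derive1 f a = d.
Proof.
move=> [r [K [r0 K0 H]]]; rewrite /derive1; apply: cvg_lim; first exact: norm_hausdorff.
apply/cvgrPdist_le => e e0.
have e1 : 0 < complex.Re e by move: e0; rewrite ltcE => /andP[].
have eE : e = (complex.Re e)%:C by rewrite RRe_real// gtr0_real.
pose s := Num.min r (complex.Re e / (1 + K)).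
have s0 : 0 < s by rewrite lt_min r0 divr_gt0// ltr_pwDl.
have s0' : (0 : C) < s%:C by rewrite ltcR.
rewrite /dnbhs near_withinE; apply: filterS (nbhsx_ballx (0 : C) _ s0') => h.
rewrite -ball_normE /= sub0r normrN -cmodE ltcR => hs hn0.
have cs : cmod h <= s by apply: ltW.
have hr : cmod h <= r by apply: le_trans cs _; rewrite ge_min lexx.
have he : cmod h <= complex.Re e / (1 + K) by apply: le_trans cs _; rewrite ge_min lexx orbT.
rewrite eE -cmodE lecR.
have -> : d - h^-1 *: (f (h + a) - f a) = - (h^-1 * (f (a + h) - f a - d * h)).
  rewrite /GRing.scale /= [h + a]addrC; field; exact: hn0.
have h0 : 0 < cmod h by rewrite cmod_gt0.
rewrite cmodN cmodM cmodV ler_pdivrMl//; apply: le_trans (H _ hr) _.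
rewrite expr2 mulrCA ler_wpM2l ?(ltW h0)//.
apply: le_trans (_ : K * (complex.Re e / (1 + K)) <= _); first by rewrite ler_wpM2l.
by rewrite mulrA ler_pdivrMr ?ltr_pwDl// mulrC ler_pM2l// lerDr.
Qed.

(** The mean value theorem, applied along the segment to the real and imaginary parts. *)
Lemma has_deriv_segment_cst f (z0 z1 : C) :
  (forall t : R, 0 <= t <= 1 -> has_deriv f (z0 + t%:C * (z1 - z0)) 0) -> f z1 = f z0.
Proof.
move=> Hf.
have real_part (k : C) : complex.Re (k * f z1) = complex.Re (k * f z0).
  pose g (t : R) := complex.Re (k * f (z0 + t%:C * (z1 - z0))).
  have gd (t : R) : 0 <= t <= 1 -> is_derive t 1 g 0.
    move=> t01; have [r [K [r0 K0 H]]] := Hf t t01.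
    pose q := cmod (z1 - z0).
    have q0 : 0 <= q := cmod_ge0 _.
    pose L := cmod k * K * q ^+ 2.
    have L0 : 0 <= L by rewrite !mulr_ge0 ?cmod_ge0 ?exprn_ge0.
    have Hg (s : R) : `|s| * q <= r -> `|g (t + s) - g t| <= L * `|s| ^+ 2.
      move=> sr; have h1 : cmod (s%:C * (z1 - z0)) <= r by rewrite cmodM cmod_real.
      rewrite /g -raddfB /= -mulrBr.
      apply: le_trans (cmod_Re _) _; rewrite cmodM.
      have := H _ h1; rewrite mul0r subr0 cmodM cmod_real -/q exprMn.
      have -> : z0 + t%:C * (z1 - z0) + s%:C * (z1 - z0) = z0 + (t + s)%:C * (z1 - z0).
        by rewrite rmorphD /= mulrDl addrA.
      move=> /(ler_wpM2l (cmod_ge0 k)) /le_trans; apply.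
      by rewrite /L; have -> : cmod k * K * q ^+ 2 * `|s| ^+ 2 = cmod k * (K * (`|s| ^+ 2 * q ^+ 2)) by ring.
    have cg : h^-1 *: (g (h *: 1 + t) - g t) @[h --> 0^'] --> (0 : R).
      apply/cvgrPdist_le => e e0.
      pose s := Num.min (r / (1 + q)) (e / (1 + L)).
      have s0 : 0 < s by rewrite lt_min !divr_gt0// ltr_pwDl.
      exists s => //= h hs0 hn0.
      have hs : `|h| < s by move: hs0; rewrite /ball_ /= sub0r normrN.
      have hr : `|h| * q <= r.
        apply: le_trans (_ : r / (1 + q) * q <= _).
          by rewrite ler_wpM2r// ltW// (lt_le_trans hs)// ge_min lexx.
        by rewrite mulrAC ler_pdivrMr ?ltr_pwDl// ler_pM2l// lerDr.
      have he : `|h| <= e / (1 + L) by rewrite ltW// (lt_le_trans hs)// ge_min lexx orbT.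
      have := Hg h hr; rewrite sub0r normrN /GRing.scale /= mulr1 [h + t]addrC => hg.
      have h0 : 0 < `|h| by rewrite normr_gt0.
      rewrite normrM normfV ler_pdivrMl//; apply: le_trans hg _.
      rewrite expr2 mulrCA ler_wpM2l ?(ltW h0)//.
      apply: le_trans (_ : L * (e / (1 + L)) <= _); first by rewrite ler_wpM2l.
      by rewrite mulrA ler_pdivrMr ?ltr_pwDl// mulrC ler_pM2l// lerDr.
    by apply: DeriveDef; [exact: (cvgP _ cg)|exact: cvg_lim].
  have [||x x01] := @MVT_segment R g (fun=> 0) 0 1 ler01.
  - by move=> x; rewrite in_itv /= => /andP[x0 x1]; apply: gd; rewrite !ltW.
  - apply: derivable_within_continuous => x; rewrite in_itv /= => /gd gx; exact: (@ex_derive _ _ _ _ _ _ _ gx).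
  by rewrite mul0r => /eqP; rewrite subr_eq0 /g mul0r addr0 mul1r addrC subrK => /eqP.
have h1 := real_part 1; have h2 := real_part 'i.
rewrite !mul1r ![_ * f _]mulrC !ReiNIm in h1 h2.
by apply/eqP; rewrite eq_complex h1 eqxx /=; apply/eqP/oppr_inj.
Qed.

End Derivative.

(** * Infinite products *)

Section Products.
Variable R : realType.
#[local] Existing Instance totally_filter.
Local Notation C := R[i].
Implicit Types (f b : C -> C) (m : C -> R) (S : set C) (M : R).

(** The remainder is quadratic in the sum of the moduli; this gives both the convergence of
    infinite products and their derivatives. *)
Lemma prod_near1 (I : Type) (s : seq I) (a : I -> C) :
  let T := \sum_(i <- s) cmod (a i) in T <= 1 / 2 ->
  cmod (\prod_(i <- s) (1 + a i) - 1 - \sum_(i <- s) a i) <= 2 * T ^+ 2.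
Proof.
have g0 (t : seq I) : 0 <= \sum_(i <- t) cmod (a i) by apply: sumr_ge0 => i _; exact: cmod_ge0.
elim: s => [|i s IH] /=.
  by move=> _; rewrite !big_nil subrr subr0 cmod0 expr0n mulr0.
rewrite !big_cons; set T := \sum_(j <- s) cmod (a j) in IH *; set t := cmod (a i).
have T0 : 0 <= T := g0 s; have t0 : 0 <= t := cmod_ge0 _.
move=> tT; have {}IH := IH ltac:(lra).
set P := \prod_(j <- s) _ in IH *; set Q := \sum_(j <- s) a j in IH *.
have -> : (1 + a i) * P - 1 - (a i + Q) = (P - 1 - Q) + a i * (P - 1) by ring.
have P1 : cmod (P - 1) <= 2 * T.
  have -> : P - 1 = (P - 1 - Q) + Q by ring.
  apply: le_trans (cmodD _ _) _; have : cmod Q <= T by apply: cmod_sum.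
  have : 2 * T ^+ 2 <= T by rewrite expr2 mulrA ler_piMl//; lra.
  lra.
apply: le_trans (cmodD _ _) _; rewrite cmodM -/t.
have := ler_wpM2l t0 P1; rewrite sqrrD.
have := mulr_ge0 t0 T0; have := sqr_ge0 t; rewrite -mulr_natr; lra.
Qed.

Lemma prod_near1_le (I : Type) (s : seq I) (a : I -> C) :
  let T := \sum_(i <- s) cmod (a i) in T <= 1 / 2 ->
  cmod (\prod_(i <- s) (1 + a i) - 1) <= 2 * T.
Proof.
move=> T T2; have := prod_near1 T2; rewrite -/T => IH.
set P := \prod_(j <- s) _ in IH *; set Q := \sum_(j <- s) a j in IH.
have T0 : 0 <= T by apply: sumr_ge0 => i _; exact: cmod_ge0.
have -> : P - 1 = (P - 1 - Q) + Q by ring.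
apply: le_trans (cmodD _ _) _; have : cmod Q <= T by apply: cmod_sum.
have : 2 * T ^+ 2 <= T by rewrite expr2 mulrA ler_piMl//; lra.
lra.
Qed.

Definition pprod S f (A : {fset C}) := \prod_(u <- A) patch (fun=> 1) S f u.

Definition multipliable S f := exists M, majorised (fun u => cmod (patch (fun=> 1) S f u - 1)) M.

Lemma multipliable_le S f m M : majorised m M -> (forall u, 0 <= m u) ->
  (forall u, S u -> cmod (f u - 1) <= m u) -> multipliable S f.
Proof.
move=> mM m0 fm; exists M; apply: majorised_le mM => u; rewrite /patch.
by case: ifPn => [/set_mem/fm//|_]; rewrite subrr cmod0.
Qed.

Lemma pprodD S f A B : (A `<=` B)%fset -> pprod S f B = pprod S f A * pprod S f (B `\` A)%fset.
Proof.
move=> AB; rewrite /pprod (big_fsetID _ (fun u => u \in A)) /=; congr (_ * _).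
  apply: eq_fbigl => u; rewrite !inE /=; case uA: (u \in A); rewrite ?andbF ?andbT//.
  by rewrite (fsubsetP AB).
by apply: eq_fbigl => u; rewrite !inE /= andbC.
Qed.

Lemma pprod1 S f A : pprod S f A = \prod_(u <- A) (1 + (patch (fun=> 1) S f u - 1)).
Proof. by apply: eq_bigr => u _; rewrite addrC subrK. Qed.

Lemma pprod_bound S f M A : majorised (fun u => cmod (patch (fun=> 1) S f u - 1)) M ->
  cmod (pprod S f A) <= expR M.
Proof.
move=> fM; apply: le_trans (_ : expR (\sum_(u <- A) cmod (patch (fun=> 1) S f u - 1)) <= _).
  rewrite /pprod; elim/big_rec2 : _ => [|u x p _ IH]; first by rewrite cmod1 expR0.
  rewrite cmodM expRD; apply: ler_pM; rewrite ?cmod_ge0//.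
  apply: le_trans (expR_ge1Dx _); have := cmodD 1 (patch (fun=> 1) S f u - 1).
  by rewrite cmod1 addrC subrK.
by rewrite ler_expR; apply: fM.
Qed.

Lemma prod_tail S f (e : R) : multipliable S f -> 0 < e -> exists A, forall B, (A `<=` B)%fset ->
  cmod (pprod S f (B `\` A)%fset - 1) <= e.
Proof.
move=> [M fM] e0; have [||A HA] := majorised_tail (m := fun u => cmod (patch (fun=> 1) S f u - 1)) _ fM (e := Num.min (e / 2) (1 / 2)).
- by move=> u; exact: cmod_ge0.
- by rewrite lt_min !divr_gt0.
exists A => B AB; have AB' : [disjoint A & (B `\` A)%fset]%fset.
  by apply/fdisjointP => u uA; rewrite !inE uA.
have := HA _ AB'; rewrite le_min => /andP[h1 h2].
by rewrite pprod1; apply: le_trans (prod_near1_le h2) _; lra.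
Qed.

Lemma prod_over_cvg S f : multipliable S f -> pprod S f @ totally --> prod_over S f.
Proof.
move=> fS.
suff [l Hl] : exists l : C, pprod S f @ totally --> l.
  rewrite /prod_over; suff -> : (fun A : {fset C} => \prod_(u : A) patch (fun=> 1) S f (val u)) = pprod S f.
    by rewrite (cvg_totally_lim Hl).
  by apply/funext => A; rewrite /pprod big_seq_fsetE.
apply: cvg_totally_cauchy => e e0; have [M fM] := fS.
have E0 : 0 < expR M by apply: expR_gt0.
have [A HA] := prod_tail fS (divr_gt0 e0 E0).
exists A => B AB; rewrite (pprodD _ _ AB).
have -> : pprod S f A * pprod S f (B `\` A)%fset - pprod S f A = pprod S f A * (pprod S f (B `\` A)%fset - 1) by ring.
rewrite cmodM; apply: le_trans (_ : expR M * (e / expR M) <= _).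
  by apply: ler_pM; rewrite ?cmod_ge0// ?pprod_bound//; exact: HA.
by rewrite mulrC divfK// gt_eqF.
Qed.

Lemma prod_over_neq0 S f : multipliable S f -> (forall u, S u -> f u != 0) -> prod_over S f != 0.
Proof.
move=> fS f0; have h0 : (0 : R) < 1 / 2 by rewrite divr_gt0.
have [A HA] := prod_tail fS h0.
have PA : pprod S f A != 0.
  rewrite /pprod; elim/big_ind : _ => [|x y|u _]; [exact: oner_neq0|exact: mulf_neq0|].
  rewrite /patch.
  by case: ifPn => [/set_mem/f0//|_]; rewrite oner_eq0.
have : cmod (pprod S f A) <= 2 * cmod (prod_over S f).
  apply: (cvg_totally_le _ (cvg_cst (pprod S f A)) (prod_over_cvg fS)) => //.
  exists A => B AB; rewrite (pprodD _ _ AB) cmodM mulrCA ler_pMr ?cmod_gt0//.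
  have := HA B AB; have := cmodDB 1 (pprod S f (B `\` A)%fset); rewrite cmod1 cmodB; lra.
by rewrite -!cmod_gt0 in PA *; lra.
Qed.

Lemma prod_over_eq0 S f u : multipliable S f -> S u -> f u = 0 -> prod_over S f = 0.
Proof.
move=> fS Su fu; apply: (cvg_totally_uniq (prod_over_cvg fS)).
apply/cvg_totallyP => e e0; exists [fset u]%fset => B; rewrite fsub1set => uB.
by rewrite /pprod (big_fsetD1 u)//= /patch mem_set// fu mul0r subrr cmod0 ltW.
Qed.

Lemma prod_over1 S f : (forall u, S u -> f u = 1) -> prod_over S f = 1.
Proof.
move=> f1; have H : multipliable S f.
  exists 0 => A; rewrite big1// => u _; rewrite /patch.
  by case: ifPn => [/set_mem/f1 ->|_]; rewrite subrr cmod0.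
apply: (cvg_totally_uniq (prod_over_cvg H)).
apply/cvg_totallyP => e e0; exists fset0 => B _; rewrite /pprod big1 ?subrr ?cmod0 ?ltW// => u _.
by rewrite /patch; case: ifPn => [/set_mem/f1|].
Qed.

(** Logarithmic differentiation of an infinite product: the relative increments
    rho u h of the factors have first-order parts b u. *)
Lemma prod_over_has_deriv S (phi rho : C -> C -> C) b m M (r : R) a :
  0 < r -> majorised m M -> (forall u, 0 <= m u) ->
  (forall h, cmod h <= r -> multipliable S (phi^~ (a + h))) ->
  (forall u h, S u -> cmod h <= r -> phi u (a + h) = phi u a * rho u h) ->
  (forall u h, S u -> cmod h <= r -> cmod (rho u h - 1 - b u * h) <= m u * cmod h ^+ 2) ->
  (forall u, S u -> cmod (b u) <= m u) ->
  has_deriv (fun z => prod_over S (phi^~ z)) a (sum_over S b * prod_over S (phi^~ a)).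
Proof.
move=> r0 mM m0 cphi phiE Hrho Hb.
have M0 := majorised_ge0 mM.
have sb : summable_over S b by apply: summ_le mM m0 Hb.
exists (Num.min (Num.min r 1) (1 / (4 * (1 + M)))), ((8 * M ^+ 2 + M) * cmod (prod_over S (phi^~ a))); split.
- by rewrite !lt_min r0 ltr01 divr_gt0// mulr_gt0//; lra.
- by rewrite mulr_ge0 ?cmod_ge0// addr_ge0// mulr_ge0// exprn_ge0.
move=> h; rewrite !le_min => /andP[/andP[hr h1] hM].
set t := cmod h in hr h1 hM *; have t0 : 0 <= t := cmod_ge0 _.
have Mt : 4 * M * t <= 1.
  apply: le_trans (_ : 4 * (1 + M) * t <= _); first by rewrite ler_wpM2r// ler_pM2l// lerDr.
  by rewrite -ler_pdivlMl ?mulr_gt0//; [rewrite mulrC|lra].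
rewrite [X in _ <= X]mulrAC.
have ca : multipliable S (phi^~ a) by have := cphi 0; rewrite addr0 cmod0; apply; exact: ltW.
have LF := cvgB (cvgB (prod_over_cvg (cphi h hr)) (prod_over_cvg ca))
  (cvgM (cvgM (sum_over_cvg sb) (prod_over_cvg ca)) (cvg_cst h)).
have FF : Filter (@totally C) by exact: filter_filter.
do 5 have {}LF := LF FF.
apply: (cvg_totally_le _ LF (prod_over_cvg ca)).
  by rewrite mulr_ge0 ?exprn_ge0// addr_ge0// mulr_ge0// exprn_ge0.
exists fset0 => A _.
pose p := pprod S (phi^~ a) A; pose q := \prod_(u <- A) patch (fun=> 1) S (rho^~ h) u.
pose s := \sum_(u <- A) patch (fun=> 0) S b u.
rewrite -[X in cmod X]/(pprod S (phi^~ (a + h)) A - p - s * p * h).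
have -> : pprod S (phi^~ (a + h)) A = p * q.
  rewrite /p /q /pprod -big_split /=; apply: eq_bigr => u _; rewrite /patch.
  by case: ifPn => [/set_mem Su|_]; rewrite ?phiE// mulr1.
have -> : p * q - p - s * p * h = (q - 1 - s * h) * p by ring.
rewrite cmodM ler_wpM2r ?cmod_ge0//.
pose e u := patch (fun=> 0) S (fun u => rho u h - 1) u.
have qE : q = \prod_(u <- A) (1 + e u).
  apply: eq_bigr => u _; rewrite /e /patch; case: ifPn => _; last by rewrite addr0.
  by rewrite addrC subrK.
have eb u : cmod (e u - patch (fun=> 0) S b u * h) <= m u * t ^+ 2.
  rewrite /e /patch; case: ifPn => [/set_mem Su|_]; first exact: Hrho.
  by rewrite mul0r subrr cmod0 mulr_ge0// exprn_ge0.
have e1 u : cmod (e u) <= 2 * t * m u.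
  have -> : e u = (e u - patch (fun=> 0) S b u * h) + patch (fun=> 0) S b u * h by rewrite subrK.
  apply: le_trans (cmodD _ _) _; rewrite cmodM -/t.
  have : cmod (patch (fun=> 0) S b u) * t <= m u * t.
    by rewrite ler_wpM2r// /patch; case: ifPn => [/set_mem/Hb//|_]; rewrite cmod0.
  have : m u * t ^+ 2 <= m u * t by rewrite ler_wpM2l// expr2 ler_piMl.
  have := eb u; lra.
have Se : \sum_(u <- A) cmod (e u) <= 2 * t * M.
  apply: le_trans (_ : \sum_(u <- A) (2 * t * m u) <= _); first by apply: ler_sum => u _.
  by rewrite -mulr_sumr ler_wpM2l// mulr_ge0.
have Sh : \sum_(u <- A) cmod (e u) <= 1 / 2 by lra.
have := prod_near1 Sh; rewrite -qE /= => hq.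
have -> : q - 1 - s * h = (q - 1 - \sum_(u <- A) e u) + \sum_(u <- A) (e u - patch (fun=> 0) S b u * h).
  by rewrite big_split /= sumrN -mulr_suml -/s; ring.
rewrite mulrDl.
apply: le_trans (cmodD _ _) _; apply: lerD.
  apply: le_trans hq _; apply: le_trans (_ : 2 * (2 * t * M) ^+ 2 <= _).
    by rewrite ler_pM2l// lerXn2r// ?nnegrE ?mulr_ge0// sumr_ge0// => u _; rewrite cmod_ge0.
  by rewrite !exprMn; lra.
apply: le_trans (cmod_sum _ _ _) _.
apply: le_trans (_ : \sum_(u <- A) (m u * t ^+ 2) <= _); first by apply: ler_sum => u _.
by rewrite -mulr_suml ler_wpM2r// exprn_ge0.
Qed.

End Products.

(** * Weierstrass series over subsets of a lattice *)

Section LatticeSeries.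
Variable R : realType.

Let eq_ler (x y : R) : x = y -> x <= y. Proof. by move=> ->. Qed.

Local Notation C := R[i].
Implicit Types (a u z : C) (S : set C).

Definition cubic_weight (Lam : set C) u : R := if u \in Lam `\ 0 then (cmod u) ^- 3 else 0.

(** The standing hypothesis on the lattice in which all summation sets lie. *)
Definition ambient (Lam : set C) (delta M : R) := [/\ subgroup Lam, 0 < delta,
  forall u, Lam u -> u != 0 -> delta <= cmod u & majorised (cubic_weight Lam) M].

(** The series of the Weierstrass functions wp and zeta and of - wp' / 2, over any set S, so
    that they can be compared for a lattice and for its cosets. *)
Definition wp_sum S z := sum_over S (fun u => 1 / (z - u) ^+ 2 - 1 / u ^+ 2).
Definition wzeta_sum S z := sum_over S (fun u => 1 / (z - u) + 1 / u + z / u ^+ 2).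
Definition cube_sum S z := sum_over S (fun u => 1 / (z - u) ^+ 3).

(** For S symmetric, averaging over u and - u turns the three series, near 0, into z ^ 2,
    z ^ 3 and z times these. *)
Definition wp_reg S z := sum_over S (fun u => (3 * u ^+ 2 - z ^+ 2) / (u ^+ 2 * (z ^+ 2 - u ^+ 2) ^+ 2)).
Definition wzeta_reg S z := sum_over S (fun u => 1 / (u ^+ 2 * (z ^+ 2 - u ^+ 2))).
Definition cube_reg S z := sum_over S (fun u => (z ^+ 2 + 3 * u ^+ 2) / (z ^+ 2 - u ^+ 2) ^+ 3).

Section Ambient.
Variables (Lam : set C) (delta M : R).
Hypothesis amb : ambient Lam delta M.

Let delta0 : 0 < delta. Proof. by case: amb. Qed.
Let subLam : subgroup Lam. Proof. by case: amb. Qed.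
Let M0 : 0 <= M. Proof. by case: amb => _ _ _ /majorised_ge0. Qed.

Lemma cubic_weight_ge0 u : 0 <= cubic_weight Lam u.
Proof. by rewrite /cubic_weight; case: ifP => // _; rewrite invr_ge0 exprn_ge0// cmod_ge0. Qed.

Lemma amb_neq0 S u : S `<=` Lam `\ 0 -> S u -> u != 0.
Proof. by move=> SL /SL[_ /eqP]. Qed.

Lemma amb_ge S u : S `<=` Lam `\ 0 -> S u -> delta <= cmod u.
Proof. by move=> SL /[dup] /(amb_neq0 SL) u0 /SL[Lu _]; case: amb => _ _ + _; apply. Qed.

Lemma amb_gt0 S u : S `<=` Lam `\ 0 -> S u -> 0 < cmod u.
Proof. by move=> SL Su; rewrite cmod_gt0 (amb_neq0 SL Su). Qed.

Lemma jet_ambient (r K : R) S (f : C -> C -> C) (d : C -> C) : 0 < r -> 0 <= K -> S `<=` Lam `\ 0 ->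
  (forall u, S u -> jet r (K * cmod u ^- 3) (f u) (d u)) ->
  jet r (K * M) (fun h => sum_over S (fun u => f u h)) (sum_over S d).
Proof.
move=> r0 K0 SL J; apply: (jet_sum (N := fun u => K * cubic_weight Lam u)) => //.
- by case: amb => _ _ _; apply: majorisedZ.
- by move=> u; rewrite mulr_ge0// cubic_weight_ge0.
- by move=> u Su; rewrite /cubic_weight mem_set; [exact: J|exact: SL].
Qed.

Lemma jet_ambient_ex (r K : R) S (f : C -> C -> C) : 0 < r -> 0 <= K -> S `<=` Lam `\ 0 ->
  (forall u, S u -> exists d, jet r (K * cmod u ^- 3) (f u) d) ->
  exists d, jet r (K * M) (fun h => sum_over S (fun u => f u h)) d.
Proof.
move=> r0 K0 SL J.
have /choice[d Hd] : forall u, exists d, S u -> jet r (K * cmod u ^- 3) (f u) d.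
  move=> u; have [Su|Su] := pselect (S u); last by exists 0.
  by have [d Jd] := J u Su; exists d.
by exists (sum_over S d); apply: jet_ambient.
Qed.

Lemma summ_ambient (K : R) S (f : C -> C) : 0 <= K -> S `<=` Lam `\ 0 ->
  (forall u, S u -> cmod (f u) <= K * cmod u ^- 3) -> summable_over S f.
Proof.
move=> K0 SL H; apply: (summ_le (m := fun u => K * cubic_weight Lam u) (M := K * M)).
- by case: amb => _ _ _; apply: majorisedZ.
- by move=> u; rewrite mulr_ge0// cubic_weight_ge0.
- by move=> u Su; rewrite /cubic_weight mem_set; [exact: H|exact: SL].
Qed.

Lemma ambient_sep S z : S `<=` Lam -> ~ S z ->
  exists2 r : R, 0 < r & forall u, S u -> 2 * r <= cmod (z - u).
Proof.
move=> SL Sz; have [_ subL] := subLam; have [_ _ H _] := amb.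
have [[u0 Su0 uz]|no] := pselect (exists2 u, S u & cmod (z - u) < delta / 2).
  have zu0 : 0 < cmod (z - u0).
    by rewrite cmod_gt0 subr_eq0; apply/eqP => zu; apply: Sz; rewrite zu.
  exists (cmod (z - u0) / 2); first by rewrite divr_gt0.
  move=> u Su; rewrite mulrC divfK//.
  have [<-//|/eqP uu0] := pselect (u0 = u).
  have := H (u0 - u) (subL _ _ (SL _ Su0) (SL _ Su)); rewrite subr_eq0 => /(_ uu0).
  have := cmodD (z - u) (- (z - u0)); rewrite cmodN.
  have -> : z - u + - (z - u0) = u0 - u by ring.
  lra.
exists (delta / 4); first by rewrite divr_gt0.
move=> u Su; rewrite leNgt; apply/negP => h; apply: no; exists u => //; lra.
Qed.

Section Away.
Variables (S : set C) (a : C) (r : R).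
Hypotheses (SL : S `<=` Lam `\ 0) (r0 : 0 < r) (far : forall u, S u -> 2 * r <= cmod (a - u)).

Let c := 1 + cmod a / (2 * r).
Let c1 : 1 <= c. Proof. by rewrite /c lerDl divr_ge0 ?cmod_ge0// ltW// mulr_gt0. Qed.

Let au u : S u -> (cmod (a - u))^-1 <= c * (cmod u)^-1.
Proof.
move=> Su; have u0 := amb_gt0 SL Su; have h := far Su.
have x0 : 0 < cmod (a - u) by apply: lt_le_trans h; rewrite mulr_gt0.
rewrite ler_pdivlMr// mulrC ler_pdivrMr//.
rewrite /c mulrDl mul1r.
have := cmodD (a - u) (- a); rewrite cmodN.
have -> : a - u - a = - u by ring.
rewrite cmodN => /le_trans; apply; rewrite lerD2l.
rewrite -mulrA ler_peMr ?cmod_ge0// mulrC ler_pdivlMr ?mulr_gt0//.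
by rewrite mul1r.
Qed.

Let x_neq0 u h : S u -> cmod h <= r -> a - u + h != 0.
Proof.
move=> Su hr; have h1 := far Su; have := cmodDB (a - u) (- h).
rewrite opprK cmodN -cmod_gt0; apply: lt_le_trans; rewrite subr_gt0.
by apply: le_lt_trans hr _; apply: lt_le_trans h1; rewrite ltr_pMl// ltr1n.
Qed.

Let J1 u : S u -> jet r (2 * c * (cmod u)^-1) (fun h => (a - u + h)^-1) (- (a - u) ^- 2).
Proof.
move=> Su; apply: jet_weaken (jet_inv r0 (far Su)).
by rewrite -mulrA ler_pM2l// au.
Qed.

Let KA := (cmod a + r) ^+ 2 * (2 * c) + (cmod a + r) * (2 * c * (2 * c + 1)) + (2 * c) ^+ 3.

Let cpos : 0 < c. Proof. by apply: lt_le_trans c1. Qed.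
Let arpos : 0 <= cmod a + r. Proof. by rewrite addr_ge0 ?cmod_ge0// ltW. Qed.
Let k1 : 0 <= (cmod a + r) ^+ 2 * (2 * c).
Proof. by rewrite mulr_ge0 ?exprn_ge0// mulr_ge0// ltW. Qed.
Let k2 : 0 <= (cmod a + r) * (2 * c * (2 * c + 1)).
Proof. by rewrite mulr_ge0// mulr_ge0// ?addr_ge0// mulr_ge0// ltW. Qed.
Let k3 : 0 <= (2 * c) ^+ 3.
Proof. by rewrite exprn_ge0// mulr_ge0// ltW. Qed.
Let KA0 : 0 <= KA.
Proof. by rewrite !addr_ge0. Qed.
Let KA1 : (cmod a + r) ^+ 2 * (2 * c) <= KA.
Proof. by rewrite /KA -addrA lerDl addr_ge0. Qed.
Let KA2 : (cmod a + r) * (2 * c * (2 * c + 1)) <= KA.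
Proof. by rewrite /KA addrAC lerDr addr_ge0. Qed.
Let KA3 : (2 * c) ^+ 3 <= KA.
Proof. by rewrite /KA lerDr addr_ge0. Qed.

(** The summand is a + h times three expansions of size O(1 / |u|). *)
Lemma jet_wp_sum : exists N, jet r N (fun h => wp_sum S (a + h)) (- 2 * cube_sum S a).
Proof.
exists (KA * M).
have sd : summable_over S (fun u => 1 / (a - u) ^+ 3).
  apply: (summ_ambient (K := c ^+ 3)) => //; first by rewrite exprn_ge0// ltW.
  move=> u Su; rewrite mul1r cmodV cmodX -!exprVn -exprMn.
  by rewrite lerXn2r ?nnegrE ?invr_ge0 ?mulr_ge0 ?invr_ge0 ?cmod_ge0 ?au// ltW.
rewrite -sum_overZ//; apply: jet_ambient => // u Su.
have u0 := amb_neq0 SL Su; have r0' := ltW r0; have u0' := amb_gt0 SL Su.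
have J := jetM r0' (jet_var r a) (jetM r0' (jet_cst r u^-1) (jetM r0' (J1 Su) (jetB r0' (J1 Su) (jet_cst r u^-1)))).
have x0 : a - u != 0 by have := x_neq0 (h := 0) Su; rewrite addr0 cmod0; apply.
have dE : - 2 * (1 / (a - u) ^+ 3) = 1 * (u^-1 * ((a - u + 0)^-1 * ((a - u + 0)^-1 - u^-1))) +
  (a + 0) * (0 * ((a - u + 0)^-1 * ((a - u + 0)^-1 - u^-1)) +
  u^-1 * (- (a - u) ^- 2 * ((a - u + 0)^-1 - u^-1) + (a - u + 0)^-1 * (- (a - u) ^- 2 - 0))).
  by rewrite !addr0; field; rewrite u0 x0.
rewrite dE; apply: jet_weaken (jet_ext r0' _ J); last first.
  move=> h hr; have xh := x_neq0 Su hr; rewrite !mul1r.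
  have -> : a + h - u = a - u + h by ring.
  by field; rewrite ?u0 ?xh.
rewrite cmodV.
have -> : (cmod a + r) * ((cmod u)^-1 * (2 * c * (cmod u)^-1 * (2 * c * (cmod u)^-1 + (cmod u)^-1))) =
  (cmod a + r) * (2 * c * (2 * c + 1)) * cmod u ^- 3.
  by field; rewrite gt_eqF.
by rewrite (ler_wpM2r _ KA2)// invr_ge0 exprn_ge0// cmod_ge0.
Qed.

Lemma jet_wzeta_sum : exists N, jet r N (fun h => wzeta_sum S (a + h)) (- wp_sum S a).
Proof.
exists (KA * M).
have J u (Su : S u) := jetM (ltW r0) (jetM (ltW r0) (jet_var r a) (jet_var r a)) (jetM (ltW r0) (jet_cst r (u ^- 2)) (J1 Su)).
have {}J u : S u -> jet r (KA * cmod u ^- 3) (fun h => 1 / (a + h - u) + 1 / u + (a + h) / u ^+ 2)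
   (- (1 / (a - u) ^+ 2 - 1 / u ^+ 2)).
  move=> Su; have u0 := amb_neq0 SL Su; have r0' := ltW r0; have u0' := amb_gt0 SL Su.
  have x0 : a - u != 0 by have := x_neq0 (h := 0) Su; rewrite addr0 cmod0; apply.
  have -> : - (1 / (a - u) ^+ 2 - 1 / u ^+ 2) = (1 * (a + 0) + (a + 0) * 1) * (u ^- 2 * (a - u + 0)^-1) +
   (a + 0) * (a + 0) * (0 * (a - u + 0)^-1 + u ^- 2 * (- (a - u) ^- 2)).
    by rewrite !addr0; field; rewrite u0 x0.
  apply: jet_weaken (jet_ext r0' _ (J u Su)); last first.
    move=> h hr; have xh := x_neq0 Su hr; rewrite !mul1r.
    have -> : a + h - u = a - u + h by ring.
    by field; rewrite ?u0 ?xh.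
  rewrite cmodV cmodX.
  have -> : (cmod a + r) * (cmod a + r) * (cmod u ^- 2 * (2 * c * (cmod u)^-1)) =
    (cmod a + r) ^+ 2 * (2 * c) * cmod u ^- 3.
    by field; rewrite gt_eqF.
  by rewrite (ler_wpM2r _ KA1)// invr_ge0 exprn_ge0// cmod_ge0.
have sp : summable_over S (fun u => 1 / (a - u) ^+ 2 - 1 / u ^+ 2).
  have K0 : 0 <= KA / r by rewrite divr_ge0// ltW.
  apply: (summ_ambient K0) => // u Su.
  have := jet_slope (ltW r0) (J u Su); rewrite cmodN -ler_pdivlMr// => /le_trans; apply.
  by rewrite mulrAC.
rewrite -sum_overN//; exact: jet_ambient.
Qed.

Lemma jet_cube_sum : exists N d, jet r N (fun h => cube_sum S (a + h)) d.
Proof.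
exists (KA * M); apply: jet_ambient_ex => // u Su.
have u0 := amb_neq0 SL Su; have r0' := ltW r0; have u0' := amb_gt0 SL Su.
have J := jetM r0' (J1 Su) (jetM r0' (J1 Su) (J1 Su)).
eexists; apply: jet_weaken (jet_ext r0' _ J); last first.
  move=> h hr; have xh := x_neq0 Su hr.
  have -> : a + h - u = a - u + h by ring.
  by field; exact: xh.
have -> : 2 * c * (cmod u)^-1 * (2 * c * (cmod u)^-1 * (2 * c * (cmod u)^-1)) = (2 * c) ^+ 3 * cmod u ^- 3.
  by field; rewrite gt_eqF.
by rewrite (ler_wpM2r _ KA3)// invr_ge0 exprn_ge0// cmod_ge0.
Qed.

Lemma away_inv u : S u -> (cmod (a - u))^-1 <= c * (cmod u)^-1.
Proof. exact: au. Qed.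

Lemma wp_term_bound : exists2 K, 0 <= K &
  forall u, S u -> cmod (1 / (a - u) ^+ 2 - 1 / u ^+ 2) <= K * cmod u ^- 3.
Proof.
exists (cmod a * (c * (c + 1))); first by have cp := ltW cpos; rewrite !mulr_ge0 ?cmod_ge0// addr_ge0.
move=> u Su; have u0 := amb_neq0 SL Su; have u0' := amb_gt0 SL Su.
have x0 : a - u != 0 by have := x_neq0 (h := 0) Su; rewrite addr0 cmod0; apply; exact: ltW.
have -> : 1 / (a - u) ^+ 2 - 1 / u ^+ 2 = a * (u^-1 * ((a - u)^-1 * ((a - u)^-1 - u^-1))).
  by field; rewrite u0 x0.
rewrite !cmodM !cmodV -mulrA ler_wpM2l ?cmod_ge0//.
have -> : c * (c + 1) * cmod u ^- 3 = (cmod u)^-1 * (c * (cmod u)^-1 * (c * (cmod u)^-1 + (cmod u)^-1)).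
  by field; rewrite gt_eqF.
rewrite ler_wpM2l ?invr_ge0 ?cmod_ge0//; apply: ler_pM; rewrite ?invr_ge0 ?cmod_ge0 ?au//.
by apply: le_trans (cmodD _ _) _; rewrite cmodN !cmodV lerD2r au.
Qed.

Lemma wz_term_bound : exists2 K, 0 <= K &
  forall u, S u -> cmod (1 / (a - u) + 1 / u + a / u ^+ 2) <= K * cmod u ^- 3.
Proof.
exists (cmod a ^+ 2 * c); first by have cp := ltW cpos; rewrite mulr_ge0// exprn_ge0// cmod_ge0.
move=> u Su; have u0 := amb_neq0 SL Su; have u0' := amb_gt0 SL Su.
have x0 : a - u != 0 by have := x_neq0 (h := 0) Su; rewrite addr0 cmod0; apply; exact: ltW.
have -> : 1 / (a - u) + 1 / u + a / u ^+ 2 = a * a * (u^-1 * u^-1 * (a - u)^-1).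
  by field; rewrite u0 x0.
rewrite !cmodM !cmodV.
have -> : cmod a ^+ 2 * c / cmod u ^+ 3 = cmod a * cmod a * ((cmod u)^-1 / cmod u * (c / cmod u)).
  by field; rewrite gt_eqF.
rewrite ler_wpM2l ?mulr_ge0 ?cmod_ge0// ler_wpM2l ?au//.
by rewrite mulr_ge0 ?invr_ge0 ?cmod_ge0.
Qed.

Lemma summ_wp_sum : summable_over S (fun u => 1 / (a - u) ^+ 2 - 1 / u ^+ 2).
Proof. by have [K K0] := wp_term_bound; apply: summ_ambient. Qed.

Lemma summ_wzeta_sum : summable_over S (fun u => 1 / (a - u) + 1 / u + a / u ^+ 2).
Proof. by have [K K0] := wz_term_bound; apply: summ_ambient. Qed.

Lemma summ_cube_sum : summable_over S (fun u => 1 / (a - u) ^+ 3).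
Proof.
have K0 : 0 <= c ^+ 3 by rewrite exprn_ge0 ?(ltW cpos).
apply: (summ_ambient K0) => // u Su.
rewrite mul1r cmodV cmodX -!exprVn -exprMn.
by rewrite lerXn2r ?nnegrE ?invr_ge0 ?mulr_ge0 ?invr_ge0 ?cmod_ge0 ?au// ltW.
Qed.

End Away.

Section Origin.
Variable S : set C.
Hypotheses (SL : S `<=` Lam `\ 0) (SN : forall u, S u -> S (- u)).

Let r := delta / 2.
Let r0 : 0 < r. Proof. by rewrite /r divr_gt0. Qed.
Let r0' : 0 <= r. Proof. exact: ltW. Qed.
Let ru u : S u -> 2 * r <= cmod u.
Proof. by move=> Su; rewrite /r mulrC divfK// (amb_ge SL Su). Qed.

Let nz u h : S u -> cmod h <= r -> u + h != 0.
Proof.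
move=> Su hr; have h1 := ru Su; have := cmodDB u (- h).
rewrite opprK cmodN -cmod_gt0; apply: lt_le_trans; rewrite subr_gt0.
by apply: le_lt_trans hr _; apply: lt_le_trans h1; rewrite ltr_pMl// ltr1n.
Qed.

Let q4 u : S u -> cmod u ^- 4 <= delta^-1 * cmod u ^- 3.
Proof.
move=> Su; have u0 := amb_gt0 SL Su.
rewrite exprS invfM ler_wpM2r ?invr_ge0 ?exprn_ge0 ?cmod_ge0//.
by rewrite lef_pV2 ?posrE// (amb_ge SL Su).
Qed.

Let JQ u : S u -> exists d, jet r (4 * cmod u ^- 2) (fun h => (h ^+ 2 - u ^+ 2)^-1) d.
Proof.
move=> Su; have u0 := amb_gt0 SL Su.
have rNu : 2 * r <= cmod (- u) by rewrite cmodN; exact: ru.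
have J := jetM r0' (jet_inv r0 (ru Su)) (jet_inv r0 rNu).
eexists; apply: jet_weaken (jet_ext r0' _ J); last first.
  move=> h hr; have h1 := nz Su hr; have h2 := nz (SN Su) hr.
  have -> : h ^+ 2 - u ^+ 2 = (u + h) * (- u + h) by ring.
  by rewrite invfM.
by rewrite cmodN; apply: eq_ler; field; rewrite gt_eqF.
Qed.

Let JP u (s : C) : S u -> cmod s <= 1 -> exists d, jet r (4 * cmod u ^+ 2) (fun h => 3 * u ^+ 2 + s * h ^+ 2) d.
Proof.
move=> Su s1; have u0 := amb_gt0 SL Su.
have J := jetD r0' (jet_cst r (3 * u ^+ 2)) (jetM r0' (jet_cst r s) (jetM r0' (jet_var r 0) (jet_var r 0))).
eexists; apply: jet_weaken (jet_ext r0' _ J); last first.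
  by move=> h hr; rewrite !add0r.
rewrite cmod0 add0r cmodM cmodX cmod_nat.
have : r * r <= cmod u ^+ 2.
  rewrite expr2; have := ru Su => h; apply: ler_pM => //; apply: le_trans h; by rewrite ler_peMl// ler1n.
move=> h; have -> : 4 * cmod u ^+ 2 = 3 * cmod u ^+ 2 + 1 * cmod u ^+ 2 by ring.
by rewrite lerD2l; apply: ler_pM; rewrite ?cmod_ge0// mulr_ge0.
Qed.

Let K := 256 / delta.
Let K0 : 0 <= K. Proof. by rewrite divr_ge0// ltW. Qed.

Let Kbound u (k : R) : S u -> 0 <= k -> k <= 256 -> k * cmod u ^- 4 <= K * cmod u ^- 3.
Proof.
move=> Su k0 k256; rewrite /K -mulrA; apply: ler_pM => //; last exact: q4.
by rewrite invr_ge0 exprn_ge0// cmod_ge0.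
Qed.

Let Jka u : S u -> exists d, jet r (K * cmod u ^- 3) (fun h => 1 / (u ^+ 2 * (h ^+ 2 - u ^+ 2))) d.
Proof.
move=> Su; have u0 := amb_gt0 SL Su; have [d JQu] := JQ Su.
have J := jetM r0' (jet_cst r (u ^- 2)) JQu.
eexists; apply: jet_weaken (jet_ext r0' _ J); last by move=> h hr; rewrite mul1r -invfM.
apply: le_trans (Kbound (k := 4) Su _ _); [|by []|by rewrite ler_nat].
by rewrite cmodV cmodX; apply: eq_ler; field; rewrite gt_eqF.
Qed.

Let Jpi u : S u -> exists d, jet r (K * cmod u ^- 3)
  (fun h => (3 * u ^+ 2 - h ^+ 2) / (u ^+ 2 * (h ^+ 2 - u ^+ 2) ^+ 2)) d.
Proof.
move=> Su; have u0 := amb_gt0 SL Su; have [d JQu] := JQ Su.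
have [|d' JPu] := JP (s := -1) Su; first by rewrite cmodN cmod1.
have J := jetM r0' JPu (jetM r0' (jet_cst r (u ^- 2)) (jetM r0' JQu JQu)).
eexists; apply: jet_weaken (jet_ext r0' _ J); last by move=> h hr; rewrite mulN1r -expr2 exprVn -invfM.
apply: le_trans (Kbound (k := 64) Su _ _); [|by []|by rewrite ler_nat].
by rewrite cmodV cmodX; apply: eq_ler; field; rewrite gt_eqF.
Qed.

Let Jta u : S u -> exists d, jet r (K * cmod u ^- 3)
  (fun h => (h ^+ 2 + 3 * u ^+ 2) / (h ^+ 2 - u ^+ 2) ^+ 3) d.
Proof.
move=> Su; have u0 := amb_gt0 SL Su; have [d JQu] := JQ Su.
have [|d' JPu] := JP (s := 1) Su; first by rewrite cmod1.
have J := jetM r0' JPu (jetM r0' JQu (jetM r0' JQu JQu)).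
eexists; apply: jet_weaken (jet_ext r0' _ J); last first.
  by move=> h hr; rewrite mul1r [_ + h ^+ 2]addrC -expr2 -exprS exprVn.
apply: le_trans (Kbound (k := 256) Su _ _); [|by []|by rewrite ler_nat].
by apply: eq_ler; field; rewrite gt_eqF.
Qed.

Lemma jet_wzeta_reg : exists N d, jet r N (wzeta_reg S) d.
Proof. by exists (K * M); apply: (jet_ambient_ex r0 K0 SL Jka). Qed.

Lemma jet_wp_reg : exists N d, jet r N (wp_reg S) d.
Proof. by exists (K * M); apply: (jet_ambient_ex r0 K0 SL Jpi). Qed.

Lemma jet_cube_reg : exists N d, jet r N (cube_reg S) d.
Proof. by exists (K * M); apply: (jet_ambient_ex r0 K0 SL Jta). Qed.

Lemma summ_inv4 : summable_over S (fun u => 1 / u ^+ 4).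
Proof.
apply: (summ_ambient K0) => // u Su; rewrite mul1r cmodV cmodX -[X in X <= _]mul1r.
by apply: Kbound => //; rewrite ler1n.
Qed.

Lemma wp_reg0 : wp_reg S 0 = 3 * sum_over S (fun u => 1 / u ^+ 4).
Proof.
rewrite -sum_overZ; last exact: summ_inv4.
by apply: eq_sum_over => u Su; have u0 := amb_neq0 SL Su; rewrite expr0n /= !sub0r subr0; field.
Qed.

Lemma wzeta_reg0 : wzeta_reg S 0 = - sum_over S (fun u => 1 / u ^+ 4).
Proof.
rewrite -sum_overN; last exact: summ_inv4.
by apply: eq_sum_over => u Su; have u0 := amb_neq0 SL Su; rewrite expr0n /= !sub0r; field.
Qed.

Lemma cube_reg0 : cube_reg S 0 = - 3 * sum_over S (fun u => 1 / u ^+ 4).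
Proof.
rewrite -sum_overZ; last exact: summ_inv4.
by apply: eq_sum_over => u Su; have u0 := amb_neq0 SL Su; rewrite expr0n /= !sub0r add0r; field.
Qed.

Let far z u : cmod z <= r -> S u -> 2 * (delta / 4) <= cmod (z - u).
Proof.
move=> zr Su; have := amb_ge SL Su; have := cmodDB u z; rewrite cmodB.
move: zr; rewrite /r => h1 h2 h3; apply: le_trans h2; rewrite lerBrDr.
apply: le_trans h3; have -> : 2 * (delta / 4) = delta - delta / 2 by field.
by rewrite -lerBrDl opprB addrCA subrr addr0.
Qed.

Let d4 : 0 < delta / 4. Proof. by rewrite divr_gt0. Qed.

Let nz2 z u : cmod z <= r -> S u -> (z - u != 0) && (z + u != 0).
Proof.
move=> zr Su; have h1 := nz Su zr; have h2 := nz (SN Su) zr.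
by rewrite ![z + _]addrC h2.
Qed.

Lemma wp_sum_near0 z : cmod z <= r -> wp_sum S z = z ^+ 2 * wp_reg S z.
Proof.
move=> zr; rewrite /wp_reg -sum_overZ; last first.
  by apply: (summ_ambient K0) => // u /Jpi[d /jet_bound J]; apply: J.
apply: sum_over_sym => //; first exact: (summ_wp_sum SL d4 (fun u => @far z u zr)).
move=> u Su; have u0 := amb_neq0 SL Su; have /andP[h1 h2] := nz2 zr Su.
have -> : z ^+ 2 - u ^+ 2 = (z - u) * (z + u) by ring.
by rewrite opprK; field; rewrite ?u0 ?h1 ?h2.
Qed.

Lemma wzeta_sum_near0 z : cmod z <= r -> wzeta_sum S z = z ^+ 3 * wzeta_reg S z.
Proof.
move=> zr; rewrite /wzeta_reg -sum_overZ; last first.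
  by apply: (summ_ambient K0) => // u /Jka[d /jet_bound J]; apply: J.
apply: sum_over_sym => //; first exact: (summ_wzeta_sum SL d4 (fun u => @far z u zr)).
move=> u Su; have u0 := amb_neq0 SL Su; have /andP[h1 h2] := nz2 zr Su.
have -> : z ^+ 2 - u ^+ 2 = (z - u) * (z + u) by ring.
by rewrite opprK; field; rewrite ?u0 ?h1 ?h2.
Qed.

Lemma cube_sum_near0 z : cmod z <= r -> cube_sum S z = z * cube_reg S z.
Proof.
move=> zr; rewrite /cube_reg -sum_overZ; last first.
  by apply: (summ_ambient K0) => // u /Jta[d /jet_bound J]; apply: J.
apply: sum_over_sym => //; first exact: (summ_cube_sum SL d4 (fun u => @far z u zr)).
move=> u Su; have u0 := amb_neq0 SL Su; have /andP[h1 h2] := nz2 zr Su.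
have -> : z ^+ 2 - u ^+ 2 = (z - u) * (z + u) by ring.
by rewrite opprK; field; rewrite ?u0 ?h1 ?h2.
Qed.

End Origin.

End Ambient.
End LatticeSeries.

(** * Regularity without numerical data *)

Section ExistentialJets.
Variable R : realType.
Local Notation C := R[i].
Implicit Types (f g : C -> C) (a : C) (r : R).

(** Second-order expandability without the numerical data, for the functions of
    which only the regularity matters. *)
Definition jetx r f := exists N d, jet r N f d.

Lemma jetx_ext r f g : 0 <= r -> (forall h, cmod h <= r -> f h = g h) -> jetx r f -> jetx r g.
Proof. by move=> r0 fg [N [d J]]; exists N, d; apply: jet_ext J. Qed.

Lemma jetx_cst r a : jetx r (fun=> a).
Proof. by exists (cmod a), 0; exact: jet_cst. Qed.

Lemma jetx_id r : jetx r (fun h => h).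
Proof. by exists (cmod (0 : C) + r), 1; have := @jet_var _ r (0 : C); congr jet; apply/funext => h; rewrite add0r. Qed.

Lemma jetxD r f g : 0 <= r -> jetx r f -> jetx r g -> jetx r (fun h => f h + g h).
Proof. by move=> r0 [N [d J]] [N' [d' J']]; eexists; eexists; exact: (jetD r0 J J'). Qed.

Lemma jetxM r f g : 0 <= r -> jetx r f -> jetx r g -> jetx r (fun h => f h * g h).
Proof. by move=> r0 [N [d J]] [N' [d' J']]; eexists; eexists; exact: (jetM r0 J J'). Qed.

Lemma jetxB r f g : 0 <= r -> jetx r f -> jetx r g -> jetx r (fun h => f h - g h).
Proof. by move=> r0 [N [d J]] [N' [d' J']]; eexists; eexists; exact: (jetB r0 J J'). Qed.

Lemma jetxZ r a f : 0 <= r -> jetx r f -> jetx r (fun h => a * f h).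
Proof. by move=> r0; apply: jetxM => //; exact: jetx_cst. Qed.

Lemma jetxX r f n : 0 <= r -> jetx r f -> jetx r (fun h => f h ^+ n).
Proof.
move=> r0 J; elim: n => [|n IH].
  by apply: (jetx_ext r0 _ (jetx_cst r 1)) => h _; rewrite expr0.
by apply: (jetx_ext r0 _ (jetxM r0 J IH)) => h _; rewrite exprS.
Qed.

Lemma jetx_zero r f : 0 < r -> jetx r f -> (forall h, h != 0 -> cmod h <= r -> f h = 0) -> f 0 = 0.
Proof.
move=> r0 [N [d J]] f0; apply/eqP; rewrite -cmod_eq0 eq_le cmod_ge0 andbT.
apply/ler_addgt0Pl => e e0; rewrite addr0.
have J' : jet r N (fun h => f (0 + h)) d by apply: jet_ext (ltW r0) _ J => h _; rewrite add0r.
have [s s0 Hs] := jet_cont r0 J' e0.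
pose t := Num.min r s; have t0 : 0 < t by rewrite lt_min r0.
have ct : cmod t%:C = t by rewrite cmod_real ger0_norm// ltW.
have tn0 : t%:C != 0 :> C by rewrite -cmod_gt0 ct.
have := Hs t%:C; rewrite subr0 f0//; last by rewrite ct ge_min lexx.
by rewrite sub0r cmodN ct; apply; rewrite ge_min lexx orbT.
Qed.

End ExistentialJets.

(** * The Weierstrass functions of a lattice and of an overlattice of index two *)

Section Isogeny.
Variable R : realType.
Local Notation C := R[i].
Implicit Types (a u v z : C).
Variables (Lam : set C) (delta M : R).
Hypothesis amb : ambient Lam delta M.
Variables (L : set C) (w : C).
Hypotheses (subL : subgroup L) (LLam : L `<=` Lam) (wLam : Lam w) (Lw : ~ L w) (Lww : L (w + w)).

Local Notation L0 := (L `\ 0).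
Definition coset : set C := [set u | L (u - w)].
Local Notation D := coset.

Lemma subgroupB u v : L u -> L v -> L (u - v).
Proof. by case: subL => _; apply. Qed.
Lemma subgroup0 : L 0. Proof. by case: subL. Qed.
Lemma subgroupN u : L u -> L (- u).
Proof. by move=> Lu; rewrite -[- u]add0r; apply: subgroupB; [exact: subgroup0|]. Qed.
Lemma subgroupD u v : L u -> L v -> L (u + v).
Proof. by move=> Lu Lv; rewrite -[v]opprK; apply: subgroupB => //; exact: subgroupN. Qed.

Lemma cosetN u : D u -> D (- u).
Proof.
rewrite /coset /= => H; have := subgroupN (subgroupD H Lww).
by have -> : - (u - w + (w + w)) = - u - w by ring.
Qed.

Lemma coset_shift v u : L v -> D (u + v) <-> D u.
Proof.
move=> Lv; rewrite /coset /=; split => H.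
  by have := subgroupB H Lv; have -> : u + v - w - v = u - w by ring.
by have := subgroupD H Lv; have -> : u - w + v = u + v - w by ring.
Qed.

Lemma subgroup_shift v u : L v -> L (u + v) <-> L u.
Proof.
move=> Lv; split => [H|H]; last exact: subgroupD.
by rewrite -[u](addrK v); exact: subgroupB.
Qed.

Lemma subgroup_shiftw u : L (u + w) <-> D u.
Proof.
rewrite /coset /=; split => H.
  by have := subgroupB H Lww; have -> : u + w - (w + w) = u - w by ring.
by have := subgroupD H Lww; have -> : u - w + (w + w) = u + w by ring.
Qed.

Lemma coset_shiftw u : D (u + w) <-> L u.
Proof. by rewrite /coset /= addrK. Qed.

Lemma coset_Lam : D `<=` Lam `\ 0.
Proof.
move=> u Du; have [[_ subLam] _ _ _] := amb; split.
  have := subLam _ _ (LLam (subgroupD Du Lww)) wLam.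
  by have -> : u - w + (w + w) - w = u by ring.
by move=> /= u0; move: Du; rewrite u0 /coset /= sub0r => /subgroupN; rewrite opprK.
Qed.

Lemma L0_Lam : L0 `<=` Lam `\ 0.
Proof. by move=> u [/LLam ? ?]. Qed.

Lemma L0N u : L0 u -> L0 (- u).
Proof. by move=> [Lu u0]; split; [exact: subgroupN|move=> /= /eqP; rewrite oppr_eq0 => /eqP]. Qed.

Lemma LE : L = [set 0] `|` L0.
Proof.
apply/seteqP; split => u /=; last by case=> [->|[]//]; exact: subgroup0.
by move=> Lu; have [->|u0] := pselect (u = 0); [left|right].
Qed.

Lemma coset_notL u : D u -> ~ L u.
Proof.
rewrite /coset /= => Du Lu; apply: Lw; have := subgroupB Lu Du.
by have -> : u - (u - w) = w by ring.
Qed.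

Lemma notL_neq0 z : ~ L z -> z != 0.
Proof. by move=> Lz; apply/eqP => z0; apply: Lz; rewrite z0; exact: subgroup0. Qed.

Lemma coset0 : ~ D 0.
Proof. by rewrite /coset /= sub0r => /subgroupN; rewrite opprK. Qed.

Lemma notLN z : ~ L z -> ~ L (- z).
Proof. by move=> H /subgroupN; rewrite opprK. Qed.

Lemma notDN z : ~ D z -> ~ D (- z).
Proof. by move=> H /cosetN; rewrite opprK. Qed.

Lemma sum_over_subgroup f : summable_over L0 f -> sum_over L f = f 0 + sum_over L0 f.
Proof.
move=> sf; rewrite {1}LE sum_overU ?sum_over1//; first exact: summ1.
by move=> u /= -> [].
Qed.

Lemma summ_subgroup f : summable_over L0 f -> summable_over L f.
Proof. by move=> sf; rewrite LE; apply: summU => //; exact: summ1. Qed.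

Lemma sum_over_translate (S S' : set C) v f g : (forall u, S (u + v) <-> S' u) ->
  (forall u, f (u + v) = g u) -> summable_over S f -> sum_over S f = sum_over S' g.
Proof.
move=> SS' fg sf; rewrite -(sum_over_shift v sf).
have -> : [set u | S (u + v)] = S' by apply/seteqP; split => u /SS'.
by apply: eq_sum_over => u _; exact: fg.
Qed.

(** In these terms the theory of the larger lattice L u D reads: wp_gap vanishes at w,
    wp_coset is its translate by w, and zeta_gap, a series with simple poles at the points of
    L u D, turns out to be half the logarithmic derivative of wp_gap. *)
Definition wp z := weierstrass_p L z.
Definition half_value := wp w.
Definition wp_gap z := wp z - half_value.
Definition wp_coset z := wp_sum D z.
Definition wzeta z := weierstrass_zeta L z.
Definition zeta_gap z := wzeta_sum D z - wzeta z - half_value * z.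
Definition dwp_gap z := - 2 * (1 / z ^+ 3 + cube_sum L0 z).
Definition dwp_coset z := - 2 * cube_sum D z.

Lemma wpE z : wp z = 1 / z ^+ 2 + wp_sum L0 z. Proof. by []. Qed.
Lemma wzetaE z : wzeta z = 1 / z + wzeta_sum L0 z. Proof. by []. Qed.

Lemma summ_wp_coset z : ~ D z -> summable_over D (fun u => 1 / (z - u) ^+ 2 - 1 / u ^+ 2).
Proof.
move=> Dz; have DL u : D u -> Lam u by move=> /coset_Lam[].
have [r r0 H] := ambient_sep amb DL Dz; exact: (summ_wp_sum amb coset_Lam r0 H).
Qed.

Lemma summ_wp z : ~ L z -> summable_over L0 (fun u => 1 / (z - u) ^+ 2 - 1 / u ^+ 2).
Proof.
move=> Lz; have [r r0 H] := ambient_sep amb LLam Lz.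
by apply: (summ_wp_sum amb L0_Lam r0) => u [Lu _]; exact: H.
Qed.

Lemma summ_wzeta_coset z : ~ D z -> summable_over D (fun u => 1 / (z - u) + 1 / u + z / u ^+ 2).
Proof.
move=> Dz; have DL u : D u -> Lam u by move=> /coset_Lam[].
have [r r0 H] := ambient_sep amb DL Dz; exact: (summ_wzeta_sum amb coset_Lam r0 H).
Qed.

Lemma summ_wzeta z : ~ L z -> summable_over L0 (fun u => 1 / (z - u) + 1 / u + z / u ^+ 2).
Proof.
move=> Lz; have [r r0 H] := ambient_sep amb LLam Lz.
by apply: (summ_wzeta_sum amb L0_Lam r0) => u [Lu _]; exact: H.
Qed.

Lemma summ_cube z : ~ L z -> summable_over L0 (fun u => 1 / (z - u) ^+ 3).
Proof.
move=> Lz; have [r r0 H] := ambient_sep amb LLam Lz.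
by apply: (summ_cube_sum amb L0_Lam r0) => u [Lu _]; exact: H.
Qed.

Lemma wp_sumN S z : (forall u, S u -> S (- u)) ->
  summable_over S (fun u => 1 / (z - u) ^+ 2 - 1 / u ^+ 2) -> wp_sum S (- z) = wp_sum S z.
Proof.
move=> SN sz; rewrite /wp_sum -(sum_over_opp SN sz); apply: eq_sum_over => u _.
by rewrite sqrrN -opprD sqrrN opprK.
Qed.

Lemma wzeta_sumN S z : (forall u, S u -> S (- u)) ->
  summable_over S (fun u => 1 / (z - u) + 1 / u + z / u ^+ 2) -> wzeta_sum S (- z) = - wzeta_sum S z.
Proof.
move=> SN sz; rewrite /wzeta_sum -(sum_over_opp SN sz) -(sum_overN (summ_opp SN sz)).
apply: eq_sum_over => u _; rewrite sqrrN opprK -opprD !invrN !mulrN !mulNr mul1r.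
by rewrite !opprD opprK; congr (_ + _); rewrite mul1r.
Qed.

Lemma wpN z : ~ L z -> wp (- z) = wp z.
Proof. by move=> Lz; rewrite !wpE sqrrN wp_sumN//; [exact: L0N|exact: summ_wp]. Qed.

Lemma wzetaN z : ~ L z -> wzeta (- z) = - wzeta z.
Proof. by move=> Lz; rewrite !wzetaE wzeta_sumN; [rewrite invrN mulrN opprD|exact: L0N|exact: summ_wzeta]. Qed.

Lemma zeta_gapN z : ~ L z -> ~ D z -> zeta_gap (- z) = - zeta_gap z.
Proof.
move=> Lz Dz; rewrite /zeta_gap wzetaN// wzeta_sumN; [ring|exact: cosetN|exact: summ_wzeta_coset].
Qed.

(** The difference of two values of wp is a series over the whole of L, absolutely
    convergent and invariant under simultaneous translation of both arguments. *)
Lemma wp_diff z z' : ~ L z -> ~ L z' ->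
  wp z - wp z' = sum_over L (fun u => 1 / (z - u) ^+ 2 - 1 / (z' - u) ^+ 2) /\
  summable_over L (fun u => 1 / (z - u) ^+ 2 - 1 / (z' - u) ^+ 2).
Proof.
move=> Lz Lz'; have sz := summ_wp Lz; have sz' := summ_wp Lz'.
have s : summable_over L0 (fun u => 1 / (z - u) ^+ 2 - 1 / (z' - u) ^+ 2).
  by apply: eq_summ (summB sz sz') => u _; ring.
split; last exact: summ_subgroup.
rewrite sum_over_subgroup// !subr0 !wpE /wp_sum opprD addrACA -sum_overB//.
by congr (_ + _); apply: eq_sum_over => u _; ring.
Qed.

Lemma wp_coset_diff z z' : ~ D z -> ~ D z' ->
  wp_coset z - wp_coset z' = sum_over D (fun u => 1 / (z - u) ^+ 2 - 1 / (z' - u) ^+ 2).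
Proof.
move=> Dz Dz'; have sz := summ_wp_coset Dz; have sz' := summ_wp_coset Dz'.
by rewrite /wp_coset /wp_sum -sum_overB//; apply: eq_sum_over => u _; ring.
Qed.

(** Translation invariance of the differences makes wp (z + v) - wp z independent of z; the
    evenness of wp makes it change sign between z and - z - v. *)
Lemma wp_periodic v z : L v -> ~ L z -> wp (z + v) = wp z.
Proof.
move=> Lv Lz.
have nL x : ~ L x -> ~ L (x + v) by move=> H /(subgroup_shift _ Lv).
have K x y : ~ L x -> ~ L y -> wp (x + v) - wp (y + v) = wp x - wp y.
  move=> Lx Ly; have [-> s] := wp_diff (nL _ Lx) (nL _ Ly); have [-> _] := wp_diff Lx Ly.
  apply: (sum_over_translate (v := v)) s => u; first exact: subgroup_shift.
  by congr (1 / _ ^+ 2 - 1 / _ ^+ 2); ring.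
have Lzv : ~ L (- z - v) by rewrite -opprD; apply: notLN; exact: nL.
have := K z (- z - v) Lz Lzv.
have -> : - z - v + v = - z by ring.
rewrite wpN// -opprD wpN; last exact: nL.
move=> H; have {}H : 2 * wp (z + v) = 2 * wp z by move/eqP: H; rewrite subr_eq => /eqP H; rewrite mulr_natl mulr2n {1}H; ring.
exact: (mulfI _ H).
Qed.

Lemma wp_gap_periodic v z : L v -> ~ L z -> wp_gap (z + v) = wp_gap z.
Proof. by move=> Lv Lz; rewrite /wp_gap wp_periodic. Qed.

(** Translation by w exchanges the index sets L and D, and both sides vanish at z = 0. *)
Lemma wp_gap_shift z : ~ D z -> wp_gap (z + w) = wp_coset z.
Proof.
move=> Dz; have Lzw : ~ L (z + w) by move=> /subgroup_shiftw.
have q0 : wp_coset 0 = 0.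
  rewrite /wp_coset /wp_sum -[RHS](sum_over0 D); apply: eq_sum_over => u _.
  by rewrite sub0r sqrrN subrr.
have [pE s] := wp_diff Lzw Lw.
have -> : wp_coset z = wp_coset z - wp_coset 0 by rewrite q0 subr0.
rewrite wp_coset_diff//; last exact: coset0.
rewrite /wp_gap /half_value pE; apply: (sum_over_translate (v := w)) s => u; first exact: subgroup_shiftw.
by congr (1 / _ ^+ 2 - 1 / _ ^+ 2); ring.
Qed.

Lemma wp_coset_shift z : ~ L z -> wp_coset (z + w) = wp_gap z.
Proof.
move=> Lz; have Dzw : ~ D (z + w) by move=> /coset_shiftw.
by rewrite -wp_gap_shift// -addrA wp_gap_periodic.
Qed.

Lemma wp_coset_periodic v z : L v -> ~ D z -> wp_coset (z + v) = wp_coset z.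
Proof.
move=> Lv Dz; have Dzv : ~ D (z + v) by move=> /(coset_shift _ Lv).
rewrite -wp_gap_shift// addrAC wp_gap_periodic ?wp_gap_shift// => /subgroup_shiftw; exact.
Qed.

Lemma dwp_gap_sum z : ~ L z -> dwp_gap z = - 2 * sum_over L (fun u => 1 / (z - u) ^+ 3).
Proof. by move=> Lz; rewrite /dwp_gap sum_over_subgroup ?subr0//; exact: summ_cube. Qed.

Lemma dwp_gap_periodic v z : L v -> ~ L z -> dwp_gap (z + v) = dwp_gap z.
Proof.
move=> Lv Lz; have Lzv : ~ L (z + v) by move=> /(subgroup_shift _ Lv).
rewrite !dwp_gap_sum//; congr (_ * _); apply: (sum_over_translate (v := v)).
- by move=> u; exact: subgroup_shift.
- by move=> u; congr (1 / _ ^+ 3); ring.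
- exact/summ_subgroup/summ_cube.
Qed.

Lemma dwp_gap_shift z : ~ D z -> dwp_gap (z + w) = dwp_coset z.
Proof.
move=> Dz; have Lzw : ~ L (z + w) by move=> /subgroup_shiftw.
rewrite dwp_gap_sum//; congr (_ * _); apply: (sum_over_translate (v := w)).
- by move=> u; exact: subgroup_shiftw.
- by move=> u; congr (1 / _ ^+ 3); ring.
- exact/summ_subgroup/summ_cube.
Qed.

(** The combination of the terms of zeta and wp in which the corrections 1 / u and z / u ^ 2
    cancel: it is summable and depends only on the positions relative to u. *)
Definition psi_term z z' u := 1 / (z - u) - 1 / (z' - u) + (z - z') / (z - u) ^+ 2.

Lemma wzeta_diff z z' : ~ L z -> ~ L z' ->
  wzeta z - wzeta z' = sum_over L (psi_term z z') - (z - z') * wp z /\ summable_over L (psi_term z z').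
Proof.
move=> Lz Lz'; have sz := summ_wzeta Lz; have sz' := summ_wzeta Lz'; have sp := summ_wp Lz.
have s : summable_over L0 (psi_term z z').
  apply: eq_summ (summD (summB sz sz') (summZ (z - z') sp)) => u _.
  by rewrite /psi_term; ring.
split; last exact: summ_subgroup.
rewrite sum_over_subgroup// !wzetaE wpE /wzeta_sum /wp_sum.
have -> : sum_over L0 (psi_term z z') = sum_over L0 (fun u => 1 / (z - u) + 1 / u + z / u ^+ 2)
   - sum_over L0 (fun u => 1 / (z' - u) + 1 / u + z' / u ^+ 2)
   + (z - z') * sum_over L0 (fun u => 1 / (z - u) ^+ 2 - 1 / u ^+ 2).
  rewrite -sum_overZ// -sum_overB// -sum_overD//; [|exact: summB|exact: summZ].
  by apply: eq_sum_over => u _; rewrite /psi_term; ring.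
rewrite /psi_term !subr0; ring.
Qed.

Lemma wzeta_coset_diff z z' : ~ D z -> ~ D z' ->
  wzeta_sum D z - wzeta_sum D z' = sum_over D (psi_term z z') - (z - z') * wp_coset z /\ summable_over D (psi_term z z').
Proof.
move=> Dz Dz'; have sz := summ_wzeta_coset Dz; have sz' := summ_wzeta_coset Dz'; have sp := summ_wp_coset Dz.
have s : summable_over D (psi_term z z').
  apply: eq_summ (summD (summB sz sz') (summZ (z - z') sp)) => u _.
  by rewrite /psi_term; ring.
split => //; rewrite /wzeta_sum /wp_coset /wp_sum.
have -> : sum_over D (psi_term z z') = sum_over D (fun u => 1 / (z - u) + 1 / u + z / u ^+ 2)
   - sum_over D (fun u => 1 / (z' - u) + 1 / u + z' / u ^+ 2)
   + (z - z') * sum_over D (fun u => 1 / (z - u) ^+ 2 - 1 / u ^+ 2).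
  rewrite -sum_overZ// -sum_overB// -sum_overD//; [|exact: summB|exact: summZ].
  by apply: eq_sum_over => u _; rewrite /psi_term; ring.
ring.
Qed.

Lemma psi_termD z z' u v : psi_term (z + v) (z' + v) (u + v) = psi_term z z' u.
Proof. by rewrite /psi_term; congr (1 / _ - 1 / _ + _ / _ ^+ 2); ring. Qed.

Lemma zeta_gap_diff z z' : ~ L z -> ~ D z -> ~ L z' -> ~ D z' ->
  zeta_gap z - zeta_gap z' = sum_over D (psi_term z z') - sum_over L (psi_term z z') + (z - z') * (wp_gap z - wp_coset z).
Proof.
move=> Lz Dz Lz' Dz'.
have [h1 _] := wzeta_diff Lz Lz'; have [h2 _] := wzeta_coset_diff Dz Dz'.
have -> : zeta_gap z - zeta_gap z' = (wzeta_sum D z - wzeta_sum D z') - (wzeta z - wzeta z') - half_value * (z - z').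
  by rewrite /zeta_gap; ring.
rewrite h1 h2 /wp_gap; ring.
Qed.

(** By zeta_gap_diff the sum zeta_gap (z + w) + zeta_gap z is independent of z, and it
    changes sign between z and - z - w. *)
Lemma zeta_gap_shift z : ~ L z -> ~ D z -> zeta_gap (z + w) = - zeta_gap z.
Proof.
move=> Lz Dz.
have Lzw : ~ L (z + w) by move=> /subgroup_shiftw.
have Dzw : ~ D (z + w) by move=> /coset_shiftw.
pose z' := - (z + w).
have Lz' : ~ L z' by apply: notLN. have Dz' : ~ D z' by apply: notDN.
have z'w : z' + w = - z by rewrite /z'; ring.
have := zeta_gap_diff Lz Dz Lz' Dz'.
have Lzw' : ~ L (z' + w) by rewrite z'w; apply: notLN.
have Dzw' : ~ D (z' + w) by rewrite z'w; apply: notDN.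
have := zeta_gap_diff Lzw Dzw Lzw' Dzw'.
have [_ s1] := wzeta_diff Lzw Lzw'; have [_ s2] := wzeta_coset_diff Dzw Dzw'.
rewrite (sum_over_translate (v := w) coset_shiftw (psi_termD _ _ ^~ _) s2).
rewrite (sum_over_translate (v := w) subgroup_shiftw (psi_termD _ _ ^~ _) s1).
rewrite wp_gap_shift// wp_coset_shift// z'w /z' !zeta_gapN// => H1 H2.
have H : 2 * (zeta_gap (z + w) + zeta_gap z) = 0.
  have -> : 2 * (zeta_gap (z + w) + zeta_gap z) = (zeta_gap (z + w) - - zeta_gap z) + (zeta_gap z - - zeta_gap (z + w)) by ring.
  by rewrite H1 H2; ring.
by apply/eqP; rewrite -addr_eq0; move/eqP: H; rewrite mulf_eq0 pnatr_eq0.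
Qed.

(** Translation by v adds a constant to zeta_gap; since zeta_gap changes sign under
    translation by w, the constant is its own opposite. *)
Lemma zeta_gap_periodic v z : L v -> ~ L z -> ~ D z -> zeta_gap (z + v) = zeta_gap z.
Proof.
move=> Lv Lz Dz.
have Lzv : ~ L (z + v) by move=> /(subgroup_shift _ Lv).
have Dzv : ~ D (z + v) by move=> /(coset_shift _ Lv).
have Lzw : ~ L (z + w) by move=> /subgroup_shiftw.
have Dzw : ~ D (z + w) by move=> /coset_shiftw.
have Lzwv : ~ L (z + w + v) by move=> /(subgroup_shift _ Lv).
have Dzwv : ~ D (z + w + v) by move=> /(coset_shift _ Lv).
have := zeta_gap_diff Lz Dz Lzw Dzw; have := zeta_gap_diff Lzv Dzv Lzwv Dzwv.
have [_ s1] := wzeta_diff Lzv Lzwv; have [_ s2] := wzeta_coset_diff Dzv Dzwv.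
rewrite (sum_over_translate (v := v) (fun u => @coset_shift v u Lv) (psi_termD _ _ ^~ _) s2).
rewrite (sum_over_translate (v := v) (fun u => @subgroup_shift v u Lv) (psi_termD _ _ ^~ _) s1).
rewrite wp_gap_periodic// wp_coset_periodic//.
have -> : z + w + v = z + v + w by ring.
rewrite !zeta_gap_shift// => H1 H2.
have H : 2 * zeta_gap (z + v) = 2 * zeta_gap z.
  have -> : 2 * zeta_gap (z + v) = zeta_gap (z + v) - - zeta_gap (z + v) by ring.
  have -> : 2 * zeta_gap z = zeta_gap z - - zeta_gap z by ring.
  by rewrite H1 H2; congr (_ + _ * _); ring.
exact: (mulfI _ H).
Qed.


Local Notation G z := (L z \/ D z).

Lemma ambient_far z : ~ G z -> exists2 r : R, 0 < r & forall u, G u -> 2 * r <= cmod (z - u).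
Proof.
move=> Gz; apply: (ambient_sep amb (S := [set u | G u])) => // u /= [/LLam//|].
by move=> /coset_Lam[].
Qed.

Section Off.
Variables (a : C) (r : R).
Hypotheses (r0 : 0 < r) (far : forall u, G u -> 2 * r <= cmod (a - u)).

Let r0' : 0 <= r. Proof. exact: ltW. Qed.
Let farL u : L0 u -> 2 * r <= cmod (a - u). Proof. by case=> Lu _; apply: far; left. Qed.
Let farD u : D u -> 2 * r <= cmod (a - u). Proof. by move=> Du; apply: far; right. Qed.
Let ra : 2 * r <= cmod a. Proof. by have := far (or_introl subgroup0); rewrite subr0. Qed.
Let a0 : a != 0.
Proof. by rewrite -cmod_gt0; apply: lt_le_trans ra; rewrite mulr_gt0. Qed.
Let J0 := jet_inv r0 ra.

Lemma off_G h : cmod h <= r -> ~ G (a + h).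
Proof.
move=> hr /far; have -> : a - (a + h) = - h by ring.
by rewrite cmodN => /le_trans/(_ hr); rewrite ger_pMl// lern1.
Qed.

Lemma jet_wp_gap : exists N, jet r N (fun h => wp_gap (a + h)) (dwp_gap a).
Proof.
have [N J] := jet_wp_sum amb L0_Lam r0 farL.
have J' := jetD r0' (jetM r0' J0 J0) (jetB r0' J (jet_cst r half_value)).
eexists; have -> : dwp_gap a = - a ^- 2 * (a + 0)^-1 + (a + 0)^-1 * - a ^- 2 + (- 2 * cube_sum L0 a - 0).
  by rewrite /dwp_gap addr0; field; rewrite a0.
apply: (jet_ext r0' _ J') => h _; rewrite /wp_gap wpE addrA mul1r.
by congr (_ + _ - _); rewrite -expr2 exprVn.
Qed.

Lemma jet_wp_coset : exists N, jet r N (fun h => wp_coset (a + h)) (dwp_coset a).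
Proof. exact: (jet_wp_sum amb coset_Lam r0 farD). Qed.

Lemma jet_wzeta : exists N, jet r N (fun h => wzeta (a + h)) (- wp a).
Proof.
have [N J] := jet_wzeta_sum amb L0_Lam r0 farL.
eexists; have -> : - wp a = - a ^- 2 + - wp_sum L0 a by rewrite wpE opprD mul1r.
by apply: (jet_ext r0' _ (jetD r0' J0 J)) => h _; rewrite wzetaE mul1r.
Qed.

Lemma jet_zeta_gap : exists N, jet r N (fun h => zeta_gap (a + h)) (wp_gap a - wp_coset a).
Proof.
have [N J] := jet_wzeta_sum amb coset_Lam r0 farD; have [N' J'] := jet_wzeta.
have Ja := jetZ half_value r0' (jet_var r a).
eexists; have -> : wp_gap a - wp_coset a = - wp_sum D a - - wp a - half_value * 1 by rewrite /wp_gap /wp_coset; ring.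
exact: (jetB r0' (jetB r0' J J') Ja).
Qed.

Lemma jetx_dwp_gap : jetx r (fun h => dwp_gap (a + h)).
Proof.
have J : jetx r (fun h => cube_sum L0 (a + h)) by exact: (jet_cube_sum amb L0_Lam r0 farL).
have J1 : jetx r (fun h => (a + h)^-1) by do 2 eexists; exact: J0.
apply: (jetx_ext r0' _ (jetxZ (-2) r0' (jetxD r0' (jetxX 3 r0' J1) J))) => h _.
by rewrite /dwp_gap mul1r exprVn.
Qed.

Lemma jetx_wp_gap : jetx r (fun h => wp_gap (a + h)).
Proof. by have [N J] := jet_wp_gap; exists N, (dwp_gap a). Qed.
Lemma jetx_wp_coset : jetx r (fun h => wp_coset (a + h)).
Proof. by have [N J] := jet_wp_coset; exists N, (dwp_coset a). Qed.
Lemma jetx_zeta_gap : jetx r (fun h => zeta_gap (a + h)).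
Proof. by have [N J] := jet_zeta_gap; exists N, (wp_gap a - wp_coset a). Qed.

End Off.

Let r := delta / 2.
Let r0 : 0 < r. Proof. by case: amb => _ d0 _ _; rewrite /r divr_gt0. Qed.
Let r0' : 0 <= r. Proof. exact: ltW. Qed.

Lemma small_off z : z != 0 -> cmod z <= r -> ~ G z.
Proof.
move=> z0 zr Gz; have [_ d0 H _] := amb.
have Lz : Lam z by case: Gz => [/LLam//|/coset_Lam[]].
have := le_trans (H z Lz z0) zr; rewrite /r ler_pdivlMr// ger_pMr//.
by rewrite lern1.
Qed.

Let pi0 := wp_reg L0. Let piD := wp_reg D.
Let ka z := wzeta_reg D z - wzeta_reg L0 z.
Let ta0 := cube_reg L0. Let taD := cube_reg D.

Lemma wp_gap_near0 z : z != 0 -> cmod z <= r -> wp_gap z = z ^- 2 - half_value + z ^+ 2 * pi0 z.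
Proof.
move=> z0 zr; rewrite /wp_gap wpE (wp_sum_near0 amb L0_Lam L0N zr) mul1r /pi0; ring.
Qed.

Lemma wp_coset_near0 z : cmod z <= r -> wp_coset z = z ^+ 2 * piD z.
Proof. by move=> zr; rewrite /wp_coset (wp_sum_near0 amb coset_Lam cosetN zr). Qed.

Lemma zeta_gap_near0 z : cmod z <= r -> zeta_gap z = - z^-1 - half_value * z + z ^+ 3 * ka z.
Proof.
move=> zr; rewrite /zeta_gap wzetaE (wzeta_sum_near0 amb L0_Lam L0N zr) (wzeta_sum_near0 amb coset_Lam cosetN zr).
by rewrite mul1r /ka; ring.
Qed.

Lemma dwp_gap_near0 z : cmod z <= r -> dwp_gap z = - 2 * (z ^- 3 + z * ta0 z).
Proof. by move=> zr; rewrite /dwp_gap (cube_sum_near0 amb L0_Lam L0N zr) mul1r. Qed.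

Lemma dwp_coset_near0 z : cmod z <= r -> dwp_coset z = - 2 * (z * taD z).
Proof. by move=> zr; rewrite /dwp_coset (cube_sum_near0 amb coset_Lam cosetN zr). Qed.

Let jpi0 : jetx r pi0. Proof. exact: (jet_wp_reg amb L0_Lam L0N). Qed.
Let jpiD : jetx r piD. Proof. exact: (jet_wp_reg amb coset_Lam cosetN). Qed.
Let jka : jetx r ka.
Proof. by apply: jetxB => //; [exact: (jet_wzeta_reg amb coset_Lam cosetN)|exact: (jet_wzeta_reg amb L0_Lam L0N)]. Qed.
Let jta0 : jetx r ta0. Proof. exact: (jet_cube_reg amb L0_Lam L0N). Qed.
Let jtaD : jetx r taD. Proof. exact: (jet_cube_reg amb coset_Lam cosetN). Qed.
Let jz n : jetx r (fun h : C => h ^+ n).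
Proof. by apply: jetxX => //; exact: jetx_id. Qed.

(** With p = wp_gap, h = zeta_gap and q = wp_coset: E0 and E1 are p' - 2 h p near 0 and near w,
    divided by the local coordinate, and F0 is p q near 0. The polar parts have cancelled. *)
Let E0 z := 2 * (pi0 z - ta0 z - half_value ^+ 2 - ka z + half_value * (z ^+ 2 * (pi0 z + ka z)) - z ^+ 4 * (ka z * pi0 z)).
Let E1 z := - 2 * (taD z + piD z * (1 + half_value * z ^+ 2 - z ^+ 4 * ka z)).
Let F0 z := piD z * (1 - half_value * z ^+ 2 + z ^+ 4 * pi0 z).

Let jE0 : jetx r E0.
Proof.
apply: jetxZ => //; apply: jetxB => //; last by apply: jetxM => //; exact: jetxM.
apply: jetxD => //; last by apply: jetxZ => //; apply: jetxM => //; exact: jetxD.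
apply: jetxB => //; apply: jetxB => //; last exact: jetx_cst.
exact: jetxB.
Qed.

Let jE1 : jetx r E1.
Proof.
apply: jetxZ => //; apply: jetxD => //; apply: jetxM => //; apply: jetxB => //; last exact: jetxM.
by apply: jetxD => //; [exact: jetx_cst|exact: jetxZ].
Qed.

Let jF0 : jetx r F0.
Proof.
apply: jetxM => //; apply: jetxD => //; last exact: jetxM.
by apply: jetxB => //; [exact: jetx_cst|exact: jetxZ].
Qed.

Let Eext z := if z \in [set u | G u] then 0 else dwp_gap z - 2 * zeta_gap z * wp_gap z.
Let Fext z := if z \in [set u | G u] then F0 0 else wp_gap z * wp_coset z.

Let EextF z : ~ G z -> Eext z = dwp_gap z - 2 * zeta_gap z * wp_gap z.
Proof. by move=> Gz; rewrite /Eext memNset. Qed.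
Let EextT z : G z -> Eext z = 0.
Proof. by move=> Gz; rewrite /Eext mem_set. Qed.
Let FextF z : ~ G z -> Fext z = wp_gap z * wp_coset z.
Proof. by move=> Gz; rewrite /Fext memNset. Qed.
Let FextT z : G z -> Fext z = F0 0.
Proof. by move=> Gz; rewrite /Fext mem_set. Qed.

Let G_shift v z : L v -> G (z + v) <-> G z.
Proof. by move=> Lv; rewrite (subgroup_shift z Lv) (coset_shift z Lv). Qed.

Let G_shiftw z : G (z + w) <-> G z.
Proof. by rewrite subgroup_shiftw coset_shiftw; split => -[]; [right|left|right|left]. Qed.

Let Eper v z : L v -> Eext (z + v) = Eext z.
Proof.
move=> Lv; have [Gz|Gz] := pselect (G z); first by rewrite !EextT//; apply/G_shift.
have [Lz Dz] : ~ L z /\ ~ D z by split => ?; apply: Gz; [left|right].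
by rewrite !EextF ?dwp_gap_periodic ?zeta_gap_periodic ?wp_gap_periodic// => /(G_shift _ Lv).
Qed.

Let Fper v z : L v -> Fext (z + v) = Fext z.
Proof.
move=> Lv; have [Gz|Gz] := pselect (G z); first by rewrite !FextT//; apply/G_shift.
have [Lz Dz] : ~ L z /\ ~ D z by split => ?; apply: Gz; [left|right].
by rewrite !FextF ?wp_coset_periodic ?wp_gap_periodic// => /(G_shift _ Lv).
Qed.

Let Fperw z : Fext (z + w) = Fext z.
Proof.
have [Gz|Gz] := pselect (G z); first by rewrite !FextT//; apply/G_shiftw.
have [Lz Dz] : ~ L z /\ ~ D z by split => ?; apply: Gz; [left|right].
by rewrite !FextF ?wp_coset_shift ?wp_gap_shift 1?mulrC// => /G_shiftw.
Qed.

Let E_near0 z : cmod z <= r -> Eext z = z * E0 z.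
Proof.
move=> zr; have [->|z0] := eqVneq z 0; first by rewrite mul0r EextT//; left; exact: subgroup0.
rewrite EextF; last exact: small_off.
by rewrite dwp_gap_near0// zeta_gap_near0// wp_gap_near0// /E0; field; rewrite z0.
Qed.

Let E_nearw z : cmod z <= r -> Eext (z + w) = z * E1 z.
Proof.
move=> zr; have [->|z0] := eqVneq z 0.
  by rewrite mul0r EextT//; right; rewrite coset_shiftw; exact: subgroup0.
have Gz := small_off z0 zr.
have [Lz Dz] : ~ L z /\ ~ D z by split => ?; apply: Gz; [left|right].
rewrite EextF; last by rewrite G_shiftw.
rewrite dwp_gap_shift// zeta_gap_shift// wp_gap_shift// dwp_coset_near0// zeta_gap_near0// wp_coset_near0// /E1; field; rewrite z0//.
Qed.

Let F_near0 z : cmod z <= r -> Fext z = F0 z.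
Proof.
move=> zr; have [->|z0] := eqVneq z 0; first by rewrite FextT//; left; exact: subgroup0.
rewrite FextF; last exact: small_off.
by rewrite wp_coset_near0// wp_gap_near0// /F0; field; rewrite z0.
Qed.

Let Ejet a : exists r' N d, 0 < r' /\ jet r' N (fun h => Eext (a + h)) d.
Proof.
have [[La|Da]|Ga] := pselect (G a).
- have [N [d J]] : jetx r (fun h => Eext (a + h)).
    apply: (jetx_ext r0' _ (jetxM r0' (jetx_id r) jE0)) => h hr.
    by rewrite addrC Eper// E_near0.
  by exists r, N, d.
- have [N [d J]] : jetx r (fun h => Eext (a + h)).
    apply: (jetx_ext r0' _ (jetxM r0' (jetx_id r) jE1)) => h hr.
    have -> : a + h = h + w + (a - w) by ring.
    by rewrite Eper// E_nearw.
  by exists r, N, d.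
have [s s0 far] := ambient_far Ga; have s0' := ltW s0.
have [N [d J]] : jetx s (fun h => Eext (a + h)).
  apply: (jetx_ext s0' _ (jetxB s0' (jetx_dwp_gap s0 far)
    (jetxM s0' (jetxZ 2 s0' (jetx_zeta_gap s0 far)) (jetx_wp_gap s0 far)))) => h hs.
  by rewrite EextF//; exact: (off_G s0 far).
by exists s, N, d.
Qed.

Let Fjet a : exists r' N d, 0 < r' /\ jet r' N (fun h => Fext (a + h)) d.
Proof.
have [Ga|Ga] := pselect (G a).
  have [N [d J]] : jetx r (fun h => Fext (a + h)).
    apply: (jetx_ext r0' _ jF0) => h hr; rewrite -F_near0//.
    case: Ga => [La|Da]; first by rewrite addrC Fper.
    have -> : a + h = h + w + (a - w) by ring.
    by rewrite Fper// Fperw.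
  by exists r, N, d.
have [s s0 far] := ambient_far Ga; have s0' := ltW s0.
have [N [d J]] : jetx s (fun h => Fext (a + h)).
  apply: (jetx_ext s0' _ (jetxM s0' (jetx_wp_gap s0 far) (jetx_wp_coset s0 far))) => h hs.
  by rewrite FextF//; exact: (off_G s0 far).
by exists s, N, d.
Qed.

Variable rho : R.
Hypothesis cocompact : forall z, exists2 u, L u & cmod (z - u) <= rho.

Let Gz0 : G 0. Proof. by left; exact: subgroup0. Qed.

(** The difference of the sides is periodic, without poles, and zero at the poles it had. *)
Lemma wp_gap_ode z : ~ G z -> dwp_gap z = 2 * zeta_gap z * wp_gap z.
Proof.
move=> Gz; have := liouville_periodic Ejet (fun x u Lu => Eper x Lu) cocompact z.
by rewrite (EextT Gz0) EextF// => /eqP; rewrite subr_eq0 => /eqP.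
Qed.

Definition gap_cst := 3 * sum_over D (fun u => 1 / u ^+ 4).

(** The double pole of each factor is cancelled by the double zero of the other. *)
Lemma wp_gap_coset_cst z : ~ G z -> wp_gap z * wp_coset z = gap_cst.
Proof.
move=> Gz; have := liouville_periodic Fjet (fun x u Lu => Fper x Lu) cocompact z.
rewrite (FextT Gz0) FextF// => ->.
by rewrite /F0 /piD (wp_reg0 amb coset_Lam)// !expr0n /= mulr0 mul0r subr0 addr0 mulr1.
Qed.

(** The coefficient of z in wp_gap_ode at 0 relates the sums of u ^ -4 over L and over D. *)
Lemma gap_cst_g2 : gap_cst = 3 * half_value ^+ 2 - weierstrass_g2 L / 4.
Proof.
have E00 : E0 0 = 0.
  apply: (jetx_zero r0 jE0) => h h0 hr; apply: (mulfI h0); rewrite mulr0 -E_near0//.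
  by rewrite EextF ?wp_gap_ode ?subrr//; exact: small_off.
have g2E : weierstrass_g2 L = 60 * sum_over L0 (fun u => 1 / u ^+ 4).
  rewrite -sum_overZ; last exact: (summ_inv4 amb L0_Lam).
  by apply: eq_sum_over => u _; rewrite mul1r.
move: E00; rewrite /E0 /pi0 /ta0 /ka (wzeta_reg0 amb coset_Lam)// (wzeta_reg0 amb L0_Lam)//.
rewrite (wp_reg0 amb L0_Lam)// (cube_reg0 amb L0_Lam)// !expr0n /= g2E /gap_cst.
set s := sum_over L0 _; set t := sum_over D _ => H.
have -> : t = half_value ^+ 2 - 5 * s.
  by apply/eqP; rewrite -subr_eq0; apply/eqP; rewrite -[RHS](mulr0 2^-1) -H; field.
by field.
Qed.

Lemma union_coset0 : [set u | G u] `\ 0 = L0 `|` D.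
Proof.
apply/seteqP; split => u /=; first by case=> -[Lu|Du] u0; [left|right].
case=> [[Lu u0]|Du]; first by split => //; left.
by split; [right|move=> u0; apply: coset0; rewrite -u0].
Qed.

Lemma g2_index_two : weierstrass_g2 [set u | G u] = weierstrass_g2 L + 20 * gap_cst.
Proof.
have sL := summ_inv4 amb L0_Lam. have sD := summ_inv4 amb coset_Lam.
have E S : sum_over S (fun u => 60 * u ^- 4) = sum_over S (fun u => 60 * (1 / u ^+ 4)).
  by apply: eq_sum_over => u _; rewrite mul1r.
rewrite /weierstrass_g2 !E.
rewrite union_coset0 sum_overU; [|exact: summZ|exact: summZ|by move=> u [Lu _] /coset_notL].
congr (_ + _); rewrite (sum_overZ _ sD) /gap_cst mulrA; congr (_ * _); ring.
Qed.

Lemma wp_index_two z : ~ G z -> weierstrass_p [set u | G u] z = wp z + wp_coset z.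
Proof.
move=> Gz; have [Lz Dz] : ~ L z /\ ~ D z by split => ?; apply: Gz; [left|right].
rewrite /weierstrass_p.
rewrite union_coset0 sum_overU; [|exact: summ_wp|exact: summ_wp_coset|by move=> u [Lu _] /coset_notL].
by rewrite addrA.
Qed.

Lemma wzeta_index_two z : ~ G z -> weierstrass_zeta [set u | G u] z = 2 * wzeta z + zeta_gap z + half_value * z.
Proof.
move=> Gz; have [Lz Dz] : ~ L z /\ ~ D z by split => ?; apply: Gz; [left|right].
rewrite /weierstrass_zeta.
rewrite union_coset0 sum_overU; [|exact: summ_wzeta|exact: summ_wzeta_coset|by move=> u [Lu _] /coset_notL].
by rewrite addrA /zeta_gap /wzeta /weierstrass_zeta /wzeta_sum; ring.
Qed.

End Isogeny.

(** * The complex exponential *)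

Section ComplexExponential.
Variable R : realType.
Local Notation C := R[i].

(** A bound on the derivative is integrated by the mean value theorem; iterating it gives
    the Taylor remainders of exp, sin and cos. *)
Lemma derive_bound (f df : R -> R) (K B : R) n : 0 <= K -> (forall x : R, is_derive x 1 f (df x)) -> f 0 = 0 ->
  (forall x : R, `|x| <= B -> `|df x| <= K * `|x| ^+ n) ->
  forall x : R, `|x| <= B -> `|f x| <= K * `|x| ^+ n.+1.
Proof.
move=> K0 fd f0 H x xB.
have cf : continuous f by move=> y; apply/differentiable_continuous/derivable1_diffP; have [] := fd y.
have key (c : R) : `|c| <= `|x| -> f x = df c * x -> `|f x| <= K * `|x| ^+ n.+1.
  move=> cx ->; have cB := le_trans cx xB.
  rewrite normrM exprSr mulrA ler_wpM2r//; apply: le_trans (H c cB) _.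
  by rewrite ler_wpM2l// lerXn2r// nnegrE.
have [x0|x0] := leP 0 x.
  have [c] := MVT_segment x0 (fun y _ => fd y) (continuous_subspaceT cf).
  rewrite in_itv /= f0 !subr0 => /andP[c0 cx] fx; apply: key fx.
  by rewrite !ger0_norm.
have [c] := MVT_segment (ltW x0) (fun y _ => fd y) (continuous_subspaceT cf).
rewrite in_itv /= f0 !sub0r => /andP[xc c0] fx; apply: (key c).
  by rewrite !ler0_norm// ?lerN2// ltW.
by apply/oppr_inj; rewrite fx mulrN.
Qed.

Lemma is_derive_half_sqr (x : R) : is_derive x 1 (fun y : R => y ^+ 2 / 2) x.
Proof.
have -> : (fun y : R => y ^+ 2 / 2) = 2^-1 \*: (id ^+ 2).
  by apply/funext => y; rewrite /= mulrC.
apply: is_derive_eq; rewrite /GRing.scale /= mulr1 expr1.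
by rewrite mulrA mulVf ?mul1r// pnatr_eq0.
Qed.

Lemma expR_bounds (B x : R) : `|x| <= B ->
  `|expR x - 1 - x| <= expR B * `|x| ^+ 2 /\
  `|expR x - 1 - x - x ^+ 2 / 2| <= expR B * `|x| ^+ 3.
Proof.
have E0 (y : R) : `|y| <= B -> `|expR y| <= expR B * `|y| ^+ 0.
  by move=> yB; rewrite mulr1 ger0_norm ?expR_ge0// ler_expR (le_trans (ler_norm _) yB).
have E1 (y : R) : `|y| <= B -> `|expR y - 1| <= expR B * `|y| ^+ 1.
  apply: (derive_bound (f := fun y => expR y - 1) (df := expR) (expR_ge0 B) _ _ E0) => [z|]; last by rewrite expR0 subrr.
  by rewrite -[X in is_derive _ _ _ X]subr0; apply: is_deriveB.
have E2 (y : R) : `|y| <= B -> `|expR y - 1 - y| <= expR B * `|y| ^+ 2.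
  apply: (derive_bound (f := fun y => expR y - 1 - y) (df := fun y => expR y - 1) (expR_ge0 B) _ _ E1) => [z|].
    by apply: is_deriveB; rewrite -[X in is_derive _ _ _ X]subr0; apply: is_deriveB.
  by rewrite expR0 !subrr.
move=> xB; split; first exact: E2.
apply: (derive_bound (f := fun y => expR y - 1 - y - y ^+ 2 / 2) (df := fun y => expR y - 1 - y) (expR_ge0 B) _ _ E2) xB => [z|].
  apply: is_deriveB; last exact: is_derive_half_sqr.
  by apply: is_deriveB; rewrite -[X in is_derive _ _ _ X]subr0; apply: is_deriveB.
by rewrite expR0 subrr expr0n /= mul0r !subr0.
Qed.

Lemma trig_bounds (x : R) : [/\ `|sin x| <= `|x|, `|cos x - 1| <= `|x| /\ `|cos x - 1| <= `|x| ^+ 2,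
  `|sin x - x| <= `|x| ^+ 2, `|sin x - x| <= `|x| ^+ 3 & `|cos x - 1 + x ^+ 2 / 2| <= `|x| ^+ 3].
Proof.
pose B := `|x|; have xB : `|x| <= B := lexx _.
have S0 (y : R) : `|y| <= B -> `|- sin y| <= 1 * `|y| ^+ 0.
  by move=> _; rewrite mulr1 normrN ler_norml sin_geN1 sin_le1.
have C0 (y : R) : `|y| <= B -> `|cos y| <= 1 * `|y| ^+ 0.
  by move=> _; rewrite mulr1 ler_norml cos_geN1 cos_le1.
have S1 (y : R) : `|y| <= B -> `|sin y| <= 1 * `|y| ^+ 1.
  by apply: (derive_bound ler01 _ _ C0); rewrite sin0.
have Dc (z : R) : is_derive z 1 (fun y => cos y - 1) (- sin z).
  by rewrite -[X in is_derive _ _ _ X]subr0; apply: is_deriveB.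
have Ds (z : R) : is_derive z 1 (fun y => sin y - y) (cos z - 1) by apply: is_deriveB.
have Dc2 (z : R) : is_derive z 1 (fun y => cos y - 1 + y ^+ 2 / 2) (- sin z + z).
  by apply: is_deriveD; exact: is_derive_half_sqr.
have c0 : cos 0 - 1 = 0 :> R by rewrite cos0 subrr.
have s0 : sin 0 - 0 = 0 :> R by rewrite sin0 subrr.
have C1 (y : R) : `|y| <= B -> `|cos y - 1| <= 1 * `|y| ^+ 1.
  exact: (derive_bound ler01 Dc c0 S0).
have S2 (y : R) : `|y| <= B -> `|sin y - y| <= 1 * `|y| ^+ 2.
  exact: (derive_bound ler01 Ds s0 C1).
have S1' (y : R) : `|y| <= B -> `|- sin y| <= 1 * `|y| ^+ 1 by rewrite normrN; exact: S1.
have C2 (y : R) : `|y| <= B -> `|cos y - 1| <= 1 * `|y| ^+ 2.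
  exact: (derive_bound ler01 Dc c0 S1').
have S3 (y : R) : `|y| <= B -> `|sin y - y| <= 1 * `|y| ^+ 3.
  exact: (derive_bound ler01 Ds s0 C2).
have S2' (y : R) : `|y| <= B -> `|- sin y + y| <= 1 * `|y| ^+ 2.
  by move=> /S2; rewrite -normrN opprB [y - _]addrC.
have C3 (y : R) : `|y| <= B -> `|cos y - 1 + y ^+ 2 / 2| <= 1 * `|y| ^+ 3.
  by apply: (derive_bound ler01 Dc2 _ S2'); rewrite c0 expr0n /= mul0r addr0.
have := S1 x xB; have := C1 x xB; have := C2 x xB; have := S2 x xB; have := S3 x xB; have := C3 x xB.
by rewrite !mul1r !expr1.
Qed.

Implicit Types x y z : C.

Lemma cexpD x y : cexp (x + y) = cexp x * cexp y.
Proof.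
case: x y => a b [c d]; rewrite /cexp /= expRD cosD sinD rmorphM /=.
have -> : (cos b * cos d - sin b * sin d) +i* (sin b * cos d + cos b * sin d) =
  (cos b +i* sin b) * (cos d +i* sin d).
  by apply/eqP; rewrite eq_complex /=; apply/andP; split; apply/eqP; ring.
ring.
Qed.

Lemma cexp0 : cexp (0 : C) = 1.
Proof. by rewrite /cexp /= expR0 cos0 sin0 mul1r. Qed.

Lemma cexp_neq0 x : cexp x != 0.
Proof.
apply/eqP => x0; have := cexpD x (- x); rewrite subrr cexp0 x0 mul0r => /eqP.
by rewrite oner_eq0.
Qed.

Lemma cexp_bound3 (B : R) y : cmod y <= B ->
  cmod (cexp y - 1 - y - y ^+ 2 / 2) <= (5 + 2 * expR B) * cmod y ^+ 3.
Proof.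
case: y => a b yB; set t := cmod _ in yB *; have t0 : 0 <= t := cmod_ge0 _.
have at_ : `|a| <= t := cmod_Re (a +i* b); have bt : `|b| <= t := cmod_Im (a +i* b).
have [e2 e3] := expR_bounds (le_trans at_ yB); have [s1 [c1 c2] s2 s3 c3] := trig_bounds b.
set K := expR B in e2 e3 *; have K0 : 0 <= K by apply: expR_ge0.
have sqE : (a +i* b) ^+ 2 / 2 = ((a ^+ 2 - b ^+ 2) / 2) +i* (a * b).
  apply: (mulfI (_ : (2 : C) != 0)); first by rewrite pnatr_eq0.
  rewrite mulrC divfK ?pnatr_eq0// mulr_natl.
  by rewrite expr2 mulr2n; apply/eqP; rewrite eq_complex /=; apply/andP; split; apply/eqP; field.
rewrite sqE; apply: le_trans (cmod_ReIm _) _; rewrite /cexp /= !mul0r !subr0 !addr0.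
rewrite {sqE}; set E := expR a in e2 e3 *; set c := cos b in c1 c2 c3 *; set s := sin b in s1 s2 s3 *.
have cl : `|c| <= 1 by rewrite ler_norml cos_geN1 cos_le1.
have t3E : t ^+ 3 = t * t * t by ring.
have n2 (x : R) : `|x| ^+ 2 = `|x| * `|x| by rewrite expr2.
have n3 (x : R) : `|x| ^+ 3 = `|x| * `|x| * `|x| by ring.
have aa := ler_pM (normr_ge0 _) (normr_ge0 _) at_ at_.
have bb := ler_pM (normr_ge0 _) (normr_ge0 _) bt bt.
have a3 : `|a| ^+ 3 <= t ^+ 3 by rewrite lerXn2r ?nnegrE.
have b3 : `|b| ^+ 3 <= t ^+ 3 by rewrite lerXn2r ?nnegrE.
have aabt : `|a| ^+ 2 * `|b| <= t ^+ 3 by rewrite n2 t3E; apply: ler_pM; rewrite ?mulr_ge0.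
have abbt : `|a| * `|b| ^+ 2 <= t ^+ 3 by rewrite n2 t3E -mulrA; apply: ler_pM; rewrite ?mulr_ge0.
have t3 := exprn_ge0 3 t0.
have ha2 : `|a| ^+ 2 * `|c - 1| <= t ^+ 3.
  by apply: le_trans aabt; rewrite ler_wpM2l ?exprn_ge0.
have ha1 : `|a| * `|c - 1| <= t ^+ 3 by apply: le_trans abbt; rewrite ler_wpM2l.
have ha3 : `|a| * `|s - b| <= t ^+ 3 by apply: le_trans abbt; rewrite ler_wpM2l.
have he3 : `|E - 1 - a - a ^+ 2 / 2| * `|c| <= K * t ^+ 3.
  rewrite -[X in _ <= X]mulr1; apply: ler_pM => //; apply: le_trans e3 _; exact: ler_wpM2l.
have he2 : `|E - 1 - a| * `|s| <= K * t ^+ 3.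
  apply: le_trans (_ : K * `|a| ^+ 2 * `|b| <= _); first exact: ler_pM.
  by rewrite -mulrA ler_wpM2l.
apply: le_trans (_ : (`|c - 1 + b ^+ 2 / 2| + `|a| * `|c - 1| + `|a| ^+ 2 * `|c - 1| +
  `|E - 1 - a - a ^+ 2 / 2| * `|c|) + (`|s - b| + `|a| * `|s - b| + `|E - 1 - a| * `|s|) <= _); last first.
  by move: c3 s3; lra.
apply: lerD.
  have -> : E * c - 1 - a - (a ^+ 2 - b ^+ 2) / 2 =
    (c - 1 + b ^+ 2 / 2) + a * (c - 1) + a ^+ 2 / 2 * (c - 1) + (E - 1 - a - a ^+ 2 / 2) * c by field.
  apply: le_trans (ler_normD _ _) _; rewrite normrM lerD2r.
  apply: le_trans (ler_normD _ _) _; apply: lerD.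
    by apply: le_trans (ler_normD _ _) _; rewrite normrM.
  rewrite normrM ler_wpM2r// normrM normrX ler_piMr ?exprn_ge0//.
  by rewrite ger0_norm ?invr_ge0// invf_le1// ler1n.
have -> : E * s - b - a * b = (s - b) + a * (s - b) + (E - 1 - a) * s by ring.
apply: le_trans (ler_normD _ _) _; rewrite normrM lerD2r.
by apply: le_trans (ler_normD _ _) _; rewrite normrM.
Qed.


Lemma cexp_bound2 (B : R) y : cmod y <= B ->
  cmod (cexp y - 1 - y) <= (1 + (5 + 2 * expR B) * B) * cmod y ^+ 2.
Proof.
move=> yB; have t0 := cmod_ge0 y.
have -> : cexp y - 1 - y = (cexp y - 1 - y - y ^+ 2 / 2) + y ^+ 2 / 2 by rewrite subrK.
apply: le_trans (cmodD _ _) _; rewrite mulrDl mul1r addrC; apply: lerD.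
  by rewrite cmodM cmodX cmodV cmod_nat ler_piMr ?exprn_ge0// invf_le1// ler1n.
apply: le_trans (cexp_bound3 yB) _; rewrite exprS mulrA ler_wpM2r ?exprn_ge0//.
by rewrite ler_wpM2l// addr_ge0// mulr_ge0// expR_ge0.
Qed.

Lemma has_deriv_cexp (f : C -> C) a d : has_deriv f a d -> has_deriv (fun z => cexp (f z)) a (d * cexp (f a)).
Proof.
move=> Df; have [r2 [M [r20 _ M0 HM]]] := has_deriv_lip Df.
case: Df => [r [K [r0 K0 H]]].
pose B := M; pose k := 1 + (5 + 2 * expR B) * B.
have k0 : 0 <= k by rewrite addr_ge0// mulr_ge0// addr_ge0// mulr_ge0// expR_ge0.
exists (Num.min (Num.min r r2) 1), (cmod (cexp (f a)) * (k * M ^+ 2 + K)); split.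
- by rewrite !lt_min r0 r20 ltr01.
- by rewrite mulr_ge0 ?cmod_ge0// addr_ge0// mulr_ge0// exprn_ge0.
move=> h; rewrite !le_min => /andP[/andP[/H h1 /HM h2] h3].
set x := f (a + h) - f a in h2 *.
have -> : f (a + h) = f a + x by rewrite /x [RHS]addrC subrK.
have -> : cexp (f a + x) - cexp (f a) - d * cexp (f a) * h =
  cexp (f a) * ((cexp x - 1 - x) + (x - d * h)) by rewrite cexpD; ring.
rewrite cmodM -mulrA ler_wpM2l ?cmod_ge0//.
apply: le_trans (cmodD _ _) _; rewrite [X in _ <= X]mulrDl; apply: lerD => //.
have xB : cmod x <= B by apply: le_trans h2 _; rewrite ler_piMr.
apply: le_trans (cexp_bound2 xB) _; rewrite -mulrA ler_wpM2l// -exprMn.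
by rewrite lerXn2r ?nnegrE ?mulr_ge0 ?cmod_ge0.
Qed.

(** The primary factor of genus two is 1 + O(x ^ 3): this is what makes the product
    for sigma converge. *)
Definition primary x : C := (1 - x) * cexp (x + x ^+ 2 / 2).

Lemma primary_bound (B : R) : 0 <= B -> exists2 K : R, 0 <= K &
  forall x, cmod x <= B -> cmod (primary x - 1) <= K * cmod x ^+ 3.
Proof.
move=> B0; pose B' := B * (1 + B / 2); pose k := 5 + 2 * expR B'.
have k0 : 0 <= k by rewrite addr_ge0// mulr_ge0// expR_ge0.
pose A := 1 + (1 + B) * (1 + B); pose K := (1 + B) * (k * (1 + B / 2) ^+ 3).
have q0 : 0 <= 1 + B / 2 by rewrite addr_ge0// divr_ge0.
have K0 : 0 <= K by rewrite mulr_ge0 ?addr_ge0// mulr_ge0// exprn_ge0.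
exists (A + K); first by rewrite addr_ge0// addr_ge0// mulr_ge0 ?addr_ge0.
move=> x xB; set t := cmod x in xB *; have t0 : 0 <= t := cmod_ge0 _.
set y := x + x ^+ 2 / 2.
have x1 : cmod (1 - x) <= 1 + B.
  by apply: le_trans (cmodD _ _) _; rewrite cmodN cmod1 lerD2l.
have half : cmod (2^-1 : C) = 2^-1 by rewrite cmodV cmod_nat.
have ty : cmod y <= t * (1 + B / 2).
  apply: le_trans (cmodD _ _) _; rewrite cmodM cmodX half -/t mulrDr mulr1 lerD2l.
  by rewrite expr2 -mulrA ler_wpM2l// ler_wpM2r.
have yB : cmod y <= B' by apply: le_trans ty _; rewrite /B' ler_wpM2r.
have Rb : cmod (cexp y - 1 - y - y ^+ 2 / 2) <= k * (1 + B / 2) ^+ 3 * t ^+ 3.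
  apply: le_trans (cexp_bound3 yB) _; rewrite -mulrA ler_wpM2l// -exprMn.
  by rewrite lerXn2r ?nnegrE ?mulr_ge0 ?cmod_ge0// mulrC.
have -> : primary x - 1 = x ^+ 3 * (- 1 + (1 - x) * (1 / 2 + x / 8)) +
  (1 - x) * (cexp y - 1 - y - y ^+ 2 / 2) by rewrite /primary -/y /y; field.
rewrite [X in _ <= X]mulrDl; apply: le_trans (cmodD _ _) _; apply: lerD.
  rewrite cmodM cmodX -/t mulrC ler_wpM2r ?exprn_ge0//.
  apply: le_trans (cmodD _ _) _; rewrite cmodN cmod1 lerD2l cmodM.
  apply: ler_pM; rewrite ?cmod_ge0//; apply: le_trans (cmodD _ _) _.
  rewrite !cmodM !cmodV cmod1 !cmod_nat -/t mul1r; lra.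
rewrite cmodM /K -mulrA; exact: ler_pM (cmod_ge0 _) (cmod_ge0 _) x1 Rb.
Qed.

Lemma primary0 : primary 0 = 1.
Proof. by rewrite /primary expr0n mul0r addr0 cexp0 subr0 mul1r. Qed.

End ComplexExponential.

(** * The product for sigma *)

Section SigmaProduct.
Variable R : realType.
Local Notation C := R[i].
Implicit Types (a u z h : C) (S : set C).

Definition sigma_factor u z : C := (1 - z / u) * cexp (z / u + z ^+ 2 / (2 * u ^+ 2)).
Definition sigma_prod S z := prod_over S (fun u => sigma_factor u z).

Lemma sigma_factorE u z : sigma_factor u z = primary (z / u).
Proof.
rewrite /sigma_factor /primary; congr (_ * cexp (_ + _)).
by rewrite [in RHS]exprMn exprVn -[RHS]mulrA -(invfM (u ^+ 2) 2) [2 * _]mulrC.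
Qed.

(** The increment of a factor is governed by the primary factor of a translated lattice
    point and by an exponential whose exponent is O(h / u ^ 3): its linear part is the
    term of zeta and its quadratic part half the term of - wp. *)
Lemma sigma_factor_mul a u h : u != 0 -> a - u != 0 ->
  let x := h / (a - u) in
  let m := h * (1 / (a - u) + 1 / u + a / u ^+ 2) - h ^+ 2 / 2 * (1 / (a - u) ^+ 2 - 1 / u ^+ 2) in
  sigma_factor u (a + h) = sigma_factor u a * (primary (- x) * cexp m).
Proof.
move=> u0 x0 x m; rewrite /sigma_factor /primary opprK.
have -> : 1 - (a + h) / u = (1 - a / u) * (1 + x) by rewrite /x; field; rewrite u0 x0.
have -> : (a + h) / u + (a + h) ^+ 2 / (2 * u ^+ 2) =
  (a / u + a ^+ 2 / (2 * u ^+ 2)) + ((- x + (- x) ^+ 2 / 2) + m).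
  by rewrite /m /x; field; rewrite u0 x0.
by rewrite !cexpD; ring.
Qed.

Section Ambient.
Variables (Lam : set C) (delta M : R).
Hypothesis amb : ambient Lam delta M.
Variable S : set C.
Hypothesis SL : S `<=` Lam `\ 0.

Let delta0 : 0 < delta. Proof. by case: amb. Qed.

Lemma multipliable_sigma z : multipliable S (fun u => sigma_factor u z).
Proof.
have B0 : 0 <= cmod z / delta by rewrite divr_ge0 ?cmod_ge0// ltW.
have [K K0 HK] := primary_bound B0.
have c0 : 0 <= K * cmod z ^+ 3 by rewrite mulr_ge0// exprn_ge0// cmod_ge0.
apply: (multipliable_le (m := fun u => K * cmod z ^+ 3 * cubic_weight Lam u) (M := K * cmod z ^+ 3 * M)).
- by case: amb => _ _ _; apply: majorisedZ.
- by move=> u; rewrite mulr_ge0// cubic_weight_ge0.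
- move=> u Su; rewrite sigma_factorE /cubic_weight mem_set; last exact: SL.
  have cu : cmod (z / u) = cmod z / cmod u by rewrite cmodM cmodV.
  apply: le_trans (HK _ _) _; last by rewrite cu expr_div_n mulrA.
  rewrite cu ler_wpM2l ?cmod_ge0// lef_pV2 ?posrE ?(amb_gt0 SL Su)//.
  exact: (amb_ge amb SL Su).
Qed.

Lemma sigma_prod0 : sigma_prod S 0 = 1.
Proof. by apply: prod_over1 => u _; rewrite sigma_factorE mul0r primary0. Qed.

Lemma sigma_prod_neq0 z : ~ S z -> sigma_prod S z != 0.
Proof.
move=> Sz; apply: prod_over_neq0; first exact: multipliable_sigma.
move=> u Su; have u0 := amb_neq0 SL Su.
rewrite mulf_neq0 ?cexp_neq0// subr_eq0; apply/eqP => zu; apply: Sz.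
by have -> : z = u by apply: (mulIf (invr_neq0 u0)); rewrite -zu mulfV.
Qed.

Lemma sigma_prod_eq0 z : S z -> sigma_prod S z = 0.
Proof.
move=> Sz; apply: (prod_over_eq0 (multipliable_sigma z) Sz).
by rewrite /sigma_factor divff ?subrr ?mul0r// (amb_neq0 SL Sz).
Qed.

(** The logarithmic derivative of sigma is zeta, apart from the factor z and the term 1 / z. *)
Lemma has_deriv_sigma_prod a (r : R) : 0 < r -> (forall u, S u -> 2 * r <= cmod (a - u)) ->
  has_deriv (sigma_prod S) a (wzeta_sum S a * sigma_prod S a).
Proof.
move=> r0 far; have r0' := ltW r0.
have au0 u : S u -> a - u != 0.
  by move=> /far; rewrite -cmod_gt0; apply: lt_le_trans; rewrite mulr_gt0.
pose c := 1 + cmod a / (2 * r); have c0 : 0 <= c by rewrite addr_ge0// divr_ge0 ?cmod_ge0// mulr_ge0.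
have Hc u : S u -> (cmod (a - u))^-1 <= c * (cmod u)^-1 by exact: (away_inv SL r0 far).
have [Kp Kp0 Hp] := wp_term_bound SL r0 far.
have [Kz Kz0 Hz] := wz_term_bound SL r0 far.
have h0 : 0 <= 1 / 2 :> R by rewrite divr_ge0.
have [K1 K10 H1] := primary_bound h0.
pose dl := delta ^- 3; have dl0 : 0 <= dl by rewrite invr_ge0 exprn_ge0// ltW.
pose A := Kz + r * Kp; have A0 : 0 <= A by rewrite addr_ge0// mulr_ge0.
pose B := r * A * dl; have B0 : 0 <= B by rewrite !mulr_ge0.
pose K2 := 1 + (5 + 2 * expR B) * B.
have K20 : 0 <= K2 by rewrite addr_ge0// mulr_ge0// addr_ge0// mulr_ge0// expR_ge0.
pose Ee := 1 + B + K2 * B ^+ 2.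
have Ee0 : 0 <= Ee by rewrite !addr_ge0// mulr_ge0// exprn_ge0.
pose k1 := K1 * c ^+ 3 * r * Ee; have k10 : 0 <= k1 by rewrite !mulr_ge0// exprn_ge0.
pose k2 := K2 * A ^+ 2 * dl; have k20 : 0 <= k2 by rewrite !mulr_ge0// exprn_ge0.
pose K := k1 + k2 + Kp + Kz; have K0 : 0 <= K by rewrite !addr_ge0.
pose zu u := 1 / (a - u) + 1 / u + a / u ^+ 2.
pose mm u h := h * zu u - h ^+ 2 / 2 * (1 / (a - u) ^+ 2 - 1 / u ^+ 2).
have wE u : S u -> cubic_weight Lam u = cmod u ^- 3.
  by move=> Su; rewrite /cubic_weight mem_set//; exact: SL.
apply: (prod_over_has_deriv (phi := fun u z => sigma_factor u z)
  (rho := fun u h => primary (- (h / (a - u))) * cexp (mm u h)) (b := zu)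
  (m := fun u => K * cubic_weight Lam u) (M := K * M) r0).
- by case: amb => _ _ _; apply: majorisedZ.
- by move=> u; rewrite mulr_ge0// cubic_weight_ge0.
- by move=> h _; exact: multipliable_sigma.
- by move=> u h Su hr; rewrite sigma_factor_mul// ?au0// (amb_neq0 SL Su).
- move=> u h Su hr; rewrite (wE _ Su).
  set t := cmod h in hr *; have t0 : 0 <= t := cmod_ge0 _.
  have u0 := amb_gt0 SL Su; set W := cmod u ^- 3.
  have W0 : 0 <= W by rewrite invr_ge0 exprn_ge0// cmod_ge0.
  have Wd : W <= dl.
    rewrite lef_pV2 ?posrE ?exprn_gt0// lerXn2r ?nnegrE ?cmod_ge0 ?(ltW delta0)//.
    exact: (amb_ge amb SL Su).
  set x := - (h / (a - u)); set m := mm u h.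
  have xE : cmod x = t * (cmod (a - u))^-1 by rewrite cmodN cmodM cmodV.
  have x12 : cmod x <= 1 / 2.
    have au := far u Su; have au1 : 0 < cmod (a - u) by rewrite cmod_gt0 au0.
    by rewrite xE ler_pdivrMr//; lra.
  have xc : cmod x ^+ 3 <= c ^+ 3 * r * (t ^+ 2 * W).
    apply: le_trans (_ : (t * (c * (cmod u)^-1)) ^+ 3 <= _).
      by rewrite xE lerXn2r ?nnegrE ?mulr_ge0 ?invr_ge0 ?cmod_ge0// ler_wpM2l ?Hc.
    have -> : (t * (c / cmod u)) ^+ 3 = c ^+ 3 * t * (t ^+ 2 * W) by rewrite !exprMn exprVn /W; ring.
    by rewrite ler_wpM2r ?mulr_ge0 ?exprn_ge0// ler_wpM2l ?exprn_ge0.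
  have half : cmod (2^-1 : C) = 2^-1 by rewrite cmodV cmod_nat.
  have q : cmod (h ^+ 2 / 2 * (1 / (a - u) ^+ 2 - 1 / u ^+ 2)) <= Kp * W * t ^+ 2.
    rewrite cmodM (cmodM (h ^+ 2)) half cmodX -/t mulrC; apply: ler_pM; rewrite ?cmod_ge0 ?mulr_ge0 ?exprn_ge0 ?Hp//.
    by rewrite ler_piMr ?exprn_ge0// invf_le1// ler1n.
  have mz : cmod (m - zu u * h) <= Kp * W * t ^+ 2.
    have -> : m - zu u * h = - (h ^+ 2 / 2 * (1 / (a - u) ^+ 2 - 1 / u ^+ 2)) by rewrite /m /mm; ring.
    by rewrite cmodN.
  have ma : cmod m <= t * (A * W).
    apply: le_trans (cmodD _ _) _; rewrite cmodN cmodM -/t.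
    apply: le_trans (_ : t * (Kz * W) + Kp * W * t ^+ 2 <= _).
      by rewrite lerD// ler_wpM2l// Hz.
    have -> : t * (A * W) = t * (Kz * W) + Kp * W * (t * r) by rewrite /A; ring.
    by rewrite lerD2l ler_wpM2l ?mulr_ge0// expr2 ler_wpM2l.
  have mB : cmod m <= B.
    apply: le_trans ma _; rewrite /B -mulrA; apply: ler_pM; rewrite ?mulr_ge0//.
    by rewrite ler_wpM2l.
  have m2 : cmod (cexp m - 1 - m) <= k2 * W * t ^+ 2.
    apply: le_trans (cexp_bound2 mB) _; rewrite -/K2.
    apply: le_trans (_ : K2 * (t * (A * W)) ^+ 2 <= _).
      by rewrite ler_wpM2l// lerXn2r ?nnegrE ?mulr_ge0 ?cmod_ge0.
    have -> : K2 * (t * (A * W)) ^+ 2 = K2 * A ^+ 2 * W * (W * t ^+ 2) by ring.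
    rewrite -[X in _ <= X]mulrA; apply: ler_wpM2r; first by rewrite mulr_ge0// exprn_ge0.
    by apply: ler_wpM2l => //; rewrite mulr_ge0// exprn_ge0.
  have eB : cmod (cexp m) <= Ee.
    have -> : cexp m = 1 + m + (cexp m - 1 - m) by ring.
    apply: le_trans (cmodD _ _) _; apply: lerD.
      by apply: le_trans (cmodD _ _) _; rewrite cmod1 lerD2l.
    apply: le_trans (cexp_bound2 mB) _; rewrite -/K2 ler_wpM2l//.
    by rewrite lerXn2r ?nnegrE ?cmod_ge0.
  have -> : primary x * cexp m - 1 - zu u * h =
    (primary x - 1) * cexp m + (cexp m - 1 - m) + (m - zu u * h) by ring.
  have -> : K * W * t ^+ 2 = k1 * W * t ^+ 2 + k2 * W * t ^+ 2 + Kp * W * t ^+ 2 + Kz * W * t ^+ 2.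
    by rewrite /K; ring.
  apply: le_trans (cmodD _ _) _; rewrite -[X in X <= _]addr0.
  apply: lerD; last by rewrite !mulr_ge0// exprn_ge0.
  apply: lerD => //; apply: le_trans (cmodD _ _) _; apply: lerD => //.
  rewrite cmodM; have -> : k1 * W * t ^+ 2 = K1 * (c ^+ 3 * r * (t ^+ 2 * W)) * Ee by rewrite /k1; ring.
  apply: ler_pM; rewrite ?cmod_ge0//; apply: le_trans (H1 _ x12) _.
  by rewrite ler_wpM2l.
- move=> u Su; rewrite (wE _ Su); apply: le_trans (Hz u Su) _.
  by rewrite ler_wpM2r ?invr_ge0 ?exprn_ge0 ?cmod_ge0// lerDr !addr_ge0.
Qed.

End Ambient.
End SigmaProduct.

(** * The identity for sigma *)

Section SigmaIsogeny.
Variable R : realType.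
Local Notation C := R[i].
Implicit Types (a u v z : C).
Variables (Lam : set C) (delta M : R).
Hypothesis amb : ambient Lam delta M.
Variables (L : set C) (w : C).
Hypotheses (subL : subgroup L) (LLam : L `<=` Lam) (wLam : Lam w) (Lw : ~ L w) (Lww : L (w + w)).
Variable rho : R.
Hypothesis cocompact : forall z : C, exists2 u : C, L u & cmod (z - u) <= rho.
Local Notation L0 := (L `\ 0).
Local Notation D := (coset L w).
Local Notation G := [set u | L u \/ D u].
(* The plane punctured at G but not at 0 is connected. *)
Hypothesis off_cst : forall f : C -> C, (forall z, z = 0 \/ ~ G z -> has_deriv f z 0) ->
  forall z, ~ G z -> f z = f 0.
Local Notation e := (half_value L w).
Local Notation p := (wp_gap L w).

Let has_deriv_eq f a d d' : d = d' -> has_deriv f a d -> has_deriv f a d'. Proof. by move=> ->. Qed.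

Let GLam : G `\ 0 `<=` Lam `\ 0.
Proof.
move=> u [/= [Lu|Du] u0]; first by split => //; exact: LLam.
by apply: (coset_Lam amb subL LLam wLam Lw Lww).
Qed.

Let G0E : G `\ 0 = L0 `|` D := union_coset0 subL Lw.

Let wz_at0 (S : set C) : wzeta_sum S 0 = 0.
Proof.
rewrite /wzeta_sum (eq_sum_over (g := fun=> 0)) ?sum_over0// => u _.
by rewrite sub0r invrN mulrN addNr mul0r addr0.
Qed.

(** The product ratio = z ^ 2 wp_gap sigma_quot is the quotient of the two sides of the
    identity for sigma, with the factors z of the sigma functions cancelled. Its logarithmic
    derivative is 2 / z + 2 zeta_gap + 4 wzeta_L + 2 e z - 2 wzeta_G = 0, by wp_gap_ode, where
    wzeta_L and wzeta_G stand for the series without the terms 1 / z. It equals 1 at 0. *)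
Let sigma_quot z := sigma_prod L0 z * sigma_prod L0 z * (sigma_prod L0 z * sigma_prod L0 z) *
  cexp (e * (z * z)) * (sigma_prod (G `\ 0) z * sigma_prod (G `\ 0) z)^-1.

Let has_deriv_quot a (r : R) : 0 < r -> (forall u, (G `\ 0) u -> 2 * r <= cmod (a - u)) ->
  has_deriv sigma_quot a ((4 * wzeta_sum L0 a + 2 * e * a - 2 * wzeta_sum (G `\ 0) a) * sigma_quot a).
Proof.
move=> r0 far; have r20 : 0 < 2 * r by rewrite mulr_gt0.
have farL u : L0 u -> 2 * r <= cmod (a - u) by move=> Lu; apply: far; rewrite G0E; left.
have Ga : ~ (G `\ 0) a by move=> /far; rewrite subrr cmod0 leNgt r20.
have sn : sigma_prod (G `\ 0) a != 0 by exact: (sigma_prod_neq0 amb GLam Ga).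
have dL := has_deriv_sigma_prod amb (L0_Lam LLam) r0 farL; have dL2 := has_derivM dL dL.
have dG := has_deriv_sigma_prod amb GLam r0 far.
have dE := has_deriv_cexp (has_derivZ e (has_derivM (has_deriv_id a) (has_deriv_id a))).
have dG2 := has_derivM dG dG; have dV := has_derivV (mulf_neq0 sn sn : (fun z => sigma_prod (G `\ 0) z * sigma_prod (G `\ 0) z) a != 0) dG2.
apply: has_deriv_eq (has_derivM (has_derivM (has_derivM dL2 dL2) dE) dV).
by rewrite /sigma_quot; field.
Qed.

Let ratio z := (if z == 0 then 1 else z * z * p z) * sigma_quot z.

Let ratio_off a : ~ G a -> has_deriv ratio a 0.
Proof.
move=> Ga; have a0 : a != 0.
  by apply/eqP => a0; apply: Ga; rewrite a0; left; exact: (subgroup0 subL).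
have [La Da] : ~ L a /\ ~ D a by split => ?; apply: Ga; [left|right].
have [r r0 far] := ambient_far amb subL LLam wLam Lw Lww Ga.
have far0 u : (G `\ 0) u -> 2 * r <= cmod (a - u) by case=> Gu _; apply: far.
have dX := has_deriv_quot r0 far0; have [N J] := jet_wp_gap amb subL LLam r0 far.
have dp := jet_has_deriv r0 J.
have wzGE : wzeta_sum (G `\ 0) a = wzeta_sum L0 a + wzeta_sum D a.
  rewrite /wzeta_sum G0E sum_overU//.
  - exact: (summ_wzeta amb LLam La).
  - exact: (summ_wzeta_coset amb subL LLam wLam Lw Lww Da).
  - by move=> u [Lu _] /(coset_notL subL Lw).
apply: (has_deriv_ext (f := fun z => z * z * p z * sigma_quot z) r0) => [h hr|].
  rewrite /ratio ifN//; apply: contra_notN (off_G r0 far hr) => /eqP ->; left; exact: (subgroup0 subL).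
apply: has_deriv_eq (has_derivM (has_derivM (has_derivM (has_deriv_id a) (has_deriv_id a)) dp) dX).
have -> : (1 * a + a * 1) * p a + a * a * dwp_gap L a = a * a * p a * (2 / a + 2 * zeta_gap L w a).
  by rewrite (wp_gap_ode amb subL LLam wLam Lw Lww cocompact Ga); field.
by rewrite wzGE /zeta_gap wzetaE; field.
Qed.

Let ratio_0 : has_deriv ratio 0 0.
Proof.
have [_ delta0 _ _] := amb.
have d2 : 0 < delta / 2 by rewrite divr_gt0.
have d4 : 0 < delta / 4 by rewrite divr_gt0.
have far u : (G `\ 0) u -> 2 * (delta / 4) <= cmod (0 - u).
  by move=> Gu; rewrite sub0r cmodN; have := amb_ge amb GLam Gu; lra.
have dX := has_deriv_quot d4 far; move: dX; rewrite !wz_at0 !mulr0 addr0 subr0 mul0r => dX.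
have [N [d J]] := jet_wp_reg amb (L0_Lam LLam) (L0N subL).
have dpi : has_deriv (wp_reg L0) 0 d.
  by apply: (jet_has_deriv d2 (N := N)); apply: jet_ext (ltW d2) _ J => h _; rewrite add0r.
have dz := has_derivM (has_deriv_id (0 : C)) (has_deriv_id (0 : C)).
have dF := has_derivM (has_derivD (has_derivB (has_deriv_cst 1 (0 : C)) (has_derivZ e dz)) (has_derivM (has_derivM dz dz) dpi)) dX.
apply: (has_deriv_ext d2 _ (has_deriv_eq _ dF)) => [h hr|]; last by ring.
rewrite add0r /ratio; congr (_ * _).
case: eqP => [->|/eqP h0]; first by rewrite !mulr0 !mul0r subr0 addr0.
by rewrite (wp_gap_near0 amb w subL LLam h0 hr); field.
Qed.

Let ratio1 z : ~ G z -> ratio z = 1.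
Proof.
move=> Gz; rewrite (off_cst _ Gz); last by move=> ? [->|]; [exact: ratio_0|exact: ratio_off].
rewrite /ratio eqxx /sigma_quot !sigma_prod0 !mulr0 cexp0 !mulr1 invr1 ?mulr1 //=.
Qed.

(** A zero would annihilate a function that is identically 1. *)
Lemma wp_gap_neq0 z : ~ G z -> p z != 0.
Proof.
move=> Gz; apply/eqP => p0; have := ratio1 Gz; rewrite /ratio ifN.
  by rewrite p0 mulr0 mul0r => /esym/eqP; rewrite oner_eq0.
by apply/eqP => z0; apply: Gz; rewrite z0; left; exact: (subgroup0 subL).
Qed.

Lemma sigma_isogeny z : ~ L z -> weierstrass_sigma G z ^+ 2 =
  cexp (e * z ^+ 2) * p z * weierstrass_sigma L z ^+ 4.
Proof.
have sgE S : weierstrass_sigma S z = z * sigma_prod (S `\ 0) z by [].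
move=> Lz; have z0 : z != 0 by exact: (notL_neq0 subL).
rewrite !sgE.
have [Gz|Gz] := pselect (G z).
  have Dz : D z by case: Gz => // /Lz.
  rewrite (sigma_prod_eq0 amb GLam); last by split => //; exact/eqP.
  have -> : p z = 0.
    have -> : z = w + (z - w) by ring.
    by rewrite (wp_gap_periodic amb w subL LLam Dz Lw) /wp_gap subrr.
  by rewrite !mulr0 mul0r expr0n.
have := ratio1 Gz; rewrite /ratio ifN// /sigma_quot.
have sn : sigma_prod (G `\ 0) z != 0 by apply: (sigma_prod_neq0 amb GLam) => -[].
move=> H; have -> : (z * sigma_prod (G `\ 0) z) ^+ 2 = (z * sigma_prod (G `\ 0) z) ^+ 2 * 1 by rewrite mulr1.
by rewrite -[X in _ * X = _]H expr2; field.
Qed.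

End SigmaIsogeny.

(** * Lattices spanned by a real basis of the plane *)

Section RealBasis.
Variable R : realType.
Local Notation C := R[i].
Implicit Types (z : C) (m n : int).

Definition det2 (u v : C) : R := complex.Re u * complex.Im v - complex.Im u * complex.Re v.

Lemma det2_bound u v : `|det2 u v| <= 2 * cmod u * cmod v.
Proof.
apply: le_trans (ler_normB _ _) _; rewrite !normrM -mulrA mulr_natl mulr2n.
by apply: lerD; apply: ler_pM; rewrite ?normr_ge0 ?cmod_Re ?cmod_Im.
Qed.

Section Basis.
Variables a b : C.
Hypothesis ab : det2 a b != 0.

Definition real_comb (x y : R) : C := x%:C * a + y%:C * b.

Lemma det2_linl x y : det2 (real_comb x y) b = x * det2 a b.
Proof. rewrite /det2 /real_comb; case: a b => [a1 a2] [b1 b2] /=; ring. Qed.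

Lemma det2_linr x y : det2 a (real_comb x y) = y * det2 a b.
Proof. rewrite /det2 /real_comb; case: a b => [a1 a2] [b1 b2] /=; ring. Qed.

Lemma real_comb_inj x y x' y' : real_comb x y = real_comb x' y' -> x = x' /\ y = y'.
Proof.
move=> E; split; apply: (mulIf ab); first by rewrite -(det2_linl x y) E det2_linl.
by rewrite -(det2_linr x y) E det2_linr.
Qed.

Lemma real_comb_surj z : exists x y, z = real_comb x y.
Proof.
exists (det2 z b / det2 a b), (det2 a z / det2 a b); move: ab.
rewrite /det2 /real_comb; case: a b z => [a1 a2] [b1 b2] [z1 z2] /= d0.
by apply/eqP; rewrite eq_complex /=; apply/andP; split; apply/eqP; field.
Qed.

(** By Cramer's rule the coordinates are bounded by a multiple of the modulus. *)
Lemma real_comb_bound : exists2 k : R, 0 < k & forall x y, k * (`|x| + `|y|) <= cmod (real_comb x y).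
Proof.
have a0 : 0 < cmod a.
  by rewrite cmod_gt0; apply: contraNneq ab => ->; rewrite /det2 !mul0r subrr.
have d0 : 0 < `|det2 a b| by rewrite normr_gt0.
have s0 : 0 < 2 * (cmod a + cmod b) by rewrite mulr_gt0// ltr_pwDl// cmod_ge0.
exists (`|det2 a b| / (2 * (cmod a + cmod b))); first by rewrite divr_gt0.
move=> x y; rewrite mulrAC ler_pdivrMr// mulrDr.
have := det2_bound (real_comb x y) b; have := det2_bound a (real_comb x y).
rewrite det2_linl det2_linr !normrM; lra.
Qed.

Definition zspan : set C := [set a *~ m + b *~ n | m in [set: int] & n in [set: int]].

Lemma zlinE m n : a *~ m + b *~ n = real_comb m%:~R n%:~R.
Proof. by rewrite /real_comb -(mulrzl a) -(mulrzl b) !rmorph_int. Qed.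

Lemma zspanP z : zspan z <-> exists m n, z = real_comb m%:~R n%:~R.
Proof.
split; first by case=> m _ [n _ <-]; exists m, n; exact: zlinE.
by case=> m [n ->]; exists m => //; exists n => //; exact: zlinE.
Qed.

Lemma zspan_subgroup : subgroup zspan.
Proof.
split; first by exists 0 => //; exists 0 => //; rewrite !mulr0z addr0.
move=> _ _ [m _ [n _ <-]] [m' _ [n' _ <-]]; exists (m - m') => //; exists (n - n') => //.
by rewrite !mulrzBr; ring.
Qed.

Lemma zspan_cobounded z : exists2 u, zspan u & cmod (z - u) <= cmod a + cmod b.
Proof.
have [x [y ->]] := real_comb_surj z.
have fl (t : R) : `|t - (Num.floor t)%:~R| <= 1.
  have /andP[t1 /ltW t2] := floor_itv t.
  by rewrite ger0_norm ?subr_ge0// lerBlDl; move: t2; rewrite intrD.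
exists (real_comb (Num.floor x)%:~R (Num.floor y)%:~R); first by apply/zspanP; do 2 eexists.
have -> : real_comb x y - real_comb (Num.floor x)%:~R (Num.floor y)%:~R =
  (x - (Num.floor x)%:~R)%:C * a + (y - (Num.floor y)%:~R)%:C * b by rewrite /real_comb !rmorphB /=; ring.
apply: le_trans (cmodD _ _) _; rewrite !cmodM !cmod_real.
by apply: lerD; rewrite ler_piMl ?cmod_ge0.
Qed.

(** The complement of a lattice is connected by polygons with sides parallel to the
    basis, ending with a half-diagonal that meets the lattice only at 0. *)
Lemma zspan_off_cst (f : C -> C) : (forall z, z = 0 \/ ~ zspan z -> has_deriv f z 0) ->
  forall z, ~ zspan z -> f z = f 0.
Proof.
move=> Hf; pose isint (x : R) := exists m, x = m%:~R.
have off x y : (x = 0 /\ y = 0) \/ ~ isint x \/ ~ isint y -> has_deriv f (real_comb x y) 0.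
  move=> H; apply: Hf; case: H => [[-> ->]|H]; first by left; rewrite /real_comb !mul0r addr0.
  right=> /zspanP[m [n /real_comb_inj[xm yn]]]; case: H; apply; [by exists m|by exists n].
have seg x0 y0 x1 y1 : (forall t : R, 0 <= t <= 1 ->
    let x := x0 + t * (x1 - x0) in let y := y0 + t * (y1 - y0) in
    (x = 0 /\ y = 0) \/ ~ isint x \/ ~ isint y) -> f (real_comb x1 y1) = f (real_comb x0 y0).
  move=> H; apply: has_deriv_segment_cst => t t01; have := off _ _ (H t t01); congr has_deriv.
  by rewrite /real_comb !rmorphD !rmorphM !rmorphB /=; ring.
have frac_int (x : R) : 0 < x -> x < 1 -> ~ isint x.
  move=> x0 x1 [m xm]; move: x0 x1; rewrite xm ltr0z ltrz1.
  by case: m {xm} => [[|[|n]]|n].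
have half_int : ~ isint 2^-1 by apply: frac_int; [rewrite invr_gt0|rewrite invf_lt1// ltr1n].
move=> z Gz; have [x [y zE]] := real_comb_surj z.
have diag : f (real_comb 2^-1 2^-1) = f 0.
  rewrite (_ : 0 = real_comb 0 0); last by rewrite /real_comb !mul0r addr0.
  apply: seg => t /andP[t0 t1] /=; rewrite !add0r !subr0.
  have [->|tn0] := eqVneq t 0; first by left; rewrite mul0r.
  have tp : 0 < t by rewrite lt_neqAle eq_sym tn0.
  by right; left; apply: frac_int; lra.
have cst (s t : R) : s + t * (s - s) = s by rewrite subrr mulr0 addr0.
have [xi|yi] : ~ isint x \/ ~ isint y.
  have [ix|] := pselect (isint x); last by left.
  have [iy|] := pselect (isint y); last by right.
  by exfalso; apply: Gz; case: ix iy zE => m -> [n ->] ->; apply/zspanP; exists m, n.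
- rewrite zE (seg x 2^-1) => [|t _ /=]; last by right; left; rewrite cst.
  by rewrite (seg 2^-1 2^-1) => [//|t _ /=]; right; right; rewrite cst.
- rewrite zE (seg 2^-1 y) => [|t _ /=]; last by right; right; rewrite cst.
  by rewrite (seg 2^-1 2^-1) => [//|t _ /=]; right; left; rewrite cst.
Qed.

End Basis.
End RealBasis.

(** * Convergence of the sum of the inverse cubes *)

Section LatticeSums.
Variable R : realType.
Local Notation C := R[i].

Let cube_step (k : R) : 1 <= k -> k ^- 3 <= 2 * (k ^- 2 - (k + 1) ^- 2).
Proof.
move=> k1; have k0 : 0 < k by lra.
have k0' : 0 < k + 1 by lra.
have -> : 2 * (k ^- 2 - (k + 1) ^- 2) = k ^- 3 * (2 * k * (2 * k + 1) / (k + 1) ^+ 2).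
  by field; rewrite !gt_eqF.
rewrite ler_peMr ?invr_ge0 ?exprn_ge0 ?(ltW k0)// ler_pdivlMr ?exprn_gt0// mul1r; nra.
Qed.

Let square_step (k : R) : 1 <= k -> k ^- 2 <= 2 * (k^-1 - (k + 1)^-1).
Proof.
move=> k1; have k0 : 0 < k by lra.
have k0' : 0 < k + 1 by lra.
have -> : 2 * (k^-1 - (k + 1)^-1) = k ^- 2 * (2 * k / (k + 1)) by field; rewrite !gt_eqF.
by rewrite ler_peMr ?invr_ge0 ?exprn_ge0 ?(ltW k0)// ler_pdivlMr// mul1r; lra.
Qed.

Let telescope_le (f F : nat -> R) c : 0 <= c -> (forall n, 0 <= F n) ->
  (forall n, f n <= c * (F n - F n.+1)) -> forall N, \sum_(n < N) f n <= c * F 0%N.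
Proof.
move=> c0 F0 fF N; apply: le_trans (_ : c * (F 0%N - F N) <= _).
  elim: N => [|N IH]; first by rewrite big_ord0 subrr mulr0.
  by rewrite big_ord_recr /=; have := fF N; lra.
by rewrite ler_wpM2l// gerBl.
Qed.

(** The double series of inverse cubes converges, by telescoping in each variable. *)
Lemma inverse_cubes_bound N : \sum_(m < N) \sum_(n < N) (m + n + 1)%:R ^- 3 <= 4 :> R.
Proof.
have n1 n : 1 <= n.+1%:R :> R by rewrite ler1n.
have S1 m : \sum_(n < N) (m + n + 1)%:R ^- 3 <= 2 * m.+1%:R ^- 2 :> R.
  have := telescope_le (f := fun n => (m + n + 1)%:R ^- 3) (F := fun n => (m + n).+1%:R ^- 2) (c := 2).
  rewrite addn0; apply => // n.
  by rewrite addn1 addnS -[(m + n).+2]addn1 natrD; exact: cube_step.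
apply: le_trans (ler_sum _ (fun (m : 'I_N) _ => S1 m)) _.
rewrite -mulr_sumr (_ : 4 = 2 * (2 * 1%:R^-1)); last by rewrite invr1; ring.
rewrite ler_pM2l//; have := telescope_le (f := fun n => n.+1%:R ^- 2) (F := fun n => n.+1%:R^-1) (c := 2).
apply => // n.
by rewrite -[n.+2]addn1 natrD; exact: square_step.
Qed.

Let sum_delta (A : {fset C}) (x : C) : \sum_(u <- A) (u == x)%:R <= 1 :> R.
Proof.
rewrite -natr_sum -[X in _ <= X]/(1%:R) ler_nat.
rewrite -(big_mkcond (fun u => u == x) (fun=> 1%N)) /= sum1_count count_uniq_mem ?fset_uniq//.
by case: (_ \in _).
Qed.

Section Basis.
Variables a b : C.
Hypothesis ab : det2 a b != 0.

Let sgn_nat (m : int) : exists s : bool, exists n : nat, m%:~R = (-1) ^+ s * n%:R :> R.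
Proof.
case: m => n; first by exists false, n; rewrite mul1r.
by exists true, n.+1; rewrite NegzE mulrNz mulN1r.
Qed.

(** A nonzero point with coordinates m and n has modulus at least a multiple of
    |m| + |n| + 1, and the signs of m and n leave four points for each |m| and |n|. *)
Lemma zspan_ambient : exists delta M, ambient (zspan a b) delta M.
Proof.
have [k k0 Hk] := real_comb_bound ab; have k2 : 0 < k / 2 by rewrite divr_gt0.
pose pt (i : (bool * bool) * (nat * nat)) :=
  real_comb a b ((-1) ^+ i.1.1 * i.2.1%:R) ((-1) ^+ i.1.2 * i.2.2%:R).
have ptk i : k * (i.2.1 + i.2.2)%:R <= cmod (pt i).
  by apply: le_trans (Hk _ _); rewrite !normrM !normrX !normrN !normr1 !expr1n !mul1r !normr_nat natrD.
have span_pt u : zspan a b u -> exists i, u = pt i.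
  move=> /zspanP[m [n ->]]; have [s [p ->]] := sgn_nat m; have [s' [q ->]] := sgn_nat n.
  by exists ((s, s'), (p, q)).
have pt0 i : pt i != 0 -> (0 < i.2.1 + i.2.2)%N.
  by rewrite lt0n; apply: contraNneq => /eqP; rewrite addn_eq0 => /andP[/eqP m0 /eqP n0];
    rewrite /pt m0 n0 !mulr0 /real_comb !mul0r addr0.
(* On nonzero points m + n + 1 <= 2 (m + n). *)
have ptk2 i : pt i != 0 -> k / 2 * (i.2.1 + i.2.2 + 1)%:R <= cmod (pt i).
  move=> /pt0; rewrite -(ler_nat R) => h; apply: le_trans (ptk i).
  by rewrite -mulrA ler_pM2l// natrD; lra.
exists k, ((k / 2) ^- 3 * 16); split=> //; first exact: zspan_subgroup.
- move=> u /span_pt[i ->] i0; apply: le_trans (ptk i); rewrite ler_peMr ?(ltW k0)//.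
  by rewrite ler1n pt0.
move=> A; pose B := \sum_(u <- A) cmod u.
have uB u : u \in A -> cmod u <= B.
  by move=> uA; rewrite /B (big_fsetD1 u)//= lerDl sumr_ge0// => v _; exact: cmod_ge0.
pose N := (Num.trunc (B / k)).+1.
have tN (m : nat) : k * m%:R <= B -> (m < N)%N.
  rewrite mulrC -ler_pdivlMr// => mB; rewrite -(ltr_nat R); apply: le_lt_trans mB _.
  by rewrite truncnS_gt.
pose I : finType := ((bool * bool) * ('I_N * 'I_N))%type.
pose w (i : I) : R := (i.2.1 + i.2.2 + 1)%:R ^- 3.
pose pt' (i : I) := pt (i.1, (nat_of_ord i.2.1, nat_of_ord i.2.2)).
have w0 i : 0 <= w i by rewrite invr_ge0 exprn_ge0.
have kk : 0 <= (k / 2) ^- 3 by rewrite invr_ge0 exprn_ge0// ltW.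
have key u : u \in A -> cubic_weight (zspan a b) u <= \sum_(i : I) (u == pt' i)%:R * ((k / 2) ^- 3 * w i).
  move=> uA; rewrite /cubic_weight; case: ifPn => [/set_mem[/= /span_pt[i ui] /eqP u0]|_]; last first.
    by apply: sumr_ge0 => i _; rewrite mulr_ge0// mulr_ge0.
  have iB : k * (i.2.1 + i.2.2)%:R <= B by apply: le_trans (ptk i) _; rewrite -ui uB.
  have l1 : (i.2.1 < N)%N.
    by apply: tN; apply: le_trans iB; rewrite ler_pM2l// ler_nat leq_addr.
  have l2 : (i.2.2 < N)%N.
    by apply: tN; apply: le_trans iB; rewrite ler_pM2l// ler_nat leq_addl.
  rewrite (bigD1 ((i.1, (Ordinal l1, Ordinal l2)) : I))//=.
  have -> : pt' (i.1, (Ordinal l1, Ordinal l2)) = u by rewrite ui.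
  rewrite eqxx mul1r ler_wpDr//; first by apply: sumr_ge0 => j _; rewrite mulr_ge0// mulr_ge0.
  rewrite /w /= -invfM -exprMn lef_pV2 ?posrE ?exprn_gt0 ?mulr_gt0 ?cmod_gt0 ?ltr0n ?addn1//.
  have := ptk2 i; rewrite -ui addn1 => /(_ u0) ku.
  by rewrite lerXn2r// nnegrE ?cmod_ge0// mulr_ge0// ltW.
apply: le_trans (_ : \sum_(u <- A) \sum_(i : I) (u == pt' i)%:R * ((k / 2) ^- 3 * w i) <= _).
  by rewrite big_seq_cond [X in _ <= X]big_seq_cond; apply: ler_sum => u /andP[uA _]; exact: key.
rewrite exchange_big /=.
apply: le_trans (_ : \sum_(i : I) (k / 2) ^- 3 * w i <= _).
  apply: ler_sum => i _; rewrite -mulr_suml ler_piMl ?mulr_ge0//; exact: sum_delta.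
rewrite -mulr_sumr ler_wpM2l//.
rewrite -(pair_bigA _ (fun (s : bool * bool) (j : 'I_N * 'I_N) => (j.1 + j.2 + 1)%:R ^- 3)) /=.
rewrite sumr_const card_prod card_bool.
rewrite -(pair_bigA _ (fun (m n : 'I_N) => (m + n + 1)%:R ^- 3)) /=.
have := inverse_cubes_bound N; rewrite -(@ler_pMn2r _ 4)// => /le_trans; apply.
by lra.
Qed.

End Basis.
End LatticeSums.

(** * Discrete groups of rank two *)

Section LatticeBasis.
Variable R : realType.
Local Notation C := R[i].

(** Dirichlet's approximation, by the pigeonhole principle for the fractional parts
    of the multiples of t. *)
Lemma dirichlet (t : R) N : exists n m : int, n != 0 /\ `|n%:~R * t + m%:~R| < N.+1%:R^-1.
Proof.
pose fl i : int := Num.floor (i%:R * t); pose fr i : R := i%:R * t - (fl i)%:~R.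
have fr01 i : 0 <= fr i < 1.
  by have := floor_itv (i%:R * t); rewrite -/(fl i) intrD /fr; lra.
have Nfr i : 0 <= N.+1%:R * fr i by rewrite mulr_ge0//; case/andP: (fr01 i).
pose box i := Num.trunc (N.+1%:R * fr i).
have boxN i : (box i <= N)%N.
  rewrite -ltnS -(ltr_nat R); have /andP[h _] := truncn_itv (Nfr i); apply: le_lt_trans h _.
  by rewrite -[X in _ < X]mulr1 ltr_pM2l//; case/andP: (fr01 i).
pose f (i : 'I_N.+2) : 'I_N.+1 := inord (box i).
have /injectivePn[i [j ij fij]] : ~~ injectiveb f.
  by apply/injectiveP => /leq_card; rewrite !card_ord ltnn.
have bij : box i = box j by have := congr1 val fij; rewrite /= !inordK// ltnS.
exists (i%:Z - j%:Z), (fl j - fl i); split.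
  by rewrite subr_eq0 eqz_nat; apply: contra ij => /eqP /val_inj ->.
have -> : (i%:Z - j%:Z)%:~R * t + (fl j - fl i)%:~R = fr i - fr j :> R.
  by rewrite !intrB /fr; ring.
have N0 : 0 < N.+1%:R :> R by [].
rewrite -(ltr_pM2l N0) divff// -[X in X * `|_|]ger0_norm// -normrM mulrBr.
have := truncn_itv (Nfr i); have := truncn_itv (Nfr j); rewrite -/(box i) -/(box j) bij -natr1.
by rewrite ltr_norml; lra.
Qed.

(** In a discrete group of rank two a basis over the integers is a basis over the reals:
    otherwise two generators are proportional and small combinations accumulate at 0. *)
Lemma lattice_basis (G : set C) : lattice G -> exists a b, det2 a b != 0 /\ G = zspan a b.
Proof.
move=> [[G0 _] dG [a [b [ab GE]]]]; exists a, b; split => //.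
have /dG[_ [V V0 VG]] := G0.
have [r r0 Hr] : exists2 r : R, 0 < r & forall z, cmod z < r -> V z.
  have /nbhs_ballP[e /= e0 He] := V0; exists (complex.Re e).
    by move: e0; rewrite ltcE => /andP[].
  move=> z zr; apply: He; rewrite -ball_normE /= sub0r normrN -cmodE.
  by have <- : (complex.Re e)%:C = e; [rewrite RRe_real// gtr0_real|rewrite ltcR].
have G_small z : G z -> cmod z < r -> z = 0.
  by move=> Gz /Hr Vz; have : (V `&` G) z by []; rewrite VG.
apply/eqP => d0.
have a0 : a != 0.
  by apply/eqP => a0; have [] := ab 1 0; rewrite // a0 mul0rz mulr0z addr0.
have [t bt] : exists t : R, b = t%:C * a.
  have s0 : complex.Re a ^+ 2 + complex.Im a ^+ 2 != 0 by rewrite -cmod_sqr expf_neq0// cmod_eq0.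
  exists ((complex.Re b * complex.Re a + complex.Im b * complex.Im a) / (complex.Re a ^+ 2 + complex.Im a ^+ 2)).
  move: d0 s0; rewrite /det2; case: (a) (b) => [a1 a2] [b1 b2] /= d0 s0.
  have E1 : a1 * b2 = a2 * b1 by apply/eqP; rewrite -subr_eq0 d0.
  apply/eqP; rewrite eq_complex /=; apply/andP; split; apply/eqP; rewrite mul0r ?subr0 ?addr0;
    rewrite mulrAC; apply: (canRL (mulfK s0)).
    have -> : (b1 * a1 + b2 * a2) * a1 = b1 * a1 ^+ 2 + (a1 * b2) * a2 by ring.
    by rewrite E1; ring.
  have -> : (b1 * a1 + b2 * a2) * a2 = b2 * a2 ^+ 2 + (a2 * b1) * a1 by ring.
  by rewrite -E1; ring.
pose N := Num.trunc (cmod a / r).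
have Na : N.+1%:R^-1 * cmod a < r.
  have a0' : 0 < cmod a by rewrite cmod_gt0.
  by rewrite ltr_pdivrMl// -ltr_pdivrMr// truncnS_gt.
have [n [m [n0 nm]]] := dirichlet t N.
have z0 : a *~ m + b *~ n = 0.
  apply: G_small; first by rewrite GE; exists m => //; exists n.
  have -> : a *~ m + b *~ n = (n%:~R * t + m%:~R)%:C * a.
    rewrite -(mulrzl a) -(mulrzl b) bt rmorphD rmorphM /= !rmorph_int; ring.
  by rewrite cmodM cmod_real; apply: lt_trans Na; rewrite ltr_pM2r// cmod_gt0.
by have [_ nz] := ab _ _ z0; rewrite nz eqxx in n0.
Qed.

End LatticeBasis.

(** * Roots of the cubic and subgroups of index two *)

Section Roots.
Variable R : realType.
Local Notation C := R[i].
Implicit Types (G H : set C).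

(** The coefficients are finite differences of the values at 2, 1, 0 and - 1. *)
Lemma cubic_roots_vieta G (x1 x2 x3 : C) : cubic_roots (weierstrass_cubic G) x1 x2 x3 ->
  [/\ x1 + x2 + x3 = 0, weierstrass_g2 G = - 4 * (x1 * x2 + x1 * x3 + x2 * x3)
    & weierstrass_g3 G = 4 * (x1 * x2 * x3)].
Proof.
rewrite /cubic_roots; set l := lead_coef _ => E.
set g2 := weierstrass_g2 G; set g3 := weierstrass_g3 G.
have H x : 4 * x ^+ 3 - g2 * x - g3 = l * ((x - x1) * (x - x2) * (x - x3)).
  have := congr1 (fun q => q.[x]) E.
  by rewrite /weierstrass_cubic !hornerE.
have n6 : (6 : C) != 0 by rewrite pnatr_eq0.
have l4 : l = 4.
  apply: (mulfI n6); have := H 2; have := H 1; have := H 0; have := H (-1) => h1 h2 h3 h4.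
  have -> : 6 * l = l * ((2 - x1) * (2 - x2) * (2 - x3)) - 3 * (l * ((1 - x1) * (1 - x2) * (1 - x3)))
    + 3 * (l * ((0 - x1) * (0 - x2) * (0 - x3))) - l * ((-1 - x1) * (-1 - x2) * (-1 - x3)) by ring.
  by rewrite -h1 -h2 -h3 -h4; ring.
rewrite l4 in H.
have n8 : (- 8 : C) != 0 by rewrite oppr_eq0 pnatr_eq0.
have s1 : x1 + x2 + x3 = 0.
  apply: (mulfI n8); rewrite mulr0; have := H 1; have := H 0; have := H (-1) => h1 h2 h3.
  have -> : - 8 * (x1 + x2 + x3) = 4 * ((1 - x1) * (1 - x2) * (1 - x3)) + 4 * ((-1 - x1) * (-1 - x2) * (-1 - x3))
    - 2 * (4 * ((0 - x1) * (0 - x2) * (0 - x3))) by ring.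
  by rewrite -h1 -h2 -h3; ring.
have g3E : g3 = 4 * (x1 * x2 * x3).
  have := H 0; rewrite !sub0r expr0n mulr0 mulr0 subr0 sub0r => h.
  by rewrite -[LHS]opprK h; ring.
split=> //; have := H 1; rewrite expr1n !mulr1 g3E => h.
have -> : g2 = 4 - 4 * (x1 * x2 * x3) - (4 - g2 - 4 * (x1 * x2 * x3)) by ring.
rewrite h (_ : x1 = - (x2 + x3)); last by apply/eqP; rewrite -addr_eq0 addrA s1.
by ring.
Qed.

Lemma index_two_coset H G w : subgroup G -> index_two H G -> (G `\` H) w ->
  H (w + w) /\ [set u | H u \/ coset H w u] = G.
Proof.
move=> sG [sH HG [w' _ cov]] [Gw Hw].
have ww : H (w - w') by case: (cov w Gw).
split.
  case: (cov (w + w)) => [|//|h]; first exact: (subgroupD sG).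
  by exfalso; apply: Hw; have := subgroupB sH h ww; have -> : w + w - w' - (w - w') = w by ring.
apply/seteqP; split => u /=.
  by case=> [/HG//|/HG h]; have := subgroupD sG h Gw; rewrite subrK.
move=> /cov[|h]; [by left|right; rewrite /coset /=].
by have := subgroupB sH h ww; have -> : u - w' - (w - w') = u - w by ring.
Qed.

Section IndexTwo.
Variables (G Gh : set C) (w1 w2 : C).
Hypotheses (hG : lattice G) (hGh : index_two Gh G).
Hypotheses (hw1 : (Gh `\` [set 2 * u | u in G]) w1) (hw2 : (G `\` Gh) w2).

(** What the series and the products need from the pair of lattices. The terms are indexed
    by Gh and by its translates by w2 and by the half period w1 / 2, so they are majorised
    over the lattice G / 2, which contains all of these. *)
Lemma index_two_setting : exists (Lam : set C) (delta M rho : R),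
  [/\ ambient Lam delta M, Gh `<=` Lam, Lam w2 /\ Lam (w1 / 2),
    (forall z : C, exists2 u : C, Gh u & cmod (z - u) <= rho) &
    (forall f : C -> C, (forall z, z = 0 \/ ~ G z -> has_deriv f z 0) -> forall z, ~ G z -> f z = f 0)].
Proof.
have [a [b [ab GE]]] := lattice_basis hG; have sG : subgroup G by case: hG.
have [sH HG _] := hGh.
have ab2 : det2 (a / 2) (b / 2) != 0.
  have -> : det2 (a / 2) (b / 2) = det2 a b / 4.
    by rewrite -[2%:R](rmorph_nat (@real_complex R)) -fmorphV /det2; case: (a) (b) => [? ?] [? ?] /=; field.
  by rewrite mulf_neq0// invr_eq0 pnatr_eq0.
have ab' : det2 (2 * a) (2 * b) != 0.
  have -> : det2 (2 * a) (2 * b) = det2 a b * 4.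
    by rewrite -[2%:R](rmorph_nat (@real_complex R)) /det2; case: (a) (b) => [? ?] [? ?] /=; ring.
  by rewrite mulf_neq0// pnatr_eq0.
have [delta [M amb]] := zspan_ambient ab2.
have half u : G u -> zspan (a / 2) (b / 2) (u / 2).
  rewrite GE => /zspanP[m [n ->]]; apply/zspanP; exists m, n; rewrite /real_comb; ring.
have GLam : G `<=` zspan (a / 2) (b / 2).
  move=> u /half h; have := subgroupD (zspan_subgroup _ _) h h.
  by have -> : u / 2 + u / 2 = u by field.
exists (zspan (a / 2) (b / 2)), delta, M, (cmod (2 * a) + cmod (2 * b)); split => //.
- by move=> u /HG/GLam.
- by split; [apply: GLam; case: hw2|apply: half; apply: HG; case: hw1].
- move=> z; have [u /zspanP[m [n uE]] zu] := zspan_cobounded ab' z; exists u => //.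
  have Gv : G (real_comb a b m%:~R n%:~R) by rewrite GE; apply/zspanP; exists m, n.
  have -> : u = real_comb a b m%:~R n%:~R + real_comb a b m%:~R n%:~R by rewrite uE /real_comb; ring.
  move: (real_comb _ _ _ _) Gv => v Gv; have [Hv|Hv] := pselect (Gh v); first exact: subgroupD.
  by case: (index_two_coset sG hGh (conj Gv Hv)).
- by rewrite GE; exact: zspan_off_cst.
Qed.

End IndexTwo.
End Roots.

(** * The values at the half periods *)

Section HalfPeriods.
Variable R : realType.
Local Notation C := R[i].
Variables (Lam L : set C) (delta M rho : R) (w v : C).
Hypothesis amb : ambient Lam delta M.
Hypotheses (subL : subgroup L) (LLam : L `<=` Lam).
Hypotheses (wLam : Lam w) (Lw : ~ L w) (Lww : L (w + w)).
Hypotheses (vLam : Lam v) (Lv : ~ L v) (Lvv : L (v + v)) (Lvw : ~ L (v - w)).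
Hypothesis cocompact : forall z : C, exists2 u : C, L u & cmod (z - u) <= rho.

(** With a = wp w, b = wp v and d = wp (v + w), the constancy of the product of the two
    translates of wp gives (b - a) (d - a) = 3 a ^ 2 - g2 / 4 for the half period w, and the
    same with a and b exchanged for v. Subtract and divide by b - a. *)
Lemma half_period_sum : wp L v != wp L w -> wp L w + wp L v + wp L (v + w) = 0.
Proof.
set a := wp L w; set b := wp L v; set d := wp L (v + w) => ba.
have vw : ~ (L v \/ coset L w v) by case.
have wv : ~ (L w \/ coset L v w).
  by case=> //; rewrite /coset /= => /(subgroupN subL); rewrite opprB.
have Dw : ~ coset L w v by move=> h; apply: vw; right.
have Dv : ~ coset L v w by move=> h; apply: wv; right.
have := wp_gap_coset_cst amb subL LLam wLam Lw Lww cocompact vw.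
rewrite -(wp_gap_shift amb subL LLam wLam Lw Lww Dw) (gap_cst_g2 amb subL LLam wLam Lw Lww cocompact).
have := wp_gap_coset_cst amb subL LLam vLam Lv Lvv cocompact wv.
rewrite -(wp_gap_shift amb subL LLam vLam Lv Lvv Dv) (gap_cst_g2 amb subL LLam vLam Lv Lvv cocompact).
rewrite /wp_gap /half_value [w + v]addrC -/a -/b -/d => E2 E1.
have ba0 : b - a != 0 by rewrite subr_eq0.
apply: (mulfI ba0); rewrite mulr0.
have -> : (b - a) * (a + b + d) = 2^-1 * (((b - a) * (d - a) - (a - b) * (d - b)) -
  (3 * a ^+ 2 - weierstrass_g2 L / 4 - (3 * b ^+ 2 - weierstrass_g2 L / 4))) by field.
by rewrite E1 E2 subrr mulr0.
Qed.

End HalfPeriods.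

(** * The functions of a lattice and of a subgroup of index two *)

Theorem proposition3p4 (R : realType) (G Gh : set R[i])
    (w1 w2 e1 e2 e3 eh1 eh2 eh3 : R[i])
    (hG : lattice G) (hGh : index_two Gh G)
    (hw1 : (Gh `\` [set 2 * u | u in G]) w1) (hw2 : (G `\` Gh) w2)
    (he : cubic_roots (weierstrass_cubic G) e1 e2 e3)
    (he1 : e1 = weierstrass_p G (w1 / 2))
    (heh : cubic_roots (weierstrass_cubic Gh) eh1 eh2 eh3)
    (heh1 : eh1 = weierstrass_p Gh w2) :
  [/\
    (* (i) *)
    (forall z : R[i], ~ G z ->
      [/\ weierstrass_p G z =
            weierstrass_p Gh z
            + ((eh2 - eh1) * (eh3 - eh1)) / (weierstrass_p Gh z - eh1),
          derive1 (weierstrass_p G) z =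
            derive1 (weierstrass_p Gh) z
            * (1 - ((eh2 - eh1) * (eh3 - eh1))
                   / (weierstrass_p Gh z - eh1) ^+ 2)
        & weierstrass_zeta G z =
            2 * weierstrass_zeta Gh z
            + 1 / 2 * (derive1 (weierstrass_p Gh) z
                       / (weierstrass_p Gh z - eh1))
            + eh1 * z]) /\
    (forall z : R[i], ~ Gh z ->
      weierstrass_sigma G z ^+ 2 =
        cexp (eh1 * z ^+ 2) * (weierstrass_p Gh z - eh1)
        * weierstrass_sigma Gh z ^+ 4),
    (* (ii) *)
    eh1 = - (e1 / 2) /\
    16 * (eh2 - eh1) * (eh3 - eh1) = (e2 - e3) ^+ 2
  & (* (iii) *)
    [/\ weierstrass_g2 Gh = 3 * e1 ^+ 2 / 4 + (e1 - e2) * (e1 - e3),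
        weierstrass_g3 Gh =
          - (e1 ^+ 3 / 8) + e1 / 2 * ((e1 - e2) * (e1 - e3))
      & weierstrass_disc Gh =
          1 / 16 * ((e1 - e2) * (e1 - e3) * (e2 - e3) ^+ 4)] ].
Proof.
have [Lam [delta [M [rho [amb LLam [w2Lam vLam] coc cst]]]]] := index_two_setting hG hGh hw1 hw2.
have sG : subgroup G by case: hG.
have [sL LG _] := hGh; have [Gw2 Lw2] := hw2.
have [Lww GE] := index_two_coset sG hGh hw2.
pose v := w1 / 2; have vv : v + v = w1 by rewrite /v; field.
have Gv : ~ G v.
  by case: hw1 => _ h Gv; apply: h; exists v => //; rewrite -vv; ring.
have Lv : ~ Gh v by move=> /LG.
have Lvv : Gh (v + v) by rewrite vv; case: hw1.
have Lvw : ~ Gh (v - w2).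
  by move=> /LG h; apply: Gv; have := subgroupD sG h Gw2; rewrite subrK.
have offE z : ~ G z -> ~ (Gh z \/ coset Gh w2 z) by rewrite -{1}GE.
have cst' (f : R[i] -> R[i]) : (forall z, z = 0 \/ ~ [set u | Gh u \/ coset Gh w2 u] z -> has_deriv f z 0) ->
    forall z, ~ [set u | Gh u \/ coset Gh w2 u] z -> f z = f 0.
  by rewrite GE; exact: cst.
pose P := weierstrass_p Gh.
have wE : wp Gh w2 = eh1 by rewrite heh1.
have eE : half_value Gh w2 = eh1 by [].
pose c := (eh2 - eh1) * (eh3 - eh1).
have [h1 h2 h3] := cubic_roots_vieta heh; have [k1 k2 k3] := cubic_roots_vieta he.
have eh3E : eh3 = - eh1 - eh2 by apply/eqP; rewrite -subr_eq0 -h1; apply/eqP; ring.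
have e3E : e3 = - e1 - e2 by apply/eqP; rewrite -subr_eq0 -k1; apply/eqP; ring.
have cE : c = gap_cst Gh w2.
  by rewrite (gap_cst_g2 amb sL LLam w2Lam Lw2 Lww coc) eE /c h2 eh3E; field.
have p0 z : ~ G z -> P z - eh1 != 0.
  by move=> /offE Gz; rewrite -eE; exact: (wp_gap_neq0 amb sL LLam w2Lam Lw2 Lww coc cst' Gz).
have qE z : ~ G z -> wp_coset Gh w2 z = c / (P z - eh1).
  move=> Gz; apply: (mulfI (p0 _ Gz)); rewrite mulrCA divff ?p0// mulr1 cE.
  by rewrite -eE; exact: (wp_gap_coset_cst amb sL LLam w2Lam Lw2 Lww coc (offE _ Gz)).
have PG z : ~ G z -> weierstrass_p G z = P z + c / (P z - eh1).
  move=> Gz; rewrite -(qE _ Gz) -{1}GE; exact: (wp_index_two amb sL LLam w2Lam Lw2 Lww (offE _ Gz)).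
have DP z : ~ G z -> has_deriv P z (dwp_gap Gh z) /\ exists2 r : R, 0 < r & forall h, cmod h <= r -> ~ G (z + h).
  move=> Gz; have [r r0 far] := ambient_far amb sL LLam w2Lam Lw2 Lww (offE _ Gz).
  have [N J] := jet_wp_gap amb sL LLam r0 far; split.
    apply: (has_deriv_ext (f := fun x => wp_gap Gh w2 x + eh1) r0) => [h hr|]; first by rewrite /wp_gap eE subrK.
    by rewrite -[dwp_gap _ _]addr0; apply: has_derivD; [exact: (jet_has_deriv r0 J)|exact: has_deriv_cst].
  by exists r => // h hr; rewrite -GE; exact: (off_G r0 far hr).
have e1E : e1 = - 2 * eh1.
  have := half_period_sum amb sL LLam w2Lam Lw2 Lww vLam Lv Lvv Lvw coc.
  have qv : P (v + w2) - eh1 = wp_coset Gh w2 v.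
    rewrite -eE.
    apply: (wp_gap_shift amb sL LLam w2Lam Lw2 Lww) => D; apply: Gv.
    by rewrite -GE; right.
  rewrite he1 (PG _ Gv) -(qE _ Gv) -qv -/(P v) -!/(wp Gh _) => E.
  have : wp Gh w2 + wp Gh v + wp Gh (v + w2) = 0.
    by apply: E; rewrite wE -subr_eq0; exact: p0.
  rewrite wE => E'; apply/eqP; rewrite -subr_eq0; apply/eqP.
  by rewrite -[RHS]E' /P /wp; ring.
have gE : weierstrass_g2 G = weierstrass_g2 Gh + 20 * c.
  by rewrite cE -{1}GE; exact: (g2_index_two amb sL LLam w2Lam Lw2 Lww).
have g2c : weierstrass_g2 Gh = 12 * eh1 ^+ 2 - 4 * c by rewrite h2 eh3E /c eh3E; ring.
have g3c : weierstrass_g3 Gh = 4 * eh1 * (c - 2 * eh1 ^+ 2) by rewrite h3 eh3E /c eh3E; ring.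
(* The second symmetric function of e1 = - 2 eh1, e2 and e3 in two ways. *)
have cQ : c = (e2 - eh1) ^+ 2 / 4.
  have n16 : (16 : R[i]) != 0 by rewrite pnatr_eq0.
  apply: (mulfI n16); have -> : 16 * c = weierstrass_g2 G - 12 * eh1 ^+ 2 by rewrite gE g2c; ring.
  by rewrite k2 e3E e1E; field.
split.
- split.
    move=> z Gz; rewrite -/c -/P; have [dP [r r0 far]] := DP _ Gz.
    have dPG : has_deriv (weierstrass_p G) z (dwp_gap Gh z * (1 - c / (P z - eh1) ^+ 2)).
      apply: (has_deriv_ext (f := fun x => P x + c * (P x - eh1)^-1) r0) => [h hr|].
        by rewrite PG//; exact: far.
      have dV := has_derivV (p0 _ Gz : (fun x => P x - eh1) z != 0) (has_derivB dP (has_deriv_cst eh1 z)).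
      suff -> : dwp_gap Gh z * (1 - c / (P z - eh1) ^+ 2) =
        dwp_gap Gh z + c * (- ((dwp_gap Gh z - 0) / (P z - eh1) ^+ 2)) by apply: has_derivD => //; exact: has_derivZ.
      by field; exact: p0.
    rewrite (has_deriv_derive1 dPG) (has_deriv_derive1 dP); split; [exact: PG|by []|].
    rewrite (wp_gap_ode amb sL LLam w2Lam Lw2 Lww coc (offE _ Gz)) -{1}GE.
    rewrite (wzeta_index_two amb sL LLam w2Lam Lw2 Lww (offE _ Gz)) /wp_gap /half_value /wzeta.
    rewrite wE -[wp Gh z]/(P z); field; exact: p0.
  move=> z Lz; have := sigma_isogeny amb sL LLam w2Lam Lw2 Lww coc cst' Lz.
  by rewrite GE /wp_gap eE.
- split; first by rewrite e1E; field.
  by rewrite -mulrA -/c cQ e3E e1E; field.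
- by split; rewrite /weierstrass_disc ?g2c ?g3c cQ e3E e1E; field.
Qed.
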